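(* Let $p_k\searrow1$ as $k\to\infty$, let $\varphi_k:\mathcal{C}\Omega\to\mathbb{R}$ be such that $$\sup_{k\in\mathbb{N}}\operatorname{Tail}_s^{p_k}(\varphi_k,\mathcal{C}\Omega;\cdot)\in L^1(\Omega),\qquad \varphi_k\to\varphi\ \text{ a.e. in }\mathcal{C}\Omega\ \text{ as }k\to\infty,$$ and let $u_{p_k}\in\mathcal{W}^{s,p_k}_{\varphi_k}(\Omega)$ be a sequence of $(s,p_k)$-minimizers in $\Omega$. Then there exist a subsequence $p_{k_j}\searrow1$ and a function $u_1\in\mathcal{W}^{s,1}_\varphi(\Omega)$ such that $$u_{p_{k_j}}\to u_1\quad\text{in }L^1(\Omega)\text{ and a.e. in }\mathbb{R}^n,\ \text{ as } j\to\infty.$$ Furthermore, $\operatorname{Tail}_s^1(\varphi,\mathcal{C}\Omega;\cdot)\in L^1(\Omega)$ and $u_1$ is an $(s,1)$-minimizer in $\Omega$.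
   Context: Throughout, $\Omega\subset\mathbb{R}^n$ is a bounded open set with Lipschitz boundary, $s\in(0,1)$, $p_k\in(1,\infty)$, and $\mathcal{C}\Omega:=\mathbb{R}^n\setminus\Omega$. Set $Q(\Omega):=\mathbb{R}^{2n}\setminus(\mathcal{C}\Omega)^2$. For $q\in[1,\infty)$ and measurable $u:\mathbb{R}^n\to\mathbb{R}$, $$\mathcal{E}_s^q(u):=\frac1{2q}\iint_{Q(\Omega)}\frac{|u(x)-u(y)|^q}{|x-y|^{n+sq}}\,dx\,dy.$$ $W^{s,q}(\Omega)$ is the space of $u\in L^q(\Omega)$ with $[u]_{W^{s,q}(\Omega)}:=\left(\int_\Omega\int_\Omega\frac{|u(x)-u(y)|^q}{|x-y|^{n+sq}}\,dx\,dy\right)^{1/q}<\infty$. Set $\mathcal{W}^{s,q}(\Omega):=\{u:\mathbb{R}^n\to\mathbb{R}\text{ measurable}: u|_\Omega\in W^{s,q}(\Omega)\}$ and $\mathcal{W}^{s,q}_\varphi(\Omega):=\{u\in\mathcal{W}^{s,q}(\Omega): u=\varphi\text{ a.e. in }\mathcal{C}\Omega\}$. A function $u\in\mathcal{W}^{s,q}(\Omega)$ is an $(s,q)$-minimizer in $\Omega$ if $\mathcal{E}_s^q(u)<\infty$ and $\mathcal{E}_s^q(u)\le\mathcal{E}_s^q(v)$ for all $v\in\mathcal{W}^{s,q}(\Omega)$ with $v=u$ a.e. in $\mathcal{C}\Omega$. The nonlocal tail is $\operatorname{Tail}_s^q(u,\mathcal{C}\Omega;x):=\int_{\mathcal{C}\Omega}\frac{|u(y)|^q}{|x-y|^{n+sq}}\,dy$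 for $x\in\Omega$; the supremum over $k$ is taken pointwise in $x\in\Omega$. *)

(* Defs.v *)
From HB Require Import structures.
From mathcomp Require Import all_boot all_order all_algebra.
From mathcomp Require Import all_classical all_reals all_analysis.

Set Implicit Arguments.
Unset Strict Implicit.
Unset Printing Implicit Defensive.

Import Order.TTheory GRing.Theory Num.Theory numFieldNormedType.Exports.

Local Open Scope classical_set_scope.
Local Open Scope ring_scope.

(* Points of R^n are row vectors; [borelRn R n] is 'rV[R]_n with the product of
   n copies of the Borel sigma-algebra of R. *)
Definition borelRn (R : realType) (n : nat) : Type := 'rV[R]_n.

Definition borelRn_display : measure_display. Proof. exact: default_measure_display. Qed.

Section borelRn.
Context {R : realType} {n : nat}.

HB.instance Definition _ := Pointed.on (borelRn R n).

Definition coordRn (i : 'I_n) (x : borelRn R n) : measurableTypeR R :=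
  (x : 'rV[R]_n) ord0 i.

Let borelRn_set0 : g_sigma_preimage coordRn set0.
Proof. exact: sigma_algebra0. Qed.

Let borelRn_setC A : g_sigma_preimage coordRn A -> g_sigma_preimage coordRn (~` A).
Proof. exact: sigma_algebraC. Qed.

Let borelRn_bigcup (F : (set _)^nat) :
  (forall i, g_sigma_preimage coordRn (F i)) ->
  g_sigma_preimage coordRn (\bigcup_i F i).
Proof. exact: sigma_algebra_bigcup. Qed.

HB.instance Definition _ := @isMeasurable.Build borelRn_display (borelRn R n)
  (g_sigma_preimage coordRn) borelRn_set0 borelRn_setC borelRn_bigcup.

End borelRn.

Definition consRn (R : realType) (n : nat)
    (z : measurableTypeR R * borelRn R n) : borelRn R n.+1 :=
  row_mx (z.1%:M : 'rV[R]_1) (z.2 : 'rV[R]_n) : 'rV[R]_(1 + n).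

Lemma measurable_coordRn (R : realType) (n : nat) (i : 'I_n) :
  measurable_fun [set: borelRn R n] (coordRn i).
Proof.
move=> _ Y mY; rewrite setTI; apply: sub_sigma_algebra.
rewrite -bigcup_seq/=; exists i => /=; first by rewrite mem_index_enum.
by exists Y => //; rewrite setTI.
Qed.

Lemma coordRn_measurable_fun d (T : measurableType d) (R : realType) (n : nat)
    (f : T -> borelRn R n) :
  (forall i, measurable_fun setT (coordRn i \o f)) -> measurable_fun setT f.
Proof.
move=> mf _ A; rewrite setTI => mA.
suff : g_sigma_preimage (@coordRn R n) `<=` [set B | measurable (f @^-1` B)].
  exact.
apply: smallest_sub.
  split=> [|B /= mB|F /= mF].
  - by rewrite /= preimage_set0.
  - by rewrite setTD -preimage_setC; exact: measurableC.
  - by rewrite preimage_bigcup; exact: bigcup_measurable.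
rewrite -bigcup_seq => B [i _ [C mC <-]] /=.
by rewrite setTI -comp_preimage -[X in measurable X]setTI; exact: mf.
Qed.

Lemma consRnEl (R : realType) (n : nat) (z : measurableTypeR R * borelRn R n)
    (i : 'I_1) : coordRn (lshift n i) (consRn z) = z.1.
Proof.
apply: etrans; first exact: row_mxEl.
by rewrite mxE (ord1 i).
Qed.

Lemma measurable_consRn (R : realType) (n : nat) :
  measurable_fun setT (@consRn R n).
Proof.
apply: coordRn_measurable_fun => i.
case: (@split_ordP 1 n i) => j ->.
- rewrite (_ : _ \o _ = fst)//; apply/funext => z.
  exact: consRnEl.
- rewrite (_ : _ \o _ = coordRn j \o snd); last first.
    by apply/funext => z; exact: row_mxEr.
  by apply: measurableT_comp; [exact: measurable_coordRn|exact: measurable_snd].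
Qed.

Section borel_lebesgueS.
Local Open Scope ereal_scope.
Context (R : realType) (n : nat).
Variable m : {sigma_finite_measure set (borelRn R n) -> \bar R}.

Definition borel_lebesgueS (A : set (borelRn R n.+1)) : \bar R :=
  (@lebesgue_measure R \x m) (@consRn R n @^-1` A).

Let mpre (A : set (borelRn R n.+1)) :
  measurable A -> measurable (@consRn R n @^-1` A).
Proof. by move=> mA; rewrite -[X in measurable X]setTI; exact: measurable_consRn. Qed.

Let borel_lebesgueS0 : borel_lebesgueS set0 = 0.
Proof. by rewrite /borel_lebesgueS preimage_set0 measure0. Qed.

Let borel_lebesgueS_ge0 A : 0 <= borel_lebesgueS A.
Proof. exact: measure_ge0. Qed.

Let borel_lebesgueS_sigma_additive : semi_sigma_additive borel_lebesgueS.
Proof.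
move=> F mF tF mUF; rewrite /borel_lebesgueS preimage_bigcup.
apply: measure_semi_sigma_additive.
- by move=> i; exact: mpre.
- apply/trivIsetP => i j _ _ ij; rewrite -preimage_setI.
  by move/trivIsetP : tF => /(_ _ _ _ _ ij) ->//; rewrite preimage_set0.
- by rewrite -preimage_bigcup; exact: mpre.
Qed.

HB.instance Definition _ := isMeasure.Build _ _ _ borel_lebesgueS
  borel_lebesgueS0 borel_lebesgueS_ge0 borel_lebesgueS_sigma_additive.

Let borel_lebesgueS_sigma_finite : sigma_finite setT borel_lebesgueS.
Proof.
have [F TF Foo] := sigma_finiteT (@lebesgue_measure R).
have [G TG Goo] := sigma_finiteT m.
have /card_esym/ppcard_eqP[e] := card_nat2.
pose uncons (x : borelRn R n.+1) : measurableTypeR R * borelRn R n :=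
  (coordRn (lshift n (ord0 : 'I_1)) (x : borelRn R (1 + n)), rsubmx (x : 'rV[R]_(1 + n))).
have consK : cancel (@consRn R n) uncons.
  move=> [a v]; congr pair; last exact: row_mxKr.
  exact: consRnEl.
have muncons : measurable_fun setT uncons.
  apply/measurable_fun_pairP; split; first exact: measurable_coordRn.
  apply: coordRn_measurable_fun => i.
  rewrite (_ : _ \o _ = coordRn (rshift 1 i)); first exact: measurable_coordRn.
  by apply/funext => x; rewrite /coordRn /= mxE.
exists (fun k => uncons @^-1` (F (e k).1 `*` G (e k).2)).
  rewrite -preimage_bigcup (_ : \bigcup_i _ = setT) ?preimage_setT//.
  apply/seteqP; split=> // -[a v] _.
  have [i _ Fi] : (\bigcup_i F i) a by rewrite -TF.
  have [j _ Gj] : (\bigcup_i G i) v by rewrite -TG.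
  by exists (e^-1%FUN (i, j)) => //; rewrite invK ?inE.
move=> k; have [mFk Fk] := Foo (e k).1; have [mGk Gk] := Goo (e k).2.
split; first by rewrite -[X in measurable X]setTI; apply: muncons => //; exact: measurableX.
rewrite /borel_lebesgueS -comp_preimage (_ : uncons \o _ = id); last first.
  exact/funext.
rewrite preimage_id product_measure1E//.
by rewrite lte_mul_pinfty// ge0_fin_numE.
Qed.

HB.instance Definition _ := Measure_isSigmaFinite.Build _ _ _ borel_lebesgueS
  borel_lebesgueS_sigma_finite.

End borel_lebesgueS.

(* On Borel sets, Lebesgue measure on R^n is the n-fold product of the
   one-dimensional one. *)
Fixpoint borel_lebesgue (R : realType) (n : nat) :
    {sigma_finite_measure set (borelRn R n) -> \bar R} :=
  match n with
  | 0 => @dirac _ (borelRn R 0) (0 : 'rV[R]_0) R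
  | k.+1 => borel_lebesgueS (borel_lebesgue R k)
  end.

(* 'rV[R]_n with the complete sigma-algebra of Lebesgue-measurable sets, so that
   measurability and integrals below are meant in the sense of Lebesgue. *)
Definition lebesgueRn (R : realType) (n : nat) :=
  caratheodory_type (borel_lebesgue R n)^*%mu.

Section lebesgue.
Context {R : realType} {n : nat}.

Definition lebesgue : set (lebesgueRn R n) -> \bar R :=
  @completed_measure_extension _ _ _ (borel_lebesgue R n).

HB.instance Definition _ := Measure.on lebesgue.

Let lebesgue_sigma_finite : sigma_finite setT lebesgue.
Proof. exact/completed_measure_extension_sigma_finite/sigma_finiteT. Qed.

HB.instance Definition _ :=
  Measure_isSigmaFinite.Build _ _ _ lebesgue lebesgue_sigma_finite.

End lebesgue.

Section euclidean.
Context {R : realType} {n : nat}.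
Implicit Types x y : 'rV[R]_n.

Definition dotp x y : R := \sum_(i < n) x ord0 i * y ord0 i.

(* The norm of the library on 'rV[R]_n is the sup norm. *)
Definition enorm x : R := Num.sqrt (dotp x x).

(* Near each boundary point, Omega is the strict epigraph of a Lipschitz
   function: nu is the direction of the last axis of a suitable orthonormal
   system, <x, nu> the last coordinate of x, and the orthogonal projection
   x - <x, nu> nu stands for the remaining n - 1 coordinates; only the values of
   gamma on the hyperplane orthogonal to nu matter. *)
Definition lipschitz_boundary (Omega : set 'rV[R]_n) : Prop :=
  forall z, closure Omega z -> closure (~` Omega) z ->
  exists (nu : 'rV[R]_n) (r : R) (gamma : 'rV[R]_n -> R),
    [/\ enorm nu = 1, 0 < r,
        exists L : R, forall x y, `|gamma x - gamma y| <= L * enorm (x - y) &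
        forall x, enorm (x - z) < r ->
          (Omega x <-> gamma (x - dotp x nu *: nu) < dotp x nu)].

End euclidean.

Section fractional.
Local Open Scope ereal_scope.
Context {R : realType} {n : nat}.
Local Notation Rn := (lebesgueRn R n).
Implicit Types (Omega : set Rn) (s q : R) (u v phi : Rn -> R).

(* At x = y this is 0 (0 `^ a = 0 for a != 0, and 0^-1 = 0); the diagonal is
   negligible as soon as n > 0. *)
Definition frac_kernel s q (x y : 'rV[R]_n) : R :=
  (enorm (x - y) `^ (n%:R + s * q))^-1.

Definition frac_quot s q u (x y : Rn) : \bar R :=
  (`|u x - u y| `^ q * frac_kernel s q x y)%:E.

Definition crossQ Omega : set (Rn * Rn) := ~` (~` Omega `*` ~` Omega).

(* No completion of the product is needed: if u is Lebesgue measurable then the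
   integrand and crossQ Omega, for open Omega, are measurable for the product of
   the two Lebesgue sigma-algebras. *)
Definition energy Omega s q u : \bar R :=
  ((2 * q)^-1)%:E *
  \int[lebesgue \x lebesgue]_(z in crossQ Omega) frac_quot s q u z.1 z.2.

Definition gagliardo Omega s q u : \bar R :=
  (\int[lebesgue]_(y in Omega) \int[lebesgue]_(x in Omega) frac_quot s q u x y)
  `^ q^-1.

Definition inLq Omega q u : Prop :=
  measurable_fun Omega u /\
  \int[lebesgue]_(x in Omega) (`|u x| `^ q)%:E < +oo.

Definition inWsq Omega s q u : Prop :=
  inLq Omega q u /\ gagliardo Omega s q u < +oo.

Definition calW Omega s q : set (Rn -> R) :=
  [set u | measurable_fun setT u /\ inWsq Omega s q u].

(* Exterior data are functions on the complement of Omega: their values in Omega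
   are never used. *)
Definition calW_ext Omega s q phi : set (Rn -> R) :=
  [set u | calW Omega s q u /\ ae_eq lebesgue (~` Omega) u phi].

Definition minimizer Omega s q u : Prop :=
  [/\ calW Omega s q u, energy Omega s q u < +oo &
      forall v, calW Omega s q v -> ae_eq lebesgue (~` Omega) v u ->
        energy Omega s q u <= energy Omega s q v].

Definition tail Omega s q phi (x : Rn) : \bar R :=
  \int[lebesgue]_(y in ~` Omega) (`|phi y| `^ q * frac_kernel s q x y)%:E.

End fractional.

Definition decreases_to (R : realType) (p : nat -> R) (l : R) : Prop :=
  nonincreasing_seq p /\ p k @[k --> \oo] --> l.

(* Main.v *)
Require Import Defs.
From HB Require Import structures.
From mathcomp Require Import all_boot all_order all_algebra.
From mathcomp Require Import all_classical all_reals all_analysis.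
From mathcomp Require Import measurable_realfun.
From mathcomp Require Import ring lra.

Set Implicit Arguments.
Unset Strict Implicit.
Unset Printing Implicit Defensive.

Import Order.TTheory GRing.Theory Num.Theory numFieldNormedType.Exports.

Local Open Scope classical_set_scope.
Local Open Scope ring_scope.

(** For a symmetric kernel the energy is 1/(2q) times I + 2X, where I integrates
    |u x - u y|^q |x - y|^-(n+sq) over Omega x Omega and X over
    Omega x ~Omega (energy_dint). Testing the minimality of u_k with the
    function that vanishes in Omega bounds I + 2X by twice the integral of the
    tail of the exterior datum, uniformly in k (minimizer_bound).

    Compactness. Extended by zero, u_k has bounded fractional seminorm over the
    whole space (zero_extension_bound) and bounded L^1 norm (L1_bound), because
    the mass kappa of the kernel outside Omega is bounded below on Omega. A
    mollification at scale e differs from u_k in L^1(Omega) by a constant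
    times e^s, uniformly for p_k in [1, 2] (mollify_close), and at a fixed
    scale the mollifications are equi-Lipschitz, hence uniformly Cauchy along
    an ultrafilter by the argument of Arzela and Ascoli
    (ultra_uniform_cauchy). A subsequence with summable L^1 distances follows
    (seminorm_compactness); it converges almost everywhere in Omega and in
    L^1, and outside Omega it converges to phi by assumption.

    Minimality of the limit against a Lipschitz competitor w that vanishes near
    the boundary. The part I is lower semicontinuous along u_k by Fatou's lemma
    and converges for w by dominated convergence (lip_seminorm_cvg). The
    interactions A_k of u_k and B_k of w with the exterior datum of u_k need not
    converge, since the exterior data converge only almost everywhere and mass
    may escape. But |u_k x - u_k y|^p - |w x - u_k y|^p is, up to factors
    2^(p-1) which tend to 1, bounded below by - |w x - u_k x|^p, so that Fatou's
    lemma applies to the difference A_k - B_k, first in y (inner_limit) and then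
    in x, where the integrable supremum of the tails dominates (outer_limit).
    The numbers B_k then cancel between this lower bound and the minimality of
    u_k (combine_limits, limit_minimal_lip).

    Density. An arbitrary competitor v of finite energy is approximated by such
    functions w in energy and in L^1 with weight kappa (lipschitz_density). It
    is first multiplied by cutoffs max(0, 1 - dl/depth), which converge because
    depth^-s is bounded by kappa: this is the fractional Hardy inequality, and
    the only place where the regularity of the boundary enters, through boxes of
    the complement of size and distance comparable to the depth
    (exterior_ball). It is then mollified; by Jensen's inequality and
    translation invariance this does not increase the seminorm over the whole
    space (mollify_energy), which for functions vanishing off Omega equals I
    plus twice the kappa-weighted norm (seminorm_split), and the second summand
    converges. *)

(** * Lebesgue measure on R^n *)

Section lebesgue_basics.
Context {R : realType} {n : nat}.
Local Notation Rn := (lebesgueRn R n).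
Local Notation Bn := (borelRn R n).
Local Notation leb := (@lebesgue R n).

Lemma borel_lebesgue_measurable (A : set Bn) :
  measurable A -> measurable (A : set Rn).
Proof. by move=> mA; apply: sub_caratheodory; exact: sub_sigma_algebra. Qed.

Lemma lebesgue_borelE (A : set Bn) : measurable A -> leb A = borel_lebesgue R n A.
Proof. by move=> mA; rewrite /lebesgue /completed_measure_extension measurable_mu_extE. Qed.

Lemma measurable_id_borel : measurable_fun [set: Rn] (fun x : Rn => x : Bn).
Proof. by move=> _ A mA; rewrite setTI; exact: borel_lebesgue_measurable. Qed.

Lemma lebesgue_complete : measure_is_complete leb.
Proof. exact: measure_is_complete_caratheodory. Qed.

Lemma measurable_coord (i : 'I_n) :
  measurable_fun [set: Rn] (fun x : Rn => (x : 'rV[R]_n) ord0 i).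
Proof.
apply: (@measurableT_comp _ _ _ _ _ _ (@coordRn R n i) _ (fun x : Rn => x : Bn)).
  exact: measurable_coordRn.
exact: measurable_id_borel.
Qed.

Lemma measurable_fun_to_borel d (T : measurableType d) (f : T -> 'rV[R]_n) :
  (forall i, measurable_fun setT (fun x => f x ord0 i)) ->
  measurable_fun [set: T] (f : T -> Bn).
Proof. by move=> mf; exact: coordRn_measurable_fun. Qed.

End lebesgue_basics.

Section translation.
Context {R : realType}.

Lemma lebesgue_measure_translate (a : R) (A : set (measurableTypeR R)) :
  measurable A -> lebesgue_measure ((fun x : R => x + a) @^-1` A) = lebesgue_measure A.
Proof.
move=> mA.
have mf : measurable_fun setT (fun x : measurableTypeR R => x + a : measurableTypeR R).
  exact: measurable_funD.
pose f : {mfun (measurableTypeR R) >-> (measurableTypeR R)} := HB.pack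
  (fun x : measurableTypeR R => x + a : measurableTypeR R)
  (isMeasurableFun.Build _ _ _ _ _ mf).
rewrite [RHS](@lebesgue_measure_unique R (pushforward (@lebesgue_measure R) f))//.
move=> _ [[x y] _ <-].
have E : f @^-1` `]x, y]%classic = [set` `]x - a, y - a]].
  by apply/seteqP; split => z /=; rewrite !in_itv/= ltrBlDr lerBrDr.
change (lebesgue_measure `]x, y]%classic = lebesgue_measure (f @^-1` `]x, y]%classic)).
rewrite E !lebesgue_measure_itv/= !lte_fin ltrD2r -!EFinD.
by case: ifP => // _; congr (_%:E); ring.
Qed.

Lemma measurable_translate n (a : 'rV[R]_n) :
  measurable_fun [set: borelRn R n] (fun x : borelRn R n => (x : 'rV[R]_n) + a : borelRn R n).
Proof.
apply: coordRn_measurable_fun => i.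
rewrite (_ : _ \o _ = (coordRn i : _ -> R) \+ cst (a ord0 i)).
  by apply: measurable_funD => //; exact: measurable_coordRn.
by apply/funext => x; rewrite /coordRn/= mxE.
Qed.

(** The induction step compares two measures on a product of lower dimensional
    spaces, which agree as soon as they agree on rectangles. *)
Lemma borel_lebesgue_translate n (a : 'rV[R]_n) (A : set (borelRn R n)) :
  measurable A ->
  borel_lebesgue R n ((fun x : borelRn R n => (x : 'rV[R]_n) + a : borelRn R n) @^-1` A)
    = borel_lebesgue R n A.
Proof.
elim: n a A => [a A mA|n IH a A mA].
  by congr (borel_lebesgue R 0 _); apply/seteqP; split => x /=; rewrite (thinmx0 x) (thinmx0 (_ + _)).
rewrite /= /borel_lebesgueS.
pose a1 : R := (a : 'rV[R]_(1 + n)) ord0 (lshift n ord0).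
pose a2 : 'rV[R]_n := rsubmx (a : 'rV[R]_(1 + n)).
pose f (z : measurableTypeR R * borelRn R n) : measurableTypeR R * borelRn R n :=
  (z.1 + a1, (z.2 : 'rV[R]_n) + a2).
have mf : measurable_fun setT f.
  apply/measurable_fun_pairP; split.
    by apply: measurable_funD => //; exact: measurable_fst.
  apply: (@measurableT_comp _ _ _ _ _ _ (fun x : borelRn R n => (x : 'rV[R]_n) + a2 : borelRn R n)).
    exact: measurable_translate.
  exact: measurable_snd.
pose f' : {mfun _ >-> _} := HB.pack f (isMeasurableFun.Build _ _ _ _ _ mf).
have -> : @consRn R n @^-1` ((fun x : borelRn R n.+1 => (x : 'rV[R]_n.+1) + a : borelRn R n.+1) @^-1` A)
    = f @^-1` (@consRn R n @^-1` A).
  apply/funext => -[x y]; rewrite /preimage/=; congr A.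
  apply/rowP => i; rewrite mxE.
  case: (@split_ordP 1 n i) => j ->.
    have E z : consRn z ord0 (lshift n j) = z.1 by exact: (consRnEl z j).
    by rewrite !E/= /a1 (ord1 j).
  have E z : consRn z ord0 (rshift 1 j) = (z.2 : 'rV[R]_n) ord0 j by exact: row_mxEr.
  by rewrite !E !mxE.
have mcA : measurable (@consRn R n @^-1` A).
  by rewrite -[X in measurable X]setTI; exact: measurable_consRn.
rewrite [RHS](@product_measure_unique _ _ _ _ _ _ _ (pushforward (lebesgue_measure \x borel_lebesgue R n)%E f'))//.
move=> B C mB mC.
transitivity ((lebesgue_measure \x borel_lebesgue R n)%E (((fun x : R => x + a1) @^-1` B) `*`
  ((fun x : borelRn R n => (x : 'rV[R]_n) + a2 : borelRn R n) @^-1` C))) => //.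
have mB' : measurable ((fun x : measurableTypeR R => x + a1 : measurableTypeR R) @^-1` B).
  rewrite -[X in measurable X]setTI.
  by apply: (@measurable_funD _ (measurableTypeR R) R setT id (cst a1)).
have mC' : measurable ((fun x : borelRn R n => (x : 'rV[R]_n) + a2 : borelRn R n) @^-1` C).
  by rewrite -[X in measurable X]setTI; exact: measurable_translate.
rewrite product_measure1E// IH//; congr (_ * _)%E.
exact: lebesgue_measure_translate.
Qed.

End translation.

Section boxes.
Context {R : realType}.

Lemma mx_norm_ltP n (x : 'rV[R]_n) r : 0 < r ->
  reflect (forall i, `|x ord0 i| < r) (`|x| < r).
Proof.
move=> r0; apply: (iffP idP) => [xr i|xr].
  apply: le_lt_trans xr; rewrite /Num.norm/= mx_normrE.
  by apply: (le_bigmax _ (fun ij : 'I_1 * 'I_n => `|x ij.1 ij.2|) (ord0, i)).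
by rewrite /Num.norm/= mx_normrE; apply/bigmax_ltP; split => // -[i j] _ /=; rewrite (ord1 i).
Qed.

Lemma mx_norm_coord n (x : 'rV[R]_n) i : `|x ord0 i| <= `|x|.
Proof.
rewrite [leRHS]/Num.norm/= mx_normrE.
by apply: (le_bigmax _ (fun ij : 'I_1 * 'I_n => `|x ij.1 ij.2|) (ord0, i)).
Qed.

Definition box n (x : 'rV[R]_n) (r : R) : set (borelRn R n) :=
  [set y | forall i, `|(y : 'rV[R]_n) ord0 i - x ord0 i| < r].

Lemma boxE n (x : 'rV[R]_n) r : 0 < r -> box x r = [set y | `|(y : 'rV[R]_n) - x| < r].
Proof.
move=> r0; apply/seteqP; split => y /= h.
  by apply/mx_norm_ltP => // i; rewrite !mxE.
by move=> i; have /(mx_norm_ltP _ r0)/(_ i) := h; rewrite !mxE.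
Qed.

Lemma measurable_box n (x : 'rV[R]_n) r : measurable (box x r).
Proof.
have -> : box x r = \bigcap_(i in [set: 'I_n]) (coordRn i @^-1` `]x ord0 i - r, x ord0 i + r[%classic).
  apply/seteqP; split => y /= h i; first by move=> _; rewrite /= in_itv/= -ltr_distl; exact: h.
  by have := h i I; rewrite /= in_itv/= -ltr_distl.
apply: fin_bigcap_measurable => // i _.
by rewrite -[X in measurable X]setTI; exact: measurable_coordRn.
Qed.

Lemma borel_lebesgue_box n (x : 'rV[R]_n) r : 0 < r ->
  borel_lebesgue R n (box x r) = ((2 * r) ^+ n)%:E.
Proof.
move=> r0; elim: n x => [x|n IH x] /=.
  by rewrite expr0 diracE mem_set// => -[].
rewrite /borel_lebesgueS.
pose x2 : 'rV[R]_n := rsubmx (x : 'rV[R]_(1 + n)).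
pose x1 : R := (x : 'rV[R]_(1 + n)) ord0 (lshift n ord0).
have El (z : measurableTypeR R * borelRn R n) (j : 'I_1) : consRn z ord0 (lshift n j) = z.1 by exact: (consRnEl z j).
have Er z j : consRn z ord0 (rshift 1 j) = (z.2 : 'rV[R]_n) ord0 j by exact: row_mxEr.
have -> : @consRn R n @^-1` box x r = `]x1 - r, x1 + r[%classic `*` box x2 r.
  apply/seteqP; split => -[y1 y2] /=.
    move=> h; split.
      by rewrite /= in_itv/= -ltr_distl; have := h (lshift n (ord0 : 'I_1)); rewrite El.
    by move=> i; have := h (rshift 1 i : 'I_(1 + n)); rewrite Er mxE.
  move=> [/=]; rewrite in_itv/= -ltr_distl => h1 h2 i.
  case: (@split_ordP 1 n i) => j ->; first by rewrite El/= (ord1 j).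
  by rewrite Er/=; have := h2 j; rewrite mxE.
rewrite product_measure1E//; last exact: measurable_box.
rewrite [X in (X * _)%E]lebesgue_measure_itv/= lte_fin IH ifT; last by lra.
by rewrite -EFinD -EFinM exprS; congr (_ * _)%:E; lra.
Qed.

End boxes.

Section borel_sets.
Context {R : realType} {n : nat}.
Local Notation Rn := (lebesgueRn R n).
Local Notation Bn := (borelRn R n).
Local Notation leb := (@lebesgue R n).

Lemma open_borel (U : set 'rV[R]_n) : open U -> measurable (U : set Bn).
Proof.
move=> oU.
pose c (q : 'rV[rat]_n) : 'rV[R]_n := \row_i ratr (q ord0 i).
have -> : U = \bigcup_(qk in [set qk : 'rV[rat]_n * nat | box (c qk.1) qk.2.+1%:R^-1 `<=` U])
   box (c qk.1) qk.2.+1%:R^-1.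
  apply/seteqP; split => [y Uy|y [qk /= h] /h//].
  have [e /= e0 eU] : exists2 e : R, 0 < e & ball y e `<=` U.
    by apply/nbhs_ballP; apply: open_nbhs_nbhs.
  near \oo => k.
  have k0 : 0 < k.+1%:R^-1 :> R by rewrite invr_gt0.
  have ke : k.+1%:R^-1 < e / 2 by near: k; apply: near_infty_natSinv_lt (PosNum _); rewrite divr_gt0.
  have h (i : 'I_n) : exists q : rat, `|y ord0 i - ratr q| < k.+1%:R^-1.
    have : y ord0 i - k.+1%:R^-1 < y ord0 i by rewrite ltrBlDr ltrDl.
    move=> /rat_in_itvoo[q]; rewrite in_itv/= => /andP[q1 q2]; exists q.
    by rewrite gtr0_norm ?subr_gt0// ltrBlDr -ltrBlDl.
  have [q hq] := choice h.
  exists (\row_i q i, k) => /=.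
    move=> z; rewrite boxE//= => hz; apply: eU.
    rewrite -ball_normE/=.
    have -> : y - z = (y - c (\row_i q i)) - (z - c (\row_i q i)) by rewrite opprB addrA subrK.
    apply: le_lt_trans (ler_normB _ _) _.
    have : `|y - c (\row_i q i)| < k.+1%:R^-1 by apply/mx_norm_ltP => // i; rewrite !mxE.
    move: hz => /[swap] h1 h2; apply: lt_trans (ltrD h1 h2) _.
    by move: ke; rewrite ltr_pdivlMr// mulr_natr mulr2n.
  by move=> i; rewrite !mxE.
rewrite bigcup_mkcond; apply: countable_bigcupT_measurable => // qk.
by case: ifP => // _; exact: measurable_box.
Unshelve. all: by end_near. Qed.

Lemma continuous_borel (f : 'rV[R]_n -> R) : continuous f -> measurable_fun [set: Bn] f.
Proof.
move=> /continuousP cf; apply: (measurability _ (RGenOpens.measurableE R)).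
by move=> _ [_ [a [b ->]] <-]; rewrite setTI; apply: open_borel; apply: cf; exact: interval_open.
Qed.

Lemma open_lebesgue (U : set 'rV[R]_n) : open U -> measurable (U : set Rn).
Proof. by move=> oU; apply: borel_lebesgue_measurable; exact: open_borel. Qed.

Lemma continuous_lebesgue (f : 'rV[R]_n -> R) : continuous f -> measurable_fun [set: Rn] f.
Proof.
move=> cf; apply: (@measurableT_comp _ _ _ _ _ _ (f : Bn -> R) _ (fun x : Rn => x : Bn)).
  exact: continuous_borel.
exact: measurable_id_borel.
Qed.

Lemma ge0_integral_translate (a : 'rV[R]_n) (f : Bn -> \bar R) :
  measurable_fun setT f -> (forall x, 0 <= f x)%E ->
  (\int[leb]_x f ((x : 'rV[R]_n) + a)%R = \int[leb]_x f x)%E.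
Proof.
move=> mf f0.
have mT : measurable_fun [set: Rn] (fun x : Rn => (x : 'rV[R]_n) + a : Bn).
  exact: (measurableT_comp (@measurable_translate R n a) measurable_id_borel).
pose g : {mfun Rn >-> Bn} := HB.pack (fun x : Rn => (x : 'rV[R]_n) + a : Bn)
  (isMeasurableFun.Build _ _ _ _ _ mT).
pose h : {mfun Rn >-> Bn} := HB.pack (fun x : Rn => x : Bn)
  (isMeasurableFun.Build _ _ _ _ _ measurable_id_borel).
transitivity (\int[pushforward leb g]_x f x)%E.
  by rewrite ge0_integral_pushforward.
transitivity (\int[pushforward leb h]_x f x)%E; last first.
  by rewrite ge0_integral_pushforward//; exact: measurable_id_borel.
apply: (@eq_measure_integral _ _ _ setT (pushforward leb h) (pushforward leb g)) => A mA _.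
have mTA : measurable ((fun x : Bn => (x : 'rV[R]_n) + a : Bn) @^-1` A).
  by rewrite -[X in measurable X]setTI; exact: measurable_translate.
transitivity (borel_lebesgue R n ((fun x : Bn => (x : 'rV[R]_n) + a : Bn) @^-1` A)).
  exact: lebesgue_borelE.
by rewrite borel_lebesgue_translate//; apply/esym; exact: lebesgue_borelE.
Qed.

End borel_sets.

Section borel_version.
Context {R : realType} {n : nat}.
Local Notation Rn := (lebesgueRn R n).
Local Notation Bn := (borelRn R n).
Local Notation leb := (@lebesgue R n).
Local Notation bleb := (borel_lebesgue R n).
Local Open Scope ereal_scope.

(** The outer measure is an infimum over countable Borel covers; the
    intersection of a minimizing sequence of covers attains it. *)
Lemma outer_borel (E : set Rn) : leb E < +oo ->
  exists F : set Bn, [/\ measurable F, E `<=` F & bleb F <= leb E].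
Proof.
move=> Eoo.
have Efin : leb E \is a fin_num by rewrite ge0_fin_numE// outer_measure_ge0.
have coverE k : exists2 A, @measurable_cover _ Bn E A &
    \sum_(0 <= j <oo) bleb (A j) < leb E + k.+1%:R^-1%:E.
  have k0 : (0 < k.+1%:R^-1 :> R)%R by rewrite invr_gt0.
  by move: Efin => /lb_ereal_inf_adherent => /(_ _ k0)[_/= [A EA] <-] ?; exists A.
pose A k := projT1 (cid2 (coverE k)).
have mA k : @measurable_cover _ Bn E (A k) by rewrite /A; case: cid2.
have A_E k : \sum_(0 <= j <oo) bleb (A k j) < leb E + k.+1%:R^-1%:E.
  by rewrite /A; case: cid2.
have mAk k : measurable (\bigcup_j A k j).
  by apply: bigcupT_measurable => j; have [/(_ j)] := mA k.
have mF : measurable (\bigcap_k \bigcup_j A k j) by exact: bigcapT_measurable.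
exists (\bigcap_k \bigcup_j A k j); split => //.
  by apply: sub_bigcap => k _; have [_] := mA k.
apply/lee_addgt0Pr => _/posnumP[e]; near \oo => k.
apply: (@le_trans _ _ (bleb (\bigcup_j A k j))).
  by rewrite le_measure ?inE//; exact: bigcap_inf.
apply: (@le_trans _ _ (\sum_(0 <= j <oo) bleb (A k j))).
  by apply: measure_sigma_subadditive => // j; have [/(_ j)] := mA k.
rewrite (le_trans (ltW (A_E k)))// leeD// lee_fin ltW//.
by near: k; apply: near_infty_natSinv_lt.
Unshelve. all: by end_near. Qed.

Definition borel_null (N : set Bn) := measurable N /\ bleb N = 0.

(** On a piece of finite measure, compare the set with a Borel hull G of the
    same measure: the difference is null, hence inside a Borel null set. *)
Lemma borel_up_to_null (A : set Rn) : measurable A ->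
  exists2 N, borel_null N & measurable ((A `\` N) : set Bn).
Proof.
move=> mA.
have [F TF Foo] := sigma_finiteT (borel_lebesgue R n).
suff H k : exists2 N, borel_null N & measurable (((A `&` F k) `\` N) : set Bn).
  have H' k : exists N, borel_null N /\ measurable (((A `&` F k) `\` N) : set Bn).
    by have [N] := H k; exists N.
  have [N hN] := choice H'.
  have mN k : measurable (N k) by have [[]] := hN k.
  have mUN : measurable (\bigcup_k N k) by exact: bigcupT_measurable.
  exists (\bigcup_k N k).
    split => //; apply/eqP; rewrite eq_le measure_ge0 andbT.
    apply: le_trans (@measure_sigma_subadditive _ _ _ bleb _ _ mN mUN (@subset_refl _ _)) _.
    by rewrite eseries0// => k _ _; have [[]] := hN k.
  rewrite (_ : _ `\` _ = (\bigcup_k ((A `&` F k) `\` N k)) `\` \bigcup_k N k).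
    by apply: measurableD => //; apply: bigcupT_measurable => k; have [] := hN k.
  apply/seteqP; split => x [].
    move=> Ax Nx; split => //.
    have : (\bigcup_k F k) x by rewrite -TF.
    by move=> [k _ Fk]; exists k => //; split => // Nk; apply: Nx; exists k.
  by move=> [k _ [[Ax Fx] Nx]] ?.
have [mFk Fk] := Foo k.
have mFk' := borel_lebesgue_measurable mFk.
have mE : measurable (A `&` F k) by exact: measurableI.
set E := A `&` F k in mE *.
have Eoo : leb E < +oo.
  apply: (@le_lt_trans _ _ (leb (F k))); last by rewrite lebesgue_borelE.
  by rewrite le_measure ?inE//; exact: subIsetr.
(* G is a Borel hull of E with the same measure. *)
have [G [mG EG GE]] := outer_borel Eoo.
have mG' := borel_lebesgue_measurable mG.
have mGE : measurable (G `\` E : set Rn) by exact: measurableD.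
have GE0 : leb (G `\` E) = 0.
  have Gle : leb G <= leb E by rewrite lebesgue_borelE.
  have GE' : leb G = leb E.
    by apply/eqP; rewrite eq_le Gle andTb le_measure ?inE.
  rewrite measureD//; last exact: le_lt_trans Eoo.
  change (leb G - leb (G `&` E) = 0).
  by rewrite (setIidr EG) GE' subee// ge0_fin_numE.
have [|N [mN sN N0]] := @outer_borel (G `\` E); first by rewrite GE0.
exists N.
  by split => //; apply/eqP; rewrite eq_le measure_ge0 andbT (le_trans N0)// GE0.
rewrite (_ : E `\` N = G `\` N); first exact: measurableD.
apply/seteqP; split => x [Ex Nx]; split => //; first exact: EG.
by apply: contrapT => nEx; apply: Nx; apply: sN.
Qed.

(** Each superlevel set at a rational height is Borel off a Borel null set; the
    union of these countably many null sets serves all heights at once. *)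
Lemma borel_version (v : Rn -> R) : measurable_fun setT v ->
  exists2 N, borel_null N &
    measurable_fun [set: Bn] (fun x : Bn => (v x * \1_(~` N) x)%R).
Proof.
move=> mv.
have H (q : rat) : {N | borel_null N /\ measurable ((v @^-1` `]ratr q, +oo[ `\` N) : set Bn)}.
  apply: cid; have [|N N0 mN] := @borel_up_to_null (v @^-1` `]ratr q, +oo[).
    by rewrite -[X in measurable X]setTI; exact: mv.
  by exists N.
pose N0 q := sval (H q).
have N0p q : borel_null (N0 q) /\ measurable ((v @^-1` `]ratr q, +oo[ `\` N0 q) : set Bn) by rewrite /N0; case: (H q).
pose N := \bigcup_q N0 q.
have mN0 q : measurable (N0 q) by have [[]] := N0p q.
have mN : measurable N by apply: bigcupT_measurable_rat.
exists N.
  split => //; apply/eqP; rewrite eq_le measure_ge0 andbT.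
  have /card_esym/ppcard_eqP[e] := card_rat.
  have NE : N = \bigcup_k N0 (e k).
    rewrite /N; apply/seteqP; split => x [q _ Nq]; last by exists (e q).
    by exists (e^-1%FUN q) => //; rewrite invK ?inE.
  have mN0e k : measurable (N0 (e k)) by [].
  apply: le_trans (@measure_sigma_subadditive _ _ _ bleb _ (N0 \o e) mN0e mN _) _.
    by rewrite NE.
  by rewrite eseries0// => k _ _ /=; have [[]] := N0p (e k).
apply: (measurability _ (RGenOInfty.measurableE R)) => _ [_ [a ->] <-]; rewrite setTI.
set f := (fun x => _).
have -> : f @^-1` `]a, +oo[%classic =
   (\bigcup_(q in [set q : rat | (a < ratr q)%R]) ((v @^-1` `]ratr q, +oo[ `\` N0 q) `\` N)) `|`
   (if (a < 0)%R then N else set0).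
  apply/seteqP; split => x /=; rewrite in_itv/= andbT /f.
    have [Nx|Nx] := pselect (N x).
      by rewrite indicE memNset ?mulr0//= => -> //; right.
    rewrite indicE mem_set ?mulr1// => /rat_in_itvoo[q]; rewrite in_itv/= => /andP[aq qv].
    left; exists q => //; split => //; split; first by rewrite /= in_itv/= qv.
    by move=> N0q; apply: Nx; exists q.
  move=> [[q /= aq [[/=]]]|].
    by rewrite in_itv/= andbT => qv _ Nx; rewrite indicE mem_set// mulr1 (lt_trans aq).
  by case: ifP => // a0 Nx; rewrite indicE memNset ?mulr0//=; apply.
apply: measurableU; last by case: ifP.
rewrite bigcup_mkcond; apply: bigcupT_measurable_rat => q; case: ifP => // _.
by apply: measurableD => //; have [] := N0p q.
Qed.

End borel_version.

(** * The kernel and its integrable majorant *)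

Section euclidean_norm.
Context {R : realType} {n : nat}.
Implicit Types x y h : 'rV[R]_n.

Lemma enorm_ge x : `|x| <= enorm x.
Proof.
have [/mx_norm_neq0[[i j] /= xij]|/negbNE/eqP x0] := boolP (`|x| != 0); last first.
  by rewrite x0 sqrtr_ge0.
rewrite [leLHS]xij -sqrtr_sqr /enorm ler_wsqrtr// /dotp (bigD1 j)//= (ord1 i) expr2.
by rewrite lerDl sumr_ge0// => k _; rewrite -expr2 sqr_ge0.
Qed.

Lemma enorm_le x : enorm x <= n%:R * `|x|.
Proof.
have h : 0 <= n%:R * `|x| by rewrite mulr_ge0.
rewrite -(ger0_norm h) -sqrtr_sqr /enorm ler_wsqrtr// /dotp.
apply: (@le_trans _ _ (\sum_(i < n) `|x| ^+ 2)).
  apply: ler_sum => i _; rewrite -expr2 -real_normK ?num_real//.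
  by rewrite lerXn2r// ?nnegrE// mx_norm_coord.
rewrite sumr_const card_ord -[leLHS]mulr_natl exprMn ler_wpM2r ?sqr_ge0//.
by rewrite -natrX ler_nat; case: (n) => // m; rewrite -mulnn leq_pmulr.
Qed.

Lemma enormB x y : enorm (x - y) = enorm (y - x).
Proof.
rewrite /enorm /dotp; congr Num.sqrt; apply: eq_bigr => i _.
by rewrite -(opprB y x) !mxE mulrNN.
Qed.

Lemma frac_kernelE (s q : R) x y :
  frac_kernel s q x y = enorm (x - y) `^ (- (n%:R + s * q)).
Proof. by rewrite powRN. Qed.

Lemma frac_kernel_sym (s q : R) x y : frac_kernel s q x y = frac_kernel s q y x.
Proof. by rewrite /frac_kernel enormB. Qed.

Lemma frac_kernel_ge0 (s q : R) x y : 0 <= frac_kernel s q x y.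
Proof. by rewrite invr_ge0 powR_ge0. Qed.

Lemma frac_kernel_translate (s q : R) x y h :
  frac_kernel s q (x + h) (y + h) = frac_kernel s q x y.
Proof. by rewrite /frac_kernel opprD addrACA subrr addr0. Qed.

End euclidean_norm.

Section kernel_bounds.
Context {R : realType}.

Lemma ler_powRN (a b c : R) : 0 <= c -> 0 < a -> a <= b -> b `^ (- c) <= a `^ (- c).
Proof.
move=> c0 a0 ab; rewrite !powRN lef_pV2 ?posrE ?powR_gt0//; last exact: lt_le_trans ab.
by apply: ge0_ler_powR; rewrite ?nnegrE// ltW// (lt_le_trans a0).
Qed.

Lemma frac_kernel_le n (s q : R) (x y : 'rV[R]_n) : 0 <= s * q -> x != y ->
  frac_kernel s q x y <= `|x - y| `^ (- (n%:R + s * q)).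
Proof.
move=> sq xy; rewrite frac_kernelE ler_powRN ?addr_ge0 ?enorm_ge//.
by rewrite normr_gt0 subr_eq0.
Qed.

Lemma frac_kernel_ge n (s q t : R) (x y : 'rV[R]_n) : 0 <= s * q -> x != y ->
  n%:R * `|x - y| <= t -> t `^ (- (n%:R + s * q)) <= frac_kernel s q x y.
Proof.
move=> sq xy xyt; rewrite frac_kernelE ler_powRN ?addr_ge0//.
  by apply: lt_le_trans (enorm_ge _); rewrite normr_gt0 subr_eq0.
exact: le_trans (enorm_le _) xyt.
Qed.

Lemma dyadic_scale (z : R) : 1 <= z -> exists j : nat, 2 ^+ j <= z < 2 ^+ j.+1.
Proof.
move=> z1.
have ex : exists j, z < 2 ^+ j.
  exists (Num.truncn z).+1; apply: lt_trans (truncnS_gt _) _.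
  by rewrite -natrX ltr_nat ltn_expl.
have [[|j] zj jmin] := ex_minnP ex.
  by move: zj; rewrite expr0 ltNge z1.
exists j; rewrite zj andbT leNgt; apply/negP => /jmin; by rewrite ltnn.
Qed.

Lemma powR_scale n (s k c : R) : 0 < c -> 0 <= k ->
  c `^ (- (n%:R + s)) * (k * c) ^+ n = k ^+ n * c `^ (- s).
Proof.
move=> c0 k0; rewrite exprMn mulrCA; congr (_ * _).
rewrite -[c ^+ n]powR_mulrn ?ltW// -powRD; last by rewrite (gt_eqF c0) implybT.
by congr (_ `^ _); ring.
Qed.

Lemma powRX (c a : R) j : 0 <= c -> (c ^+ j) `^ a = (c `^ a) ^+ j.
Proof. by move=> c0; elim: j => [|j IH]; rewrite ?expr0 ?powR1// !exprS powRM ?exprn_ge0// IH. Qed.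

End kernel_bounds.

Section generic_measure.
Context d (T : measurableType d) {R : realType} (mu : {measure set T -> \bar R}).

Lemma measurable_fun_powR (D : set T) (f : T -> R) (a : R) :
  measurable_fun D f -> measurable_fun D (fun x => f x `^ a).
Proof. by move=> mf; exact: (measurableT_comp (measurable_powR _) mf). Qed.

Lemma measurable_min1 (f : T -> R) (a r : R) : measurable_fun setT f ->
  measurable_fun setT (fun y => Num.min 1 (f y / r) * f y `^ a).
Proof.
move=> mf; apply: measurable_funM; last exact: measurable_fun_powR.
by apply: measurable_minr => //; exact: measurable_funM.
Qed.

Local Open Scope ereal_scope.

(** Radial functions are dominated by such sums over dyadic balls, whose
    integrals are geometric series. *)
Definition weighted_indics (a : nat -> R) (B : nat -> set T) (y : T) :=
  \sum_(j <oo) (a j * \1_(B j) y)%:E.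

Variables (a : nat -> R) (B : nat -> set T).
Hypotheses (a0 : forall j, (0 <= a j)%R) (mB : forall j, measurable (B j)).

Lemma weighted_indics_ge0 y : 0 <= weighted_indics a B y.
Proof. by apply: nneseries_ge0 => j _ _; rewrite lee_fin mulr_ge0. Qed.

Lemma weighted_indics_ge j y : B j y -> (a j)%:E <= weighted_indics a B y.
Proof.
move=> bj; apply: (@le_trans _ _ (\sum_(0 <= i < j.+1) (a i * \1_(B i) y)%:E)).
  rewrite big_nat_recr//= [X in _ <= _ + X](_ : _ = (a j)%:E).
    by rewrite leeDr// sume_ge0// => i _; rewrite lee_fin mulr_ge0.
  by rewrite indicE mem_set// mulr1.
by apply: nneseries_lim_ge => i _; rewrite lee_fin mulr_ge0.
Qed.

Lemma measurable_weighted_indics : measurable_fun setT (weighted_indics a B).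
Proof.
apply: ge0_emeasurable_sum => // j.
- by move=> y _ _; rewrite lee_fin mulr_ge0.
- by move=> _; apply/measurable_EFinP; apply: measurable_funM => //; exact: measurable_indic.
Qed.

Lemma integral_weighted_indics_le (m : nat -> R) (c z : R) :
  (0 <= c)%R -> (0 < z < 1)%R -> (forall j, mu (B j) = (m j)%:E) ->
  (forall j, a j * m j <= c * z ^+ j)%R ->
  \int[mu]_y weighted_indics a B y <= (c / (1 - z))%:E.
Proof.
move=> c0 /andP[z0 z1] muB h.
have f0 j y : [set: T] y -> 0 <= (a j * \1_(B j) y)%:E by rewrite lee_fin mulr_ge0.
have mf j : measurable_fun setT (fun y => (a j * \1_(B j) y)%:E).
  by apply/measurable_EFinP; apply: measurable_funM => //; exact: measurable_indic.
rewrite (integral_nneseries mu measurableT mf f0).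
apply: (@le_trans _ _ (\sum_(j <oo) (c * z ^+ j)%:E)).
  apply: lee_nneseries => j _.
    by move=> _; apply: integral_ge0 => y _; exact: f0.
  under eq_integral do rewrite EFinM.
  have mi : measurable_fun setT (fun y => (\1_(B j) y : R)%:E).
    by apply/measurable_EFinP; exact: measurable_indic.
  rewrite (ge0_integralZl mu measurableT mi)//; last by rewrite lee_fin a0.
  by rewrite integral_indic// setIT muB -EFinM lee_fin; exact: h.
have cv : cvgn (fun k => \sum_(0 <= j < k) (c * z ^+ j)%:E).
  by apply: is_cvg_nneseries => i _ _; rewrite lee_fin mulr_ge0// exprn_ge0 ?ltW.
apply: (lime_le cv).
apply: nearW => m'; rewrite /= sumEFin lee_fin.
have := @geometric_le_lim R m' c z c0 z0; rewrite gtr0_norm// => /(_ z1).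
by rewrite /series/=.
Qed.

End generic_measure.

Section annuli.
Context {R : realType} (n : nat).
Local Notation Rn := (lebesgueRn R n).
Local Notation leb := (@lebesgue R n).

(** The common majorant of all the singular integrals below: it behaves as
    t^(1-n-s) near 0 and as t^(-n-s) at infinity, and both are integrable for
    0 < s < 1. *)
Definition majorant (s r : R) (x y : 'rV[R]_n) : R :=
  Num.min 1 (`|x - y| / r) * `|x - y| `^ (- (n%:R + s)).

Lemma majorant_ge0 s r x y : 0 < r -> 0 <= majorant s r x y.
Proof.
by move=> r0; rewrite mulr_ge0 ?powR_ge0// le_min ler01/= divr_ge0// ltW.
Qed.

Lemma measurable_dist (x : 'rV[R]_n) : measurable_fun [set: Rn] (fun y : Rn => `|x - (y : 'rV[R]_n)| : R).
Proof.
apply: (@continuous_lebesgue _ _ (fun y => `|x - y|)) => y.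
apply: (@continuous_comp _ _ _ (fun y : 'rV[R]_n => x - y) (@Num.norm _ _)); last exact: norm_continuous.
by apply: continuousB; [exact: cst_continuous|exact: cvg_id].
Qed.

Lemma measurable_majorant s r x : measurable_fun [set: Rn] (majorant s r x : Rn -> R).
Proof. exact: measurable_min1 (measurable_dist x). Qed.

Lemma measurable_box_lebesgue (x : 'rV[R]_n) (rho : R) : measurable (box x rho : set Rn).
Proof. by apply: borel_lebesgue_measurable; exact: measurable_box. Qed.

Definition majorant_cst (s : R) :=
  (4 ^+ n / (1 - 2 `^ (- s)) + 8 ^+ n * 2 `^ s / (1 - 2 `^ (s - 1))).

Lemma lebesgue_box (x : 'rV[R]_n) r : 0 < r -> leb (box x r) = ((2 * r) ^+ n)%:E.
Proof.
move=> r0; rewrite -(borel_lebesgue_box x r0).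
by apply: lebesgue_borelE; exact: measurable_box.
Qed.

Local Open Scope ereal_scope.

(** Cutting R^n into the dyadic annuli around x bounds the integral of the
    majorant by two geometric series, of ratios 2^-s and 2^(s-1). *)
Lemma integral_majorant (s r : R) (x : 'rV[R]_n) : (0 < s < 1)%R -> (0 < r)%R ->
  \int[leb]_y (majorant s r x y)%:E <= (majorant_cst s * r `^ (- s))%:E.
Proof.
move=> /andP[s0 s1] r0.
pose a (j : nat) : R := ((2 ^+ j * r) `^ (- (n%:R + s)))%R.
pose b (j : nat) : R := ((2 `^ (-1)) ^+ j * ((2 `^ (-1)) ^+ j.+1 * r) `^ (- (n%:R + s)))%R.
pose ra (j : nat) : R := (2 ^+ j.+1 * r)%R.
pose rb (j : nat) : R := (2 * ((2 `^ (-1)) ^+ j * r))%R.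
have p2 (t : R) : (0 < 2 `^ t :> R)%R by apply: powR_gt0.
have h2 : (2 `^ (-1) = 2^-1 :> R)%R by rewrite powR_inv1.
have a0 j : (0 <= a j)%R by exact: powR_ge0.
have b0 j : (0 <= b j)%R by rewrite mulr_ge0 ?powR_ge0// exprn_ge0 ?ltW.
have ra0 j : (0 < ra j)%R by rewrite mulr_gt0.
have rb0 j : (0 < rb j)%R by rewrite !mulr_gt0// exprn_gt0.
have lt1 (t : R) : (t < 0 -> 2 `^ t < 1 :> R)%R.
  move=> t0; have : (2 `^ t <= 2 `^ 0 :> R)%R by apply: ler_powR; rewrite ?ler1n ?ltW.
  rewrite powRr0 lt_neqAle powR_eq1 => ->; rewrite andbT.
  by rewrite (lt_eqF t0) !gt_eqF ?ltr1n// ltNge ler0n.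
have q1 : (2 `^ (- s) < 1 :> R)%R by rewrite lt1// oppr_lt0.
have q2 : (2 `^ (s - 1) < 1 :> R)%R by rewrite lt1// subr_lt0.
have Ha j : (a j * (2 * ra j) ^+ n <= (4 ^+ n * r `^ (- s)) * (2 `^ (- s)) ^+ j)%R.
  rewrite /a /ra (_ : 2 * _ = 4 * (2 ^+ j * r))%R; last by rewrite exprS; ring.
  rewrite powR_scale ?mulr_gt0 ?exprn_gt0// powRM ?exprn_ge0 ?(ltW r0)// powRX//.
  by rewrite le_eqVlt; apply/orP; left; apply/eqP; ring.
have Hb j : (b j * (2 * rb j) ^+ n <= (8 ^+ n * 2 `^ s * r `^ (- s)) * (2 `^ (s - 1)) ^+ j)%R.
  rewrite /b /rb (_ : 2 * _ = 8 * ((2 `^ (-1)) ^+ j.+1 * r))%R; last by rewrite exprS h2; field.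
  rewrite -mulrA powR_scale ?mulr_gt0 ?exprn_gt0//.
  rewrite powRM ?exprn_ge0 ?(ltW r0) ?(ltW (p2 _))// powRX ?(ltW (p2 _))// -powRrM mulN1r opprK exprS.
  have -> : (2 `^ (s - 1) = 2 `^ s * 2 `^ (-1) :> R)%R.
    by rewrite -powRD// pnatr_eq0 implybT.
  by rewrite le_eqVlt; apply/orP; left; apply/eqP; rewrite exprMn; ring.
have s0' : (0 < (2 `^ (- s) : R) < 1)%R by rewrite p2.
have s1' : (0 < (2 `^ (s - 1) : R) < 1)%R by rewrite p2.
have c1 : (0 <= 4 ^+ n * r `^ (- s))%R by rewrite mulr_ge0 ?powR_ge0.
have c2 : (0 <= 8 ^+ n * 2 `^ s * r `^ (- s))%R by rewrite !mulr_ge0 ?powR_ge0.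
pose wa : Rn -> \bar R := weighted_indics a (fun j => box x (ra j) : set Rn).
pose wb : Rn -> \bar R := weighted_indics b (fun j => box x (rb j) : set Rn).
have Ia : \int[leb]_y wa y <= (4 ^+ n * r `^ (- s) / (1 - 2 `^ (- s)))%:E.
  apply: (@integral_weighted_indics_le _ _ _ leb a _ a0 _ (fun j => (2 * ra j) ^+ n)%R) => // j.
  + exact: measurable_box_lebesgue.
  + exact: lebesgue_box.
have Ib : \int[leb]_y wb y <= (8 ^+ n * 2 `^ s * r `^ (- s) / (1 - 2 `^ (s - 1)))%:E.
  apply: (@integral_weighted_indics_le _ _ _ leb b _ b0 _ (fun j => (2 * rb j) ^+ n)%R) => // j.
  + exact: measurable_box_lebesgue.
  + exact: lebesgue_box.
have mwa : measurable_fun [set: Rn] wa.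
  by apply: measurable_weighted_indics => // j; exact: measurable_box_lebesgue.
have mwb : measurable_fun [set: Rn] wb.
  by apply: measurable_weighted_indics => // j; exact: measurable_box_lebesgue.
have wa0 y : 0 <= wa y by exact: weighted_indics_ge0.
have wb0 y : 0 <= wb y by exact: weighted_indics_ge0.
apply: (@le_trans _ _ (\int[leb]_y (wa y + wb y))); last first.
  rewrite (ge0_integralD _ measurableT (fun y _ => wa0 y) mwa (fun y _ => wb0 y) mwb).
  apply: (le_trans (leeD Ia Ib)).
  by rewrite -EFinD lee_fin /majorant_cst le_eqVlt; apply/orP; left; apply/eqP; ring.
apply: ge0_le_integral; first exact: measurableT.
- by move=> y _; rewrite lee_fin majorant_ge0.
- by apply/measurable_EFinP; exact: measurable_majorant.
- exact: emeasurable_funD mwa mwb.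
move=> y _.
set t := `|x - (y : 'rV[R]_n)|%R.
have [t0|t0] := leP t 0%R.
  have te : t = 0%R by apply/eqP; rewrite eq_le t0 normr_ge0.
  rewrite /majorant -/t te mul0r (_ : Num.min 1 0 = 0)%R ?mul0r; last by apply/min_idPr.
  by rewrite adde_ge0.
have bxy (rho : R) : (0 < rho)%R -> (t < rho)%R -> box x rho y.
  by move=> rh0; rewrite boxE// /t distrC.
have [rt|tr] := leP r t.
  have [|j /andP[j1 j2]] := @dyadic_scale R (t / r).
    by rewrite ler_pdivlMr// mul1r.
  apply: (@le_trans _ _ (a j)%:E); last first.
    apply: (@le_trans _ _ (wa y)).
      apply: (weighted_indics_ge a0 (j := j)).
      by apply: bxy => //; rewrite -ltr_pdivrMr.
    by rewrite leeDl.
  rewrite lee_fin /majorant -/t /a; apply: (@le_trans _ _ (t `^ (- (n%:R + s)))%R).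
    by rewrite ler_piMl ?powR_ge0// ge_min lexx.
  apply: ler_powRN; first by rewrite addr_ge0 ?(ltW s0).
    by rewrite mulr_gt0 ?exprn_gt0.
  by rewrite -ler_pdivlMr.
have [|j /andP[j1 j2]] := @dyadic_scale R (r / t).
  by rewrite ler_pdivlMr// mul1r ltW.
have e2 k : ((2 `^ (-1)) ^+ k * 2 ^+ k = 1 :> R)%R by rewrite -exprMn h2 mulVf// expr1n.
have t1 : (t <= (2 `^ (-1)) ^+ j * r)%R.
  rewrite -(@ler_pM2r _ (2 ^+ j))// mulrAC e2 mul1r.
  by rewrite mulrC -ler_pdivlMr.
have t2 : ((2 `^ (-1)) ^+ j.+1 * r <= t)%R.
  rewrite -(@ler_pM2r _ (2 ^+ j.+1))// mulrAC e2 mul1r.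
  by rewrite mulrC -ler_pdivrMr// ltW.
apply: (@le_trans _ _ (b j)%:E); last first.
  apply: (@le_trans _ _ (wb y)).
    apply: (weighted_indics_ge b0 (j := j)).
    apply: bxy => //; rewrite /rb; apply: le_lt_trans t1 _.
    by rewrite ltr_pMl ?ltr1n// mulr_gt0// exprn_gt0.
  by rewrite leeDr.
rewrite lee_fin /majorant -/t /b; apply: ler_pM; rewrite ?powR_ge0//.
- by rewrite le_min ler01 divr_ge0// ltW.
- rewrite ge_min; apply/orP; right.
  by rewrite ler_pdivrMr.
- apply: ler_powRN => //; first by rewrite addr_ge0 ?(ltW s0).
  by rewrite mulr_gt0 ?exprn_gt0.
Qed.

End annuli.

(** * Double integrals *)

Section double_integrals.
Context d (T : measurableType d) {R : realType}.
Variable mu : {sigma_finite_measure set T -> \bar R}.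
Local Open Scope ereal_scope.
Implicit Types (A B : set T) (f : T * T -> \bar R).

Definition dint A B f := \int[mu]_(x in A) \int[mu]_(y in B) f (x, y).

Lemma patch_setX A B f x y :
  (f \_ (A `*` B)) (x, y) = if x \in A then ((fun y => f (x, y)) \_ B) y else 0.
Proof.
rewrite !patchE in_setX.
by case: (x \in A); case: (y \in B).
Qed.

Section nonneg.
Variables (f : T * T -> \bar R).
Hypotheses (mf : measurable_fun setT f) (f0 : forall z, 0 <= f z).

Lemma measurable_patch_setX A B : measurable A -> measurable B ->
  measurable_fun setT (f \_ (A `*` B)).
Proof.
move=> mA mB; apply/(measurable_restrictT _ _).1.
  exact: measurableX.
exact: measurable_funS mf.
Qed.

Lemma patch_setX_ge0 A B z : 0 <= (f \_ (A `*` B)) z.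
Proof. by rewrite patchE; case: ifP. Qed.

Lemma measurable_inner A B : measurable A -> measurable B ->
  measurable_fun A (fun x => \int[mu]_(y in B) f (x, y)).
Proof.
move=> mA mB.
have mfB := measurable_patch_setX measurableT mB.
have := measurable_fun_fubini_tonelli_F (m2 := mu) _ mfB (patch_setX_ge0 _ _).
move=> /(measurable_funS measurableT (@subsetT _ A)).
apply: eq_measurable_fun => x _; rewrite /fubini_F [RHS]integral_mkcond.
by apply: eq_integral => y _; rewrite patch_setX in_setT.
Qed.

Lemma dintE A B : measurable A -> measurable B ->
  \int[mu \x mu]_(z in A `*` B) f z = dint A B f.
Proof.
move=> mA mB; rewrite integral_mkcond.
rewrite (fubini_tonelli1 _ (measurable_patch_setX mA mB) (patch_setX_ge0 _ _)).
rewrite /dint [RHS]integral_mkcond; apply: eq_integral => x _; rewrite /fubini_F.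
rewrite patchE; under eq_integral do rewrite patch_setX.
case: ifP => [_|_]; last by rewrite integral0.
by rewrite [RHS]integral_mkcond.
Qed.

Lemma dint_swap A B : measurable A -> measurable B ->
  dint A B f = dint B A (fun z => f (z.2, z.1)).
Proof.
move=> mA mB; rewrite -dintE// integral_mkcond.
rewrite (fubini_tonelli2 _ (measurable_patch_setX mA mB) (patch_setX_ge0 _ _)).
rewrite /dint [RHS]integral_mkcond; apply: eq_integral => y _; rewrite /fubini_G.
rewrite patchE; case: ifP => yB; last first.
  rewrite -[RHS](integral0 mu setT); apply: eq_integral => x _.
  by rewrite patch_setX patchE yB; case: ifP.
rewrite [RHS]integral_mkcond; apply: eq_integral => x _.
by rewrite patch_setX !patchE yB.
Qed.

Lemma dint_ge0 A B : 0 <= dint A B f.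
Proof. by apply: integral_ge0 => x _; exact: integral_ge0. Qed.

Lemma dint_setUr A B C : measurable A -> measurable B -> measurable C ->
  [disjoint B & C]%classic -> dint A (B `|` C) f = dint A B f + dint A C f.
Proof.
move=> mA mB mC BC; rewrite /dint -ge0_integralD//; last first.
- exact: measurable_inner.
- by move=> x _; exact: integral_ge0.
- exact: measurable_inner.
- by move=> x _; exact: integral_ge0.
apply: eq_integral => x _; rewrite ge0_integral_setU//.
apply/(measurable_funS measurableT (@subsetT _ _)).
exact: (measurableT_comp mf (measurable_pair1 x)).
Qed.

Lemma dint_setUl A B C : measurable A -> measurable B -> measurable C ->
  [disjoint B & C]%classic -> dint (B `|` C) A f = dint B A f + dint C A f.
Proof.
move=> mA mB mC BC; rewrite /dint ge0_integral_setU//.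
  by apply: measurable_inner => //; exact: measurableU.
by move=> x _; exact: integral_ge0.
Qed.

End nonneg.

Lemma le_dint A B f g : measurable A -> measurable B ->
  measurable_fun setT f -> measurable_fun setT g -> (forall z, 0 <= f z) ->
  (forall x y, A x -> B y -> f (x, y) <= g (x, y)) -> dint A B f <= dint A B g.
Proof.
move=> mA mB mf mg f0 fg.
have g0 x y : A x -> B y -> 0 <= g (x, y) by move=> Ax By; apply: le_trans (fg _ _ Ax By).
rewrite -dintE// (_ : dint A B g = dint A B (fun z => `|g z|)); last first.
  apply: eq_integral => x /set_mem Ax; apply: eq_integral => y /set_mem By.
  by rewrite gee0_abs// g0.
rewrite -[leRHS]dintE//; last exact: measurableT_comp.
apply: ge0_le_integral => //; first exact: measurableX.
- exact: measurable_funS mf.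
- by apply: measurable_funS (measurableT_comp _ mg).
- move=> [x y] [/= Ax By]; rewrite gee0_abs; [exact: fg|exact: g0].
Qed.

Lemma dintD A B f g : measurable A -> measurable B ->
  measurable_fun setT f -> measurable_fun setT g ->
  (forall z, 0 <= f z) -> (forall z, 0 <= g z) ->
  dint A B (f \+ g) = dint A B f + dint A B g.
Proof.
move=> mA mB mf mg f0 g0; rewrite -!dintE//; first last.
- by move=> z; exact: adde_ge0.
- exact: emeasurable_funD.
rewrite ge0_integralD//; first exact: measurableX.
- exact: measurable_funS mf.
- exact: measurable_funS mg.
Qed.

End double_integrals.

(** * Limits of powers and a two-sided Fatou lemma *)

Section power_limits.
Context {R : realType}.
Implicit Types (z p : nat -> R).

Lemma cvg_powR_gt0 z p (z0 p0 : R) : 0 < z0 ->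
  z k @[k --> \oo] --> z0 -> p k @[k --> \oo] --> p0 ->
  z k `^ p k @[k --> \oo] --> z0 `^ p0.
Proof.
move=> z00 zz pp; rewrite {2}/powR (gt_eqF z00).
have : expR (p k * ln (z k)) @[k --> \oo] --> expR (p0 * ln z0).
  have cvl : ln (z k) @[k --> \oo] --> ln z0.
    by apply: continuous_cvg => //; exact: continuous_ln.
  by apply: continuous_cvg; [exact: continuous_expR|exact: cvgM].
apply: cvg_trans; apply: near_eq_cvg.
have : \forall k \near \oo, 0 < z k by exact: (cvgr_gt z0 zz).
by apply: filterS => k zk; rewrite /powR (gt_eqF zk).
Qed.

Lemma cvg_powR_to1 z p (z0 : R) : (forall k, 0 <= z k) -> (forall k, 1 <= p k) ->
  z k @[k --> \oo] --> z0 -> p k @[k --> \oo] --> (1 : R) ->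
  z k `^ p k @[k --> \oo] --> z0.
Proof.
move=> zge pge zz pp.
have z00 : 0 <= z0.
  rewrite -(cvg_lim (@Rhausdorff R) zz); apply: limr_ge; first by apply/cvg_ex; exists z0.
  by apply: nearW.
have [z0p|] := ltP 0 z0.
  by rewrite -[z0 in X in _ --> X](powRr1 z00); exact: cvg_powR_gt0.
move=> z0n; have e0 : z0 = 0 by apply/eqP; rewrite eq_le z0n z00.
rewrite e0 in zz *.
apply: (@squeeze_cvgr _ _ _ _ (fun=> 0) z) => //; last exact: cvg_cst.
have : \forall k \near \oo, z k < 1 by exact: (cvgr_lt 0 zz).
apply: filterS => k zk; rewrite powR_ge0/=.
have [zk0|zk0] := ltP 0 (z k); first by rewrite ge1r_powR// zk0 ltW.
have -> : z k = 0 by apply/eqP; rewrite eq_le zk0 zge.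
by rewrite powR0// gt_eqF// (lt_le_trans _ (pge k)).
Qed.

(** Convexity of the power; the constant tends to 1 as p does. *)
Lemma powR_triangle (a b p : R) : 1 <= p -> 0 <= a -> 0 <= b ->
  (a + b) `^ p <= 2 `^ (p - 1) * (a `^ p + b `^ p).
Proof.
move=> p1 a0 b0.
have h2 : 0 <= (2^-1 : R) by rewrite invr_ge0.
have : (2^-1 * a + (1 - 2^-1) * b) `^ p <= 2^-1 * a `^ p + (1 - 2^-1) * b `^ p.
  by apply: (convex_powR p1 (Itv01 _ _)) => //=; rewrite ?inE/= ?in_itv/= ?andbT// invf_le1 ?ler1n.
have -> : 1 - 2^-1 = 2^-1 :> R by field.
rewrite -!mulrDr powRM ?addr_ge0// => h.
have -> : 2 `^ (p - 1) = 2 `^ p * 2^-1 :> R.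
  by rewrite powRD ?powR_inv1// pnatr_eq0 implybT.
rewrite -mulrA; apply: le_trans (ler_wpM2l (powR_ge0 2 p) h).
rewrite mulrA -powRM// divff ?pnatr_eq0// powR1 mul1r//.
Qed.

End power_limits.

Section einf.
Context {R : realType}.
Implicit Types (u : (\bar R)^nat) (c : \bar R).
Local Open Scope ereal_scope.

Lemma limn_einf_supE u : limn_einf u = ereal_sup (range (einfs u)).
Proof. by rewrite limn_einf_lim; apply/cvg_lim => //; exact: cvg_einfs_sup. Qed.

Lemma limn_einf_gt u c : c < limn_einf u -> \forall k \near \oo, c < u k.
Proof.
rewrite limn_einf_supE => /ereal_sup_gt[_ [n _ <-] cn].
exists n => // m /= nm; apply: lt_le_trans cn _.
by apply: ereal_inf_lbound; exists m.
Qed.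

Lemma limn_einf_ge u c : (\forall k \near \oo, c <= u k) -> c <= limn_einf u.
Proof.
rewrite limn_einf_supE => -[n _ h].
apply: (@le_trans _ _ (einfs u n)); last by apply: ereal_sup_ubound; exists n.
by apply: le_ereal_inf_tmp => _ [m /= nm <-]; exact: h.
Qed.

Lemma measurable_limn_einf d (T : measurableType d) (D : set T) (f : (T -> \bar R)^nat) :
  (forall k, measurable_fun D (f k)) -> measurable_fun D (fun x => limn_einf (f^~ x)).
Proof.
move=> mf.
have -> : (fun x => limn_einf (f^~ x)) = (fun x => - limn_esup (fun k => - f k x)).
  by apply/funext => x; rewrite -[RHS]limn_einfN; congr limn_einf; apply/funext => k /=; rewrite oppeK.
have H : measurable_fun D (fun x => limn_esup (fun k => - f k x)).
  by apply: measurable_fun_limn_esup => k; apply: measurableT_comp (mf k); exact: oppe_measurable.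
by apply: measurableT_comp H; exact: oppe_measurable.
Qed.

End einf.

Section generalized_fatou.
Context d (T : measurableType d) {R : realType} (mu : {measure set T -> \bar R}).
Variables (D : set T) (mD : measurable D).
Local Open Scope ereal_scope.

Definition rint (f : T -> R) := \int[mu]_(x in D) (f x)%:E.

Variables (f_ g_ h_ : nat -> T -> R) (f g h : T -> R).
Hypotheses (mf_ : forall k, measurable_fun D (f_ k)) (mg_ : forall k, measurable_fun D (g_ k))
  (mh_ : forall k, measurable_fun D (h_ k))
  (mf : measurable_fun D f) (mg : measurable_fun D g) (mh : measurable_fun D h).
Hypotheses (f_0 : forall k x, D x -> (0 <= f_ k x)%R) (g_0 : forall k x, D x -> (0 <= g_ k x)%R)
  (h_0 : forall k x, D x -> (0 <= h_ k x)%R)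
  (f0 : forall x, D x -> (0 <= f x)%R) (g0 : forall x, D x -> (0 <= g x)%R)
  (h0 : forall x, D x -> (0 <= h x)%R).
Hypothesis gfh : forall k x, D x -> (g_ k x <= f_ k x + h_ k x)%R.
Hypothesis lim_ae : {ae mu, forall x, D x -> forall e : R, (0 < e)%R ->
  \forall k \near \oo, (f x + h x + g_ k x <= f_ k x + h_ k x + g x + e)%R}.
Hypotheses (ifoo : rint f < +oo) (igoo : rint g < +oo) (ihoo : rint h < +oo).
Hypotheses (ig_oo : forall k, rint (g_ k) < +oo).
Hypothesis ih_ : forall e : R, (0 < e)%R -> \forall k \near \oo, rint (h_ k) <= rint h + e%:E.

Let mE (u : T -> R) : measurable_fun D u -> measurable_fun D (EFin \o u).
Proof. by move=> ?; exact/measurable_EFinP. Qed.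

Let rint0 (u : T -> R) : (forall x, D x -> (0 <= u x)%R) -> 0 <= rint u.
Proof. by move=> u0; apply: integral_ge0 => x Dx; rewrite lee_fin u0. Qed.

Let rintD (u v : T -> R) : (forall x, D x -> (0 <= u x)%R) -> (forall x, D x -> (0 <= v x)%R) ->
  measurable_fun D u -> measurable_fun D v -> rint (fun x => u x + v x)%R = rint u + rint v.
Proof.
move=> u0 v0 mu_ mv; by rewrite /rint -ge0_integralD//; exact: mE.
Qed.

(** Fatou's lemma for the nonnegative functions f_k + h_k - g_k, written without
    subtraction: it is a lower bound for a difference of two integrals, of which
    neither needs to converge. *)
Lemma generalized_fatou (e : R) : (0 < e)%R ->
  \forall k \near \oo, rint f + rint (g_ k) <= rint (f_ k) + rint g + e%:E.
Proof.
move=> e0.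
pose G k x := (f_ k x + h_ k x - g_ k x)%R.
have mG k : measurable_fun D (G k).
  by apply: measurable_funB => //; exact: measurable_funD.
have G0 k x : D x -> (0 <= G k x)%R by move=> Dx; rewrite subr_ge0 gfh.
pose L x := limn_einf (fun k => (G k x)%:E).
have mL : measurable_fun D L by apply: measurable_limn_einf => k; exact: mE.
have L0 x : D x -> 0 <= L x.
  by move=> Dx; apply: limn_einf_ge; apply: nearW => k; rewrite lee_fin G0.
have le1 : rint f + rint h <= limn_einf (fun k => rint (G k)) + rint g.
  have fat : \int[mu]_(x in D) L x <= limn_einf (fun k => rint (G k)).
    by apply: fatou => // k; exact: mE.
  apply: le_trans (leeD2r _ fat).
  rewrite -rintD// /rint -ge0_integralD//; last exact: mE.
  apply: ae_ge0_le_integral => //.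
  - by move=> x Dx; rewrite lee_fin addr_ge0 ?f0 ?h0.
  - by apply: mE; exact: measurable_funD.
  - by move=> x Dx; rewrite adde_ge0 ?L0// lee_fin g0.
  - by apply: emeasurable_funD => //; exact: mE.
  apply: filterS lim_ae => x lx Dx.
  apply/lee_addgt0Pr => e' e'0.
  rewrite -leeBlDr// -leeBlDr// -!EFinB; apply: limn_einf_ge.
  apply: filterS (lx Dx e' e'0) => k hk; rewrite lee_fin /G; lra.
have [F FE] : exists r : R, rint f = r%:E.
  by exists (fine (rint f)); rewrite fineK// ge0_fin_numE ?rint0.
have [Gr GE] : exists r : R, rint g = r%:E.
  by exists (fine (rint g)); rewrite fineK// ge0_fin_numE ?rint0.
have [H HE] : exists r : R, rint h = r%:E.
  by exists (fine (rint h)); rewrite fineK// ge0_fin_numE ?rint0.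
have lt1 : (F + H - Gr - e / 2)%:E < limn_einf (fun k => rint (G k)).
  apply: (@lt_le_trans _ _ (F + H - Gr)%:E); first by rewrite lte_fin ltrBlDr ltrDl divr_gt0.
  by move: le1; rewrite FE GE HE -EFinD -leeBlDr// -EFinB.
near=> k.
have h1 : (F + H - Gr - e / 2)%:E < rint (G k) by near: k; exact: limn_einf_gt lt1.
have h2 : rint (h_ k) <= rint h + (e / 2)%:E by near: k; apply: ih_; rewrite divr_gt0.
have GD : rint (G k) + rint (g_ k) = rint (f_ k) + rint (h_ k).
  rewrite -(rintD (G0 k) (g_0 k) (mG k) (mg_ k)) -(rintD (f_0 k) (h_0 k) (mf_ k) (mh_ k)).
  by rewrite /rint; apply: eq_integral => x _; rewrite /G subrK.
have [g' g'E] : exists r : R, rint (g_ k) = r%:E.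
  by exists (fine (rint (g_ k))); rewrite fineK// ge0_fin_numE// rint0// => x; exact: g_0.
have [h' h'E] : exists r : R, rint (h_ k) = r%:E.
  exists (fine (rint (h_ k))); rewrite fineK// ge0_fin_numE; last by rewrite rint0// => x; exact: h_0.
  by apply: le_lt_trans h2 _; rewrite HE -EFinD ltry.
rewrite g'E h'E in GD; rewrite h'E HE -EFinD lee_fin in h2.
rewrite FE g'E GE.
have := rint0 (f_0 k); move: GD; case: (rint (f_ k)) => [f'| |] // GD _.
have G' : rint (G k) = (f' + h' - g')%:E.
  by rewrite EFinB EFinD -GD addeK.
move: h1; rewrite G' lte_fin -!EFinD lee_fin => h1; lra.
by rewrite /= leey.
Unshelve. all: by end_near. Qed.

End generalized_fatou.

(** * Passing to the limit in the interaction with the exterior *)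

Section fatou_variants.
Context d (T : measurableType d) {R : realType} (mu : {measure set T -> \bar R}).
Variables (D : set T) (mD : measurable D).
Local Open Scope ereal_scope.

Lemma fatou_ae (f_ : nat -> T -> \bar R) (f : T -> \bar R) :
  (forall k, measurable_fun D (f_ k)) -> measurable_fun D f ->
  (forall k x, D x -> 0 <= f_ k x) -> (forall x, D x -> 0 <= f x) ->
  {ae mu, forall x, D x -> f x <= limn_einf (f_ ^~ x)} ->
  \int[mu]_(x in D) f x <= limn_einf (fun k => \int[mu]_(x in D) f_ k x).
Proof.
move=> mf_ mf f_0 f0 fl.
apply: le_trans (fatou mu mD mf_ f_0).
apply: ae_ge0_le_integral => //; last exact: measurable_limn_einf.
by move=> x Dx; apply: limn_einf_ge; apply: nearW => k; exact: f_0.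
Qed.

Lemma limn_einf_le_cst (u : (\bar R)^nat) (c : \bar R) :
  (forall k, u k <= c) -> limn_einf u <= c.
Proof.
move=> uc; rewrite limn_einf_supE; apply: ge_ereal_sup => _ [n _ <-].
by apply: le_trans (uc n); apply: ereal_inf_lbound; exists n => /=.
Qed.

End fatou_variants.

Section quotients.
Context d (T : measurableType d) {R : realType}.
Implicit Types (K : T -> T -> R) (v w : T -> R) (p : R).

Definition powdiff p K v w (z : T * T) : \bar R :=
  (`|v z.1 - w z.2| `^ p * K z.1 z.2)%:E.

Lemma measurable_powdiff p K v w : measurable_fun setT (fun z => K z.1 z.2) ->
  measurable_fun setT v -> measurable_fun setT w -> measurable_fun setT (powdiff p K v w).
Proof.
move=> mK mv mw; apply/measurable_EFinP; apply: measurable_funM => //.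
apply: measurable_fun_powR; apply: measurableT_comp => //; apply: measurable_funB.
  exact: measurableT_comp mv measurable_fst.
exact: measurableT_comp mw measurable_snd.
Qed.

Lemma powdiff_ge0 p K v w z : (forall x y, 0 <= K x y) -> (0 <= powdiff p K v w z)%E.
Proof. by move=> K0; rewrite lee_fin mulr_ge0 ?powR_ge0. Qed.

End quotients.

Section inner_limit.
Context d (T : measurableType d) {R : realType} (mu : {measure set T -> \bar R}).
Variables (D : set T) (mD : measurable D).
Variables (p : nat -> R) (K_ : nat -> T -> R) (K Kb : T -> R) (psi_ : nat -> T -> R) (psi : T -> R).
Hypotheses (p1 : forall k, 1 <= p k <= 2) (p_cvg : p k @[k --> \oo] --> (1 : R)).
Hypotheses (mK_ : forall k, measurable_fun D (K_ k)) (mK : measurable_fun D K)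
  (mKb : measurable_fun D Kb) (mpsi_ : forall k, measurable_fun D (psi_ k))
  (mpsi : measurable_fun D psi).
Hypotheses (K_0 : forall k y, D y -> 0 <= K_ k y)
  (K_cvg : forall y, D y -> K_ k y @[k --> \oo] --> K y)
  (K_b : forall k y, D y -> K_ k y <= Kb y) (iKb : (rint mu D Kb < +oo)%E).
Hypothesis psi_cvg : {ae mu, forall y, D y -> psi_ k y @[k --> \oo] --> psi y}.
Variables (gx : R).
Hypothesis tail_le : forall k, (rint mu D (fun y => `|psi_ k y| `^ p k * K_ k y)%R <= gx%:E)%E.

Let p1k k : 1 <= p k. Proof. by have /andP[] := p1 k. Qed.
Let p2k k : p k <= 2. Proof. by have /andP[] := p1 k. Qed.
Let p0k k : 0 <= p k. Proof. exact: le_trans (p1k k). Qed.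

Let K0 y : D y -> 0 <= K y.
Proof.
move=> Dy; rewrite -(cvg_lim (@Rhausdorff R) (K_cvg Dy)).
by apply: limr_ge; [apply/cvg_ex; exists (K y); exact: K_cvg|apply: nearW => k; exact: K_0].
Qed.

Let KKb y : D y -> K y <= Kb y.
Proof.
move=> Dy; rewrite -(cvg_lim (@Rhausdorff R) (K_cvg Dy)).
by apply: limr_le; [apply/cvg_ex; exists (K y); exact: K_cvg|apply: nearW => k; exact: K_b].
Qed.

Let measurable_int (f k : T -> R) q : measurable_fun D f -> measurable_fun D k ->
  measurable_fun D (fun y => `|f y| `^ q * k y).
Proof.
by move=> mf mk; apply: measurable_funM => //; apply: measurable_fun_powR; apply: measurableT_comp.
Qed.

Let shift_measurable (c : R) (f : T -> R) : measurable_fun D f -> measurable_fun D (fun y => c - f y).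
Proof. by move=> mf; exact: measurable_funB. Qed.

Lemma cvg_shifted_power (c_ : nat -> R) (c : R) y : c_ k @[k --> \oo] --> c ->
  D y -> psi_ k y @[k --> \oo] --> psi y ->
  `|c_ k - psi_ k y| `^ p k * K_ k y @[k --> \oo] --> `|c - psi y| `^ 1 * K y.
Proof.
move=> cc Dy py; apply: cvgM; last exact: K_cvg.
rewrite powRr1//; apply: cvg_powR_to1 => //.
by apply: cvg_norm; exact: cvgB.
Qed.

(** The point x is frozen here: psi_ is the exterior datum, and the constants
    c_ are the values at x. *)
Lemma shifted_fatou (c_ : nat -> R) (c : R) : c_ k @[k --> \oo] --> c ->
  (rint mu D (fun y => `|c - psi y| `^ 1 * K y)%R <=
   limn_einf (fun k => rint mu D (fun y => `|c_ k - psi_ k y| `^ p k * K_ k y)%R))%E.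
Proof.
move=> cc; apply: fatou_ae => //.
- by move=> k; apply/measurable_EFinP; apply: measurable_int => //; exact: shift_measurable.
- by apply/measurable_EFinP; apply: measurable_int => //; exact: shift_measurable.
- by move=> k y Dy; rewrite lee_fin mulr_ge0 ?powR_ge0 ?K_0.
- by move=> y Dy; rewrite lee_fin mulr_ge0 ?powR_ge0 ?K0.
apply: filterS psi_cvg => y py Dy.
have cv : (`|c_ k - psi_ k y| `^ p k * K_ k y)%:E @[k --> \oo] --> (`|c - psi y| `^ 1 * K y)%:E.
  by apply: cvg_EFin; [exact: nearW|exact: cvg_shifted_power (py Dy)].
by rewrite (cvg_limn_einf_sup cv).1.
Qed.

Lemma two_pow_le2 k : 2 `^ (p k - 1) <= 2 :> R.
Proof.
have : 2 `^ (p k - 1) <= 2 `^ 1 :> R.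
  by apply: ler_powR; [rewrite ler1n|rewrite lerBlDr -[1 + 1]/(2%:R : R)].
by rewrite powRr1.
Qed.

(** |c - psi|^p is at most 2 (|c|^p + |psi|^p): the first term is controlled by
    the mass of the kernel, the second by the tail. *)
Lemma shifted_le (c : R) k :
  (rint mu D (fun y => `|c - psi_ k y| `^ p k * K_ k y)%R <=
   (2 * `|c| `^ p k)%:E * rint mu D (K_ k) + 2%:E * gx%:E)%E.
Proof.
have c0 : 0 <= 2 * `|c| `^ p k by rewrite mulr_ge0 ?powR_ge0.
apply: (@le_trans _ _ ((2 * `|c| `^ p k)%:E * rint mu D (K_ k) +
   2%:E * rint mu D (fun y => `|psi_ k y| `^ p k * K_ k y)%R)%E); last first.
  by apply: leeD => //; apply: lee_wpmul2l; rewrite ?lee_fin.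
have mKE : measurable_fun D (EFin \o K_ k) by exact/measurable_EFinP.
have mpE : measurable_fun D (fun y => (`|psi_ k y| `^ p k * K_ k y)%:E).
  by apply/measurable_EFinP; exact: measurable_int.
have pE0 y : D y -> (0 <= (`|psi_ k y| `^ p k * K_ k y)%:E)%E.
  by move=> Dy; rewrite lee_fin mulr_ge0 ?powR_ge0 ?K_0.
rewrite /rint -(ge0_integralZl mu mD mKE)//; last by move=> y Dy; rewrite /= lee_fin K_0.
rewrite -(ge0_integralZl mu mD mpE)//.
rewrite -(ge0_integralD mu mD)//; first last.
- by apply: emeasurable_funM => //; exact: measurable_cst.
- by move=> y Dy; apply: mule_ge0 => //; exact: pE0.
- by apply: emeasurable_funM => //; exact: measurable_cst.
- by move=> y Dy; rewrite /= -EFinM lee_fin mulr_ge0 ?K_0.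
apply: ge0_le_integral => //.
- by move=> y Dy; rewrite lee_fin mulr_ge0 ?powR_ge0 ?K_0.
- by apply/measurable_EFinP; apply: measurable_int => //; exact: shift_measurable.
- by apply: emeasurable_funD; apply: emeasurable_funM => //; exact: measurable_cst.
move=> y Dy; rewrite /= -!EFinM -EFinD lee_fin -mulrA -mulrDr.
rewrite -mulrDl mulrA ler_wpM2r ?K_0//.
apply: (@le_trans _ _ ((`|c| + `|psi_ k y|) `^ p k)).
  by apply: ge0_ler_powR; rewrite ?nnegrE ?addr_ge0// ler_normB.
apply: le_trans (powR_triangle (p1k k) _ _) _ => //.
by rewrite ler_wpM2r ?addr_ge0 ?powR_ge0// two_pow_le2.
Qed.

Lemma rint_kernel_lt k : (rint mu D (K_ k) < +oo)%E.
Proof.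
apply: le_lt_trans iKb; apply: ge0_le_integral => //; do ?exact/measurable_EFinP.
- by move=> y Dy; rewrite lee_fin K_0.
- by move=> y Dy; rewrite lee_fin K_b.
Qed.

Lemma shifted_lt (c : R) k : (rint mu D (fun y => `|c - psi_ k y| `^ p k * K_ k y)%R < +oo)%E.
Proof.
apply: le_lt_trans (shifted_le c k) _; rewrite lte_add_pinfty// -?EFinM ?ltry//.
by rewrite lte_mul_pinfty ?lee_fin ?mulr_ge0 ?powR_ge0// rint_kernel_lt.
Qed.

Lemma limit_shifted_lt (c : R) : (rint mu D (fun y => `|c - psi y| `^ 1 * K y)%R < +oo)%E.
Proof.
have b0 : 0 <= 2 * (1 + `|c| ^+ 2) by rewrite mulr_ge0 ?addr_ge0 ?sqr_ge0.
apply: le_lt_trans (shifted_fatou (cvg_cst c)) _.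
apply: (@le_lt_trans _ _ ((2 * (1 + `|c| ^+ 2))%:E * rint mu D Kb + 2%:E * gx%:E)%E); last first.
  by rewrite lte_add_pinfty// -?EFinM ?ltry// lte_mul_pinfty ?lee_fin.
apply: limn_einf_le_cst => k; apply: le_trans (shifted_le c k) _.
rewrite leeD2r//; apply: lee_pmul; rewrite ?lee_fin ?mulr_ge0 ?powR_ge0//.
- by apply: integral_ge0 => y Dy; rewrite lee_fin K_0.
- rewrite ler_wpM2l//; have [c1|c1] := leP `|c| 1.
    apply: (@le_trans _ _ (1 `^ p k)); first by apply: ge0_ler_powR; rewrite ?nnegrE.
    by rewrite powR1 lerDl sqr_ge0.
  rewrite -[leLHS]add0r lerD//.
  by rewrite -powR_mulrn// ler_powR// ltW.
- apply: ge0_le_integral => //; do ?exact/measurable_EFinP.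
  + by move=> y Dy; rewrite lee_fin K_0.
  + by move=> y Dy; rewrite lee_fin K_b.
Qed.

(** The triangle inequality with constant 2^(p-1) compares the two powers up to
    a factor that tends to 1, so that the part of the exterior data that is
    not tight in y cancels in the limit. *)
Lemma inner_limit (a_ : nat -> R) (a b e : R) : a_ k @[k --> \oo] --> a -> 0 < e ->
  \forall k \near \oo,
  (rint mu D (fun y => `|a - psi y| `^ 1 * K y)%R +
   rint mu D (fun y => `|b - psi_ k y| `^ p k * K_ k y)%R <=
   rint mu D (fun y => 2 `^ (p k - 1) * (`|a_ k - psi_ k y| `^ p k * K_ k y))%R +
   rint mu D (fun y => `|b - psi y| `^ 1 * K y)%R + e%:E)%E.
Proof.
move=> aa e0.
pose th k : R := 2 `^ (p k - 1).
have th_cvg : th k @[k --> \oo] --> (1 : R).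
  rewrite -[1 in X in _ --> X](powRr0 2) -(subrr 1); apply: cvg_powR_gt0 => //.
    exact: cvg_cst.
  by apply: cvgB => //; exact: cvg_cst.
pose c k : R := th k * `|b - a_ k| `^ p k.
have c_cvg : c k @[k --> \oo] --> `|b - a|.
  rewrite -[X in _ --> X]mul1r; apply: cvgM => //; apply: cvg_powR_to1 => //.
  by apply: cvg_norm; apply: cvgB => //; exact: cvg_cst.
have c0 k : 0 <= c k by rewrite mulr_ge0 ?powR_ge0.
have iKoo : (rint mu D K < +oo)%E.
  by apply: le_lt_trans iKb; apply: ge0_le_integral => //; exact/measurable_EFinP.
have rintZ (r : R) (k : T -> R) : 0 <= r -> measurable_fun D k -> (forall y, D y -> 0 <= k y) ->
    rint mu D (fun y => r * k y)%R = (r%:E * rint mu D k)%E.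
  move=> r0 mk k0; rewrite /rint -ge0_integralZl//; exact/measurable_EFinP.
apply: (@generalized_fatou _ _ _ mu D mD
  (fun k y => th k * (`|a_ k - psi_ k y| `^ p k * K_ k y))
  (fun k y => `|b - psi_ k y| `^ p k * K_ k y)
  (fun k y => c k * K_ k y)
  (fun y => `|a - psi y| `^ 1 * K y)
  (fun y => `|b - psi y| `^ 1 * K y)
  (fun y => `|b - a| * K y)) => //.
- by move=> k; apply: measurable_funM => //; apply: measurable_int => //; exact: shift_measurable.
- by move=> k; apply: measurable_int => //; exact: shift_measurable.
- by move=> k; apply: measurable_funM.
- by apply: measurable_int => //; exact: shift_measurable.
- by apply: measurable_int => //; exact: shift_measurable.
- by apply: measurable_funM.
- by move=> k y Dy; rewrite !mulr_ge0 ?powR_ge0 ?K_0.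
- by move=> k y Dy; rewrite !mulr_ge0 ?powR_ge0 ?K_0.
- by move=> k y Dy; rewrite mulr_ge0 ?c0 ?K_0.
- by move=> y Dy; rewrite mulr_ge0 ?powR_ge0 ?K0.
- by move=> y Dy; rewrite mulr_ge0 ?powR_ge0 ?K0.
- by move=> y Dy; rewrite mulr_ge0 ?K0.
- move=> k y Dy; rewrite mulrA -mulrDl ler_wpM2r ?K_0// /c -mulrDr.
  apply: le_trans (powR_triangle (p1k k) _ _) => //.
  apply: ge0_ler_powR; rewrite ?nnegrE ?addr_ge0//.
  by rewrite [leRHS]addrC (_ : b - psi_ k y = (b - a_ k) + (a_ k - psi_ k y)) ?ler_normD//; ring.
- apply: filterS psi_cvg => y py Dy e' e'0.
  have c1 : th k * (`|a_ k - psi_ k y| `^ p k * K_ k y) + c k * K_ k y -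
      `|b - psi_ k y| `^ p k * K_ k y @[k --> \oo] -->
      1 * (`|a - psi y| `^ 1 * K y) + `|b - a| * K y - `|b - psi y| `^ 1 * K y.
    apply: cvgB; last by apply: (cvg_shifted_power (c_ := fun=> b)) (py Dy) => //; exact: cvg_cst.
    apply: cvgD; last by apply: cvgM => //; exact: K_cvg.
    by apply: cvgM => //; exact: cvg_shifted_power (py Dy).
  have := cvgr_gt _ c1 (1 * (`|a - psi y| `^ 1 * K y) + `|b - a| * K y - `|b - psi y| `^ 1 * K y - e').
  rewrite ltrBlDr ltrDl => /(_ _ e'0).
  apply: filterS => k; rewrite mul1r; lra.
- exact: limit_shifted_lt.
- exact: limit_shifted_lt.
- by rewrite rintZ ?normr_ge0// lte_mul_pinfty ?lee_fin.
- by move=> k; exact: shifted_lt.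
- move=> e' e'0.
  have KE : rint mu D (K_ k) @[k --> \oo] --> rint mu D K.
    have [|||||//] := @dominated_convergence _ _ _ mu D mD
      (fun k => EFin \o K_ k) (EFin \o K) (EFin \o Kb).
    + by move=> k; exact/measurable_EFinP.
    + exact/measurable_EFinP.
    + apply: nearW => y Dy; apply: cvg_EFin; first exact: nearW.
      exact: K_cvg.
    + apply/integrableP; split; first exact/measurable_EFinP.
      apply: le_lt_trans iKb; rewrite /rint le_eqVlt; apply/orP; left; apply/eqP.
      apply: eq_integral => y /set_mem Dy; by rewrite /= ger0_norm// (le_trans (K0 Dy))// KKb.
    + apply: nearW => y k Dy; rewrite /= lee_fin ger0_norm ?K_0//; exact: K_b.
  have [Kr KrE] : exists r : R, rint mu D K = r%:E.
    by exists (fine (rint mu D K)); rewrite fineK// ge0_fin_numE// integral_ge0// => y Dy; rewrite lee_fin K0.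
  rewrite KrE in KE.
  have cK : c k * fine (rint mu D (K_ k)) @[k --> \oo] --> `|b - a| * Kr.
    by apply: cvgM => //; exact: fine_cvg KE.
  have := cvgr_lt _ cK (`|b - a| * Kr + e'); rewrite ltrDl => /(_ _ e'0).
  apply: filterS => k ck.
  rewrite (rintZ (c k) (K_ k))//; last by move=> y Dy; exact: K_0.
  rewrite (rintZ `|b - a| K)// KrE -EFinM -EFinD.
  rewrite -(@fineK _ (rint mu D (K_ k))); first by rewrite -EFinM lee_fin ltW.
  by rewrite ge0_fin_numE ?rint_kernel_lt// integral_ge0// => y Dy; rewrite lee_fin K_0.
Qed.

End inner_limit.

Section outer_limit.
Context d (T : measurableType d) {R : realType} (mu : {sigma_finite_measure set T -> \bar R}).
Variables (D C : set T) (mD : measurable D) (mC : measurable C).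
Variables (p : nat -> R) (K_ : nat -> T -> T -> R) (K Kb : T -> T -> R).
Variables (u_ : nat -> T -> R) (u w g H : T -> R) (M : R).
Hypotheses (p1 : forall k, 1 <= p k <= 2) (p_cvg : p k @[k --> \oo] --> (1 : R)).
Hypotheses (mK_ : forall k, measurable_fun setT (fun z => K_ k z.1 z.2))
  (mK : measurable_fun setT (fun z => K z.1 z.2))
  (mKb : forall x, D x -> measurable_fun C (Kb x)).
Hypotheses (K_0 : forall k x y, 0 <= K_ k x y) (K0 : forall x y, 0 <= K x y)
  (K_cvg : forall x y, D x -> C y -> K_ k x y @[k --> \oo] --> K x y)
  (K_b : forall k x y, D x -> C y -> K_ k x y <= Kb x y)
  (iKb : forall x, D x -> (rint mu C (Kb x) < +oo)%E).
Hypotheses (mu_ : forall k, measurable_fun setT (u_ k)) (mu0 : measurable_fun setT u)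
  (mw : measurable_fun setT w).
Hypothesis u_C : {ae mu, forall y, C y -> u_ k y @[k --> \oo] --> u y}.
Hypothesis u_D : forall x, D x -> u_ k x @[k --> \oo] --> u x.
Hypotheses (mg : measurable_fun D g) (g0 : forall x, D x -> 0 <= g x) (ig : (rint mu D g < +oo)%E).
Hypothesis tail_le : forall k x, D x ->
  (rint mu C (fun y => (`|u_ k y| `^ p k * K_ k x y)%R) <= (g x)%:E)%E.
Hypotheses (mH : measurable_fun D H) (H0 : forall x, D x -> 0 <= H x) (iH : (rint mu D H < +oo)%E).
Hypothesis H_le : forall k x, D x ->
  ((2 * `|w x| `^ p k)%:E * rint mu C (K_ k x) <= (H x)%:E)%E.
Local Open Scope ereal_scope.

Let A_ k x := \int[mu]_(y in C) powdiff (p k) (K_ k) (u_ k) (u_ k) (x, y).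
Let B_ k x := \int[mu]_(y in C) powdiff (p k) (K_ k) w (u_ k) (x, y).
Let A x := \int[mu]_(y in C) powdiff 1 K u u (x, y).
Let B x := \int[mu]_(y in C) powdiff 1 K w u (x, y).

Hypothesis A_M : forall k, \int[mu]_(x in D) A_ k x <= M%:E.

Let p1k k : (1 <= p k)%R. Proof. by have /andP[] := p1 k. Qed.

Let msec (f : T * T -> R) x : measurable_fun setT f -> measurable_fun C (fun y => f (x, y)).
Proof.
move=> mf; apply: (@measurable_funS _ _ _ _ setT) => //.
exact: measurableT_comp mf (measurable_pair1 x).
Qed.

Let mK_x k x : measurable_fun C (K_ k x). Proof. exact: (msec x (mK_ k)). Qed.
Let mKx x : measurable_fun C (K x). Proof. exact: (msec x mK). Qed.
Let mu_C k : measurable_fun C (u_ k). Proof. exact: measurable_funS (mu_ k). Qed.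
Let muC : measurable_fun C u. Proof. exact: measurable_funS mu0. Qed.

Let mA_ k : measurable_fun D (A_ k).
Proof.
apply: (@measurable_inner _ _ _ mu (powdiff (p k) (K_ k) (u_ k) (u_ k))) => //; first exact: measurable_powdiff.
by move=> z; exact: powdiff_ge0.
Qed.
Let mB_ k : measurable_fun D (B_ k).
Proof.
apply: (@measurable_inner _ _ _ mu (powdiff (p k) (K_ k) w (u_ k))) => //; first exact: measurable_powdiff.
by move=> z; exact: powdiff_ge0.
Qed.
Let mA : measurable_fun D A.
Proof.
apply: (@measurable_inner _ _ _ mu (powdiff 1 K u u)) => //; first exact: measurable_powdiff.
by move=> z; exact: powdiff_ge0.
Qed.
Let mB : measurable_fun D B.
Proof.
apply: (@measurable_inner _ _ _ mu (powdiff 1 K w u)) => //; first exact: measurable_powdiff.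
by move=> z; exact: powdiff_ge0.
Qed.

Let A_0 k x : 0 <= A_ k x. Proof. by apply: integral_ge0 => y _; exact: powdiff_ge0. Qed.
Let B_0 k x : 0 <= B_ k x. Proof. by apply: integral_ge0 => y _; exact: powdiff_ge0. Qed.
Let A0 x : 0 <= A x. Proof. by apply: integral_ge0 => y _; exact: powdiff_ge0. Qed.
Let B0 x : 0 <= B x. Proof. by apply: integral_ge0 => y _; exact: powdiff_ge0. Qed.

Let B_le k x : D x -> B_ k x <= (H x + 2 * g x)%:E.
Proof.
move=> Dx; apply: le_trans (@shifted_le _ _ _ mu C mC p (fun k => K_ k x) u_ p1
  (fun k => mK_x k x) mu_C (fun k y _ => K_0 k x y) (g x) (fun k => tail_le k Dx) (w x) k) _.
by rewrite [leRHS]EFinD [X in _ <= _ + X]EFinM leeD2r// H_le.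
Qed.

Let A_lty k x : D x -> A_ k x < +oo.
Proof.
move=> Dx; exact: (@shifted_lt _ _ _ mu C mC p (fun k => K_ k x) (Kb x) u_ p1
  (fun k => mK_x k x) (mKb Dx) mu_C (fun k y _ => K_0 k x y) (fun k y => K_b k Dx) (iKb Dx)
  (g x) (fun k => tail_le k Dx) (u_ k x) k).
Qed.

Let B_lty k x : D x -> B_ k x < +oo.
Proof. by move=> Dx; apply: le_lt_trans (B_le k Dx) _; rewrite ltry. Qed.

Let AB_lty c x : D x -> rint mu C (fun y => `|c - u y| `^ 1 * K x y)%R < +oo.
Proof.
move=> Dx; exact: (@limit_shifted_lt _ _ _ mu C mC p (fun k => K_ k x) (K x) (Kb x) u_ u p1 p_cvg
  (fun k => mK_x k x) (mKx x) (mKb Dx) mu_C muC (fun k y _ => K_0 k x y) (fun y => K_cvg Dx)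
  (fun k y => K_b k Dx) (iKb Dx) u_C (g x) (fun k => tail_le k Dx) c).
Qed.

Let A_fatou x : D x -> A x <= limn_einf (A_ ^~ x).
Proof.
move=> Dx; exact: (@shifted_fatou _ _ _ mu C mC p (fun k => K_ k x) (K x) u_ u p1 p_cvg
  (fun k => mK_x k x) (mKx x) mu_C muC (fun k y _ => K_0 k x y) (fun y => K_cvg Dx)
  u_C (u_ ^~ x) (u x) (u_D Dx)).
Qed.

Let B_fatou x : D x -> B x <= limn_einf (B_ ^~ x).
Proof.
move=> Dx; exact: (@shifted_fatou _ _ _ mu C mC p (fun k => K_ k x) (K x) u_ u p1 p_cvg
  (fun k => mK_x k x) (mKx x) mu_C muC (fun k y _ => K_0 k x y) (fun y => K_cvg Dx)
  u_C (fun=> w x) (w x) (cvg_cst _)).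
Qed.

Lemma limit_interaction_le : \int[mu]_(x in D) A x <= M%:E.
Proof.
apply: (@le_trans _ _ (limn_einf (fun k => \int[mu]_(x in D) A_ k x))).
  exact: (fatou_ae mD mA_ mA (fun k x _ => A_0 k x) (fun x _ => A0 x) (nearW _ A_fatou)).
exact: limn_einf_le_cst.
Qed.

Let Hg x := (H x + 2 * g x)%R.
Let mHg : measurable_fun D Hg.
Proof. by apply: measurable_funD => //; exact: measurable_funM. Qed.
Let Hg0 x : D x -> (0 <= Hg x)%R.
Proof. by move=> Dx; rewrite /Hg addr_ge0 ?H0// mulr_ge0 ?g0. Qed.
Let iHg : rint mu D Hg < +oo.
Proof.
rewrite /rint /Hg; under eq_integral do rewrite EFinD EFinM.
have mgE : measurable_fun D (EFin \o g) by exact/measurable_EFinP.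
rewrite ge0_integralD//; first last.
- by apply: emeasurable_funM => //; exact: measurable_cst.
- by move=> x Dx; rewrite -EFinM lee_fin mulr_ge0 ?g0.
- exact/measurable_EFinP.
by rewrite (ge0_integralZl mu mD mgE)// lte_add_pinfty// lte_mul_pinfty.
Qed.

Let B__le k : \int[mu]_(x in D) B_ k x <= rint mu D Hg.
Proof.
have mHgE : measurable_fun D (EFin \o Hg) by exact/measurable_EFinP.
exact: (ge0_le_integral mu mD (fun x _ => B_0 k x) (mB_ k) mHgE (@B_le k)).
Qed.

Lemma competitor_interaction_lt : \int[mu]_(x in D) B x < +oo.
Proof.
apply: le_lt_trans iHg.
apply: (@le_trans _ _ (limn_einf (fun k => \int[mu]_(x in D) B_ k x))).
  exact: (fatou_ae mD mB_ mB (fun k x _ => B_0 k x) (fun x _ => B0 x) (nearW _ B_fatou)).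
exact: limn_einf_le_cst.
Qed.

Let B__lt k : \int[mu]_(x in D) B_ k x < +oo.
Proof. exact: le_lt_trans (B__le k) iHg. Qed.

Let fineK_in (F : T -> \bar R) x : (forall x, 0 <= F x) -> (F x < +oo) -> (fine (F x))%:E = F x.
Proof. by move=> F0 Foo; rewrite fineK// ge0_fin_numE. Qed.

Let A_lt x : D x -> A x < +oo. Proof. exact: (AB_lty (u x)). Qed.
Let B_lt x : D x -> B x < +oo. Proof. exact: (AB_lty (w x)). Qed.

Let rint_fine (F : T -> \bar R) : (forall x, 0 <= F x) -> (forall x, D x -> F x < +oo) ->
  rint mu D (fun x => fine (F x)) = \int[mu]_(x in D) F x.
Proof.
by move=> F0 Foo; apply: eq_integral => x /set_mem Dx; rewrite fineK_in// Foo.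
Qed.

Let mfine (F : T -> \bar R) : measurable_fun D F -> measurable_fun D (fun x => fine (F x)).
Proof. by move=> mF; exact: measurableT_comp mF. Qed.

(** Fatou's lemma is used twice, once in y for almost every x, and once in x,
    where only the domination of the tails by g allows it. *)
Lemma outer_limit (e : R) : (0 < e)%R -> \forall k \near \oo,
  \int[mu]_(x in D) A x + \int[mu]_(x in D) B_ k x <=
  \int[mu]_(x in D) A_ k x + \int[mu]_(x in D) B x + e%:E.
Proof.
move=> e0.
pose th k : R := (2 `^ (p k - 1))%R.
have th0 k : (0 <= th k)%R by exact: powR_ge0.
have th_cvg : (th k @[k --> \oo] --> (1 : R))%R.
  rewrite -[X in _ --> X](powRr0 2) -(subrr 1%R); apply: cvg_powR_gt0 => //.
    exact: cvg_cst.
  by apply: cvgB => //; exact: cvg_cst.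
have e2 : (0 < e / 2)%R by rewrite divr_gt0.
have thA k : rint mu D (fun x => th k * fine (A_ k x))%R = (th k)%:E * \int[mu]_(x in D) A_ k x.
  have mAE : measurable_fun D (EFin \o (fun x => fine (A_ k x))).
    by apply/measurable_EFinP; exact: mfine.
  have A_f0 x : D x -> 0 <= (fine (A_ k x))%:E by move=> _; rewrite lee_fin fine_ge0 ?A_0.
  have th0E : 0 <= (th k)%:E by rewrite lee_fin th0.
  rewrite -(rint_fine (A_0 k) (@A_lty k)) /rint -(ge0_integralZl mu mD mAE A_f0 th0E).
  by apply: eq_integral => x _; rewrite /= EFinM.
have mfA k : measurable_fun D (fun x => th k * fine (A_ k x))%R.
  by apply: measurable_funM; [exact: measurable_cst|exact: mfine (mA_ k)].
have fA0 k x : D x -> (0 <= th k * fine (A_ k x))%R.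
  by move=> _; apply: mulr_ge0; [exact: th0|exact: fine_ge0 (A_0 k x)].
have gfh k x : D x -> (fine (B_ k x) <= th k * fine (A_ k x) + Hg x)%R.
  move=> Dx; rewrite -[leLHS]add0r; apply: lerD; first exact: fA0.
  by rewrite -lee_fin (fineK_in (B_0 k) (B_lty k Dx)); exact: B_le.
have lim_ae : {ae mu, forall x, D x -> forall e' : R, (0 < e')%R -> \forall k \near \oo,
    (fine (A x) + Hg x + fine (B_ k x) <= th k * fine (A_ k x) + Hg x + fine (B x) + e')%R}.
  apply: nearW => x Dx e' e'0.
  have il : \forall k \near \oo, A x + B_ k x <=
      rint mu C (fun y => 2 `^ (p k - 1) * (`|u_ k x - u_ k y| `^ p k * K_ k x y))%R + B x + e'%:E :=
    @inner_limit _ _ _ mu C mC p (fun k => K_ k x) (K x) (Kb x) u_ u p1 p_cvg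
    (fun k => mK_x k x) (mKx x) (mKb Dx) mu_C muC (fun k y _ => K_0 k x y) (fun y => K_cvg Dx)
    (fun k y => K_b k Dx) (iKb Dx) u_C (g x) (fun k => tail_le k Dx)
    (u_ ^~ x) (u x) (w x) e' (u_D Dx) e'0.
  apply: filterS il => k.
  have -> : rint mu C (fun y => 2 `^ (p k - 1) * (`|u_ k x - u_ k y| `^ p k * K_ k x y))%R =
      (th k)%:E * A_ k x.
    have mq : measurable_fun C (fun y => powdiff (p k) (K_ k) (u_ k) (u_ k) (x, y)).
      apply: (measurable_funS measurableT (@subsetT _ _)).
      exact: (measurableT_comp (measurable_powdiff (p k) (mK_ k) (mu_ k) (mu_ k)) (measurable_pair1 x)).
    have q0 y : C y -> 0 <= powdiff (p k) (K_ k) (u_ k) (u_ k) (x, y) by move=> _; exact: powdiff_ge0.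
    have th0E : 0 <= (th k)%:E by rewrite lee_fin th0.
    by rewrite /A_ -(ge0_integralZl mu mC mq q0 th0E).
  have [a aE] : exists a : R, A x = a%:E by exists (fine (A x)); rewrite (fineK_in A0 (A_lt Dx)).
  have [b bE] : exists b : R, B x = b%:E by exists (fine (B x)); rewrite (fineK_in B0 (B_lt Dx)).
  have [a' a'E] : exists a : R, A_ k x = a%:E.
    by exists (fine (A_ k x)); rewrite (fineK_in (A_0 k) (A_lty k Dx)).
  have [b' b'E] : exists b : R, B_ k x = b%:E.
    by exists (fine (B_ k x)); rewrite (fineK_in (B_0 k) (B_lty k Dx)).
  rewrite a'E b'E aE bE /=.
  by rewrite -EFinM -!EFinD !lee_fin; lra.
have ih e' : (0 < e')%R -> \forall k \near \oo, rint mu D Hg <= rint mu D Hg + e'%:E.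
  by move=> e'0; apply: nearW => k; rewrite leeDl// lee_fin ltW.
have iA : rint mu D (fun x => fine (A x)) < +oo.
  by rewrite (rint_fine A0 A_lt); apply: le_lt_trans limit_interaction_le _; rewrite ltry.
have iB : rint mu D (fun x => fine (B x)) < +oo.
  by rewrite (rint_fine B0 B_lt); exact: competitor_interaction_lt.
have iB_ k : rint mu D (fun x => fine (B_ k x)) < +oo.
  by rewrite (rint_fine (B_0 k) (@B_lty k)); exact: B__lt.
have main := generalized_fatou mD mfA (fun k => mfine (mB_ k)) (fun=> mHg) (mfine mA) (mfine mB) mHg
  fA0 (fun k x _ => fine_ge0 (B_0 k x)) (fun _ => Hg0) (fun x _ => fine_ge0 (A0 x))
  (fun x _ => fine_ge0 (B0 x)) Hg0 gfh lim_ae iA iB iHg iB_ ih e2.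
have M0 : (0 <= M)%R.
  by have := A_M 0; rewrite -lee_fin; apply: le_trans; apply: integral_ge0 => x _; exact: A_0.
have small : \forall k \near \oo, ((th k - 1) * M <= e / 2)%R.
  have c0 : ((th j - 1) * M @[j --> \oo] --> ((1 - 1) * M : R))%R.
    by apply: cvgM; [apply: cvgB => //; exact: cvg_cst|exact: cvg_cst].
  rewrite subrr mul0r in c0.
  by apply: filterS (cvgr_lt _ c0 _ e2) => k; exact: ltW.
apply: filterS2 main small => k.
rewrite thA (rint_fine A0 A_lt) (rint_fine B0 B_lt) (rint_fine (B_0 k) (@B_lty k)) => main small.
apply: le_trans main _.
have [a aE] : exists a : R, \int[mu]_(x in D) A_ k x = a%:E.
  exists (fine (\int[mu]_(x in D) A_ k x)); rewrite fineK// ge0_fin_numE.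
    by apply: le_lt_trans (A_M k) _; rewrite ltry.
  by apply: integral_ge0 => x _; exact: A_0.
have th1 : (1 <= th k)%R.
  by rewrite -[leLHS](powRr0 2) ler_powR ?ler1n// subr_ge0.
have aM : (a <= M)%R by have := A_M k; rewrite aE lee_fin.
rewrite aE -addeA [leRHS](_ : _ = a%:E + (e / 2)%:E + (\int[mu]_(x in D) B x + (e / 2)%:E)); last first.
  by rewrite [RHS]addeACA -[in RHS]EFinD -(splitr e) addeA.
apply: leeD => //; rewrite -EFinM -EFinD lee_fin.
have : ((th k - 1) * a <= (th k - 1) * M)%R by rewrite ler_wpM2l// subr_ge0.
by move: small; lra.
Qed.

End outer_limit.

(** * The fractional energy *)

Section generic_energy.
Context d (T : measurableType d) {R : realType} (mu : {sigma_finite_measure set T -> \bar R}).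
Local Open Scope ereal_scope.

(** The region is the disjoint union of A x A, A x ~A and ~A x A, and the last
    two contribute equally by symmetry. *)
Lemma integral_cross (A : set T) (f : T * T -> \bar R) : measurable A ->
  measurable_fun setT f -> (forall z, 0 <= f z) -> (forall x y, f (x, y) = f (y, x)) ->
  \int[mu \x mu]_(z in ~` (~` A `*` ~` A)) f z =
  dint mu A A f + 2%:E * dint mu A (~` A) f.
Proof.
move=> mA mf f0 fsym.
have mCA : measurable (~` A) by exact: measurableC.
have -> : ~` (~` A `*` ~` A) = (A `*` setT) `|` (~` A `*` A).
  apply/seteqP; split => -[x y] /=.
    move=> h; have [Ax|Ax] := pselect (A x); first by left.
    by right; split => //; apply: contrapT => Ay; apply: h.
  by move=> [[Ax _]|[_ Ay]] [].
rewrite ge0_integral_setU//.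
- rewrite !dintE// -(setUv A) dint_setUr//; last first.
    by apply/disj_setPS => x [].
  rewrite (dint_swap mu mf f0 mCA mA) -addeA; congr (_ + _).
  rewrite -[X in _ + X](_ : dint mu A (~` A) f = _).
    by rewrite -{1 2}[dint mu A _ f]mul1e -ge0_muleDl.
  by apply: eq_integral => x _; apply: eq_integral => y _; exact: fsym.
- exact: measurableX.
- exact: measurableX.
- exact: measurable_funS mf.
- by apply/disj_setPS => -[x y] [[/= Ax _] []].
Qed.

End generic_energy.

Section frac_measurability.
Context {R : realType}.

Lemma measurable_enorm n d (T : measurableType d) (f : T -> 'rV[R]_n) :
  (forall i, measurable_fun setT (fun t => f t ord0 i)) ->
  measurable_fun setT (fun t => enorm (f t)).
Proof.
move=> mf.
have -> : (fun t => enorm (f t)) = (fun t => (\sum_(i < n) f t ord0 i * f t ord0 i) `^ 2^-1).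
  apply/funext => t; rewrite powR12_sqrt// sumr_ge0// => i _.
  by rewrite -expr2 sqr_ge0.
apply: measurable_fun_powR; apply: measurable_sum => i.
by apply: measurable_funM; exact: mf.
Qed.

Context {n : nat}.
Local Notation Rn := (lebesgueRn R n).

(** The kernel on points of the measurable space, as the lemmas on abstract
    measure spaces need it. *)
Definition fker (s q : R) (x y : Rn) : R := frac_kernel s q x y.

Lemma measurable_coord_sub (i : 'I_n) : measurable_fun [set: Rn * Rn]
  (fun z : Rn * Rn => ((z.1 : 'rV[R]_n) - (z.2 : 'rV[R]_n)) ord0 i).
Proof.
have -> : (fun z : Rn * Rn => ((z.1 : 'rV[R]_n) - (z.2 : 'rV[R]_n)) ord0 i) =
   (fun z : Rn * Rn => (z.1 : 'rV[R]_n) ord0 i) \- (fun z => (z.2 : 'rV[R]_n) ord0 i).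
  by apply/funext => z; rewrite /= !mxE.
apply: measurable_funB.
  exact: (measurableT_comp (measurable_coord i) measurable_fst).
exact: (measurableT_comp (measurable_coord i) measurable_snd).
Qed.

Lemma measurable_frac_kernel (s q : R) :
  measurable_fun [set: Rn * Rn] (fun z : Rn * Rn => fker s q z.1 z.2).
Proof.
have -> : (fun z : Rn * Rn => fker s q z.1 z.2) =
    (fun z : Rn * Rn => enorm ((z.1 : 'rV[R]_n) - (z.2 : 'rV[R]_n)) `^ (- (n%:R + s * q))).
  by apply/funext => z; rewrite /fker frac_kernelE.
by apply: measurable_fun_powR; apply: measurable_enorm; exact: measurable_coord_sub.
Qed.

(** On the diagonal all the kernels vanish, their exponents being nonzero. *)
Lemma cvg_frac_kernel (s : R) (p : nat -> R) (x y : 'rV[R]_n) : 0 < s -> (forall k, 1 <= p k) ->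
  p k @[k --> \oo] --> (1 : R) ->
  frac_kernel s (p k) x y @[k --> \oo] --> frac_kernel s 1 x y.
Proof.
move=> s0 p1 pc.
have -> : (fun k => frac_kernel s (p k) x y) = (fun k => enorm (x - y) `^ (- (n%:R + s * p k))).
  by apply/funext => k; rewrite frac_kernelE.
rewrite frac_kernelE.
have [e0|e0] := ltP 0 (enorm (x - y)).
  apply: cvg_powR_gt0 => //; first exact: cvg_cst.
  apply: cvgN; apply: cvgD; first exact: cvg_cst.
  by apply: cvgM => //; exact: cvg_cst.
have -> : enorm (x - y) = 0 by apply/eqP; rewrite eq_le e0 sqrtr_ge0.
have ne0 q : 1 <= q -> - (n%:R + s * q) != 0.
  move=> q1; rewrite oppr_eq0 gt_eqF// ltr_wpDl// mulr_gt0//.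
  exact: lt_le_trans q1.
rewrite powR0 ?ne0//.
have -> : (fun k => 0 `^ (- (n%:R + s * p k))) = (fun=> 0 : R).
  by apply/funext => k; rewrite powR0 ?ne0.
exact: cvg_cst.
Qed.

(** Away from the diagonal one integrable function dominates the kernels of
    all orders q in [1, 2] at once. *)
Lemma frac_kernel_far (s q r : R) (x y : 'rV[R]_n) : 0 < s -> 1 <= q <= 2 -> 0 < r ->
  r <= `|x - y| -> frac_kernel s q x y <= (1 + r `^ (- s)) * majorant s r x y.
Proof.
move=> s0 /andP[q1 q2] r0 rxy.
have t0 : 0 < `|x - y| by exact: lt_le_trans rxy.
have xy : x != y by rewrite -subr_eq0 -normr_gt0.
apply: le_trans (frac_kernel_le _ xy) _; first by rewrite mulr_ge0 ?(ltW s0)// (le_trans _ q1).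
rewrite /majorant (_ : Num.min _ _ = 1) ?mul1r; last first.
  by apply/min_idPl; rewrite ler_pdivlMr// mul1r.
have -> : - (n%:R + s * q) = - (s * (q - 1)) + - (n%:R + s) by ring.
rewrite powRD; last by rewrite (gt_eqF t0) implybT.
rewrite ler_wpM2r ?powR_ge0//.
have sq : 0 <= s * (q - 1) by rewrite mulr_ge0 ?(ltW s0)// subr_ge0.
have [t1|t1] := leP 1 `|x - y|.
  apply: (@le_trans _ _ 1); last by rewrite lerDl powR_ge0.
  by rewrite -[leRHS](powRr0 `|x - y|) ler_powR// oppr_le0.
apply: (@le_trans _ _ (`|x - y| `^ (- s))).
  apply: ger_powR; first by rewrite t0 ltW.
  rewrite lerN2 -[leRHS]mulr1 ler_wpM2l ?(ltW s0)//; lra.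
rewrite -[leLHS]add0r lerD//; apply: ler_powRN => //; exact: ltW.
Qed.

Lemma energy_dint (Omega : set Rn) (s q : R) (u : Rn -> R) :
  measurable Omega -> measurable_fun setT u ->
  energy Omega s q u = (((2 * q)^-1)%:E * (dint lebesgue Omega Omega (powdiff q (fker s q) u u) +
    2%:E * dint lebesgue Omega (~` Omega) (powdiff q (fker s q) u u)))%E.
Proof.
move=> mO mv; rewrite /energy; congr (_ * _)%E.
have mq := measurable_powdiff q (measurable_frac_kernel s q) mv mv.
have q0 z : (0 <= powdiff q (fker s q) u u z)%E by apply: powdiff_ge0 => x y; exact: frac_kernel_ge0.
have qs (x y : Rn) : powdiff q (fker s q) u u (x, y) = powdiff q (fker s q) u u (y, x).
  by rewrite /powdiff/fker/= distrC frac_kernel_sym.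
exact: (integral_cross lebesgue mO mq q0 qs).
Qed.

Lemma gagliardo_lty (Omega : set Rn) (s q : R) (u : Rn -> R) : 0 < q ->
  (gagliardo Omega s q u < +oo)%E <->
  (dint lebesgue Omega Omega (powdiff q (fker s q) u u) < +oo)%E.
Proof.
move=> q0; have q'0 : q^-1 != 0 by rewrite invr_neq0// gt_eqF.
have E : (\int[lebesgue]_(y in Omega) \int[lebesgue]_(x in Omega) frac_quot s q u x y =
    dint lebesgue Omega Omega (powdiff q (fker s q) u u))%E.
  apply: eq_integral => y _; apply: eq_integral => x _.
  by rewrite /powdiff/fker/= /frac_quot distrC frac_kernel_sym.
rewrite /gagliardo E.
split; last exact: poweR_lty.
exact: (lty_poweRy q'0).
Qed.

End frac_measurability.

(** * Distance to the complement and the fractional Hardy inequality *)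

Section distance.
Context {R : realType} {n : nat}.
Variable C : set 'rV[R]_n.
Hypothesis C_ne : C !=set0.
Implicit Types x y : 'rV[R]_n.

Definition dist x : R := inf [set `|x - y| | y in C].

Let has_inf_dist x : has_inf [set `|x - y| | y in C].
Proof.
split; first by have [y Cy] := C_ne; exists `|x - y|; exists y.
by exists 0 => _ [y _ <-].
Qed.

Lemma dist_le x y : C y -> dist x <= `|x - y|.
Proof. by move=> Cy; apply: ge_inf; [have [] := has_inf_dist x|exists y]. Qed.

Lemma dist_ge0 x : 0 <= dist x.
Proof. by apply: lb_le_inf => [|_ [y _ <-]//]; have [] := has_inf_dist x. Qed.

Lemma dist_approx x e : 0 < e -> exists2 y, C y & `|x - y| < dist x + e.
Proof.
by move=> e0; have [_ [y Cy <-] h] := inf_adherent e0 (has_inf_dist x); exists y.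
Qed.

Lemma dist_triangle x y : dist x <= dist y + `|x - y|.
Proof.
apply/ler_addgt0Pr => e e0; have [z Cz yz] := dist_approx y e0.
apply: le_trans (dist_le x Cz) _.
rewrite (_ : x - z = (x - y) + (y - z)); last by rewrite addrA subrK.
by apply: le_trans (ler_normD _ _) _; lra.
Qed.

Lemma dist_lip x y : `|dist x - dist y| <= `|x - y|.
Proof.
rewrite ler_norml; have := dist_triangle x y; have := dist_triangle y x.
by rewrite (distrC y x) => ? ?; apply/andP; split; lra.
Qed.

Lemma dist_gt0 x : open (~` C) -> ~ C x -> 0 < dist x.
Proof.
move=> oC nCx; have [e /= e0 eC] : exists2 e : R, 0 < e & ball x e `<=` ~` C.
  by apply/nbhs_ballP; apply: open_nbhs_nbhs.
apply: lt_le_trans e0 _; apply: lb_le_inf; first by have [] := has_inf_dist x.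
move=> _ [y Cy <-]; rewrite leNgt; apply/negP => xy.
by apply: (eC y) => //; rewrite -ball_normE.
Qed.

Lemma dist_eq0 x : C x -> dist x = 0.
Proof.
by move=> Cx; apply/eqP; rewrite eq_le dist_ge0 andbT; have := dist_le x Cx; rewrite subrr normr0.
Qed.

Lemma continuous_dist : continuous dist.
Proof.
move=> x; apply/cvgrPdist_lt; first exact: nbhs_filter.
move=> e e0.
have : nbhs x [set y | `|dist x - dist y| < e].
  apply/nbhs_ballP; exists e => //= y; rewrite -ball_normE/=.
  by apply: le_lt_trans; exact: dist_lip.
exact.
Qed.

End distance.

Section hardy.
Context {R : realType} {n : nat}.
Variable s : R.
Hypotheses (n_gt0 : (0 < n)%N) (s0 : 0 < s).
Local Notation Rn := (lebesgueRn R n).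
Local Notation leb := (@lebesgue R n).

Lemma measurable_fker_x q (x : Rn) : measurable_fun [set: Rn] (fker s q x).
Proof. exact: (measurableT_comp (measurable_frac_kernel s q) (measurable_pair1 x)). Qed.

(** On a box of the complement within distance L of x the kernel is at least
    (n L)^-(n+sq), the factor n coming from the comparison of the norms. *)
Lemma kernel_integral_ge (C : set Rn) (q L rho : R) (x y0 : 'rV[R]_n) : 0 <= q ->
  0 < rho -> 0 < L -> measurable C -> ~ C x -> box y0 rho `<=` C ->
  (forall y, box y0 rho y -> `|x - (y : 'rV[R]_n)| <= L) ->
  (((n%:R * L) `^ (- (n%:R + s * q)) * (2 * rho) ^+ n)%:E <= rint leb C (fker s q x))%E.
Proof.
move=> q0 rho0 L0 mC nCx bC bL.
have mb := measurable_box_lebesgue y0 rho.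
have mk : measurable_fun C (EFin \o fker s q x).
  by apply/measurable_EFinP; apply: (measurable_funS measurableT (@subsetT _ _)); exact: measurable_fker_x.
apply: (@le_trans _ _ (rint leb (box y0 rho) (fker s q x))); last first.
  apply: (ge0_subset_integral leb mb mC mk _ bC) => y _.
  by rewrite /= lee_fin; exact: frac_kernel_ge0.
have mc : measurable_fun (box y0 rho : set Rn) (cst (((n%:R * L) `^ (- (n%:R + s * q)))%:E)).
  exact: measurable_cst.
have mkb : measurable_fun (box y0 rho : set Rn) (EFin \o fker s q x).
  exact: measurable_funS mC bC mk.
have c0 y : box y0 rho y -> (0 <= ((n%:R * L) `^ (- (n%:R + s * q)))%:E)%E.
  by move=> _; rewrite lee_fin powR_ge0.
have cle y : box y0 rho y -> (((n%:R * L) `^ (- (n%:R + s * q)))%:E <= (fker s q x y)%:E)%E.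
  move=> by_; rewrite lee_fin; apply: frac_kernel_ge; first by rewrite mulr_ge0// ltW.
    by apply: contra_notN nCx => /eqP ->; exact: bC.
  by rewrite ler_wpM2l// bL.
have := ge0_le_integral leb mb c0 mc mkb cle.
by rewrite integral_cst// EFinM -(lebesgue_box y0 rho0).
Qed.

Lemma dotpDl (x y z : 'rV[R]_n) : dotp (x + y) z = dotp x z + dotp y z.
Proof. by rewrite /dotp -big_split; apply: eq_bigr => i _; rewrite mxE mulrDl. Qed.

Lemma dotpZl (a : R) (x z : 'rV[R]_n) : dotp (a *: x) z = a * dotp x z.
Proof. by rewrite /dotp mulr_sumr; apply: eq_bigr => i _; rewrite mxE mulrA. Qed.

Lemma dotp_le (h nu : 'rV[R]_n) : `|nu| <= 1 -> `|dotp h nu| <= n%:R * `|h|.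
Proof.
move=> nu1; apply: le_trans (ler_norm_sum _ _ _) _.
apply: (@le_trans _ _ (\sum_(i < n) `|h|)); last by rewrite sumr_const card_ord mulr_natl.
apply: ler_sum => i _; rewrite normrM -[leRHS]mulr1 ler_pM ?mx_norm_coord//.
exact: le_trans (mx_norm_coord _ _) nu1.
Qed.

(** Below a point of the complement, at distance d in the direction -nu, a whole
    ball of radius comparable with d lies under the Lipschitz graph. *)
Lemma exterior_ball (Omega : set 'rV[R]_n) (z nu : 'rV[R]_n) (r L : R) (gamma : 'rV[R]_n -> R)
    (x y : 'rV[R]_n) (d : R) :
  enorm nu = 1 -> 0 <= L -> (forall x y, `|gamma x - gamma y| <= L * enorm (x - y)) ->
  (forall x, enorm (x - z) < r -> (Omega x <-> gamma (x - dotp x nu *: nu) < dotp x nu)) ->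
  ~ Omega y -> 0 < d -> `|x - y| <= 2 * d -> d <= `|x - z| -> n%:R * (5 * `|x - z|) < r ->
  let rho := d / (1 + n%:R + L * (n%:R * (1 + n%:R))) in
  box (y - d *: nu) rho `<=` ~` Omega /\
  forall q, box (y - d *: nu) rho q -> `|x - (q : 'rV[R]_n)| <= 4 * d.
Proof.
move=> enu L0 gL OP nOy d0 xy dz zr rho.
have nu1 : `|nu| <= 1 by rewrite -enu enorm_ge.
have D1 : 1 <= 1 + n%:R + L * (n%:R * (1 + n%:R)).
  by rewrite -addrA lerDl addr_ge0// !mulr_ge0.
have rho0 : 0 < rho by rewrite divr_gt0// (lt_le_trans _ D1).
have rhod : rho <= d by rewrite ler_pdivrMr ?ler_peMr ?(ltW d0)// (lt_le_trans _ D1).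
have main q : box (y - d *: nu) rho q -> `|x - (q : 'rV[R]_n)| <= 4 * d /\ ~ Omega q.
  rewrite boxE//= => hq.
  set h : 'rV[R]_n := (q : 'rV[R]_n) - (y - d *: nu) in hq.
  have qE : (q : 'rV[R]_n) = y - d *: nu + h by rewrite /h addrC subrK.
  have dnu : `|d *: nu| <= d by rewrite normrZ (gtr0_norm d0) ler_piMr// ltW.
  have qy : `|(q : 'rV[R]_n) - y| <= d + rho.
    rewrite qE (_ : _ - y = h - d *: nu); last by rewrite addrAC [X in X + h]addrAC subrr add0r addrC.
    by apply: le_trans (ler_normB _ _) _; move: hq dnu; lra.
  have xq : `|x - (q : 'rV[R]_n)| <= 4 * d.
    rewrite (_ : x - _ = (x - y) - ((q : 'rV[R]_n) - y)); last by rewrite opprB addrA subrK.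
    by apply: le_trans (ler_normB _ _) _; move: qy xy rhod; lra.
  split => //.
  have nr (a b : R) : a <= b -> n%:R * a <= n%:R * b by move=> ab; rewrite ler_wpM2l.
  have yz : enorm (y - z) < r.
    apply: le_lt_trans (enorm_le _) _; apply: le_lt_trans zr; apply: nr.
    rewrite (_ : y - z = (x - z) - (x - y)); last by apply/rowP => i; rewrite !mxE; ring.
    by apply: le_trans (ler_normB _ _) _; move: xy dz; lra.
  have qz : enorm ((q : 'rV[R]_n) - z) < r.
    apply: le_lt_trans (enorm_le _) _; apply: le_lt_trans zr; apply: nr.
    rewrite (_ : _ - z = (x - z) - (x - (q : 'rV[R]_n))); last by apply/rowP => i; rewrite !mxE; ring.
    by apply: le_trans (ler_normB _ _) _; move: xq dz; lra.
  move=> /(OP _ qz).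
  have gy : dotp y nu <= gamma (y - dotp y nu *: nu).
    by rewrite leNgt; apply/negP => /(OP _ yz).
  have nunu : dotp nu nu = 1.
    have : enorm nu ^+ 2 = 1 by rewrite enu expr1n.
    by rewrite sqr_sqrtr// sumr_ge0// => i _; rewrite -expr2 sqr_ge0.
  have dq : dotp q nu = dotp y nu - d + dotp h nu.
    by rewrite qE !dotpDl -scaleNr dotpZl nunu mulr1.
  rewrite dq.
  have -> : (q : 'rV[R]_n) - (dotp y nu - d + dotp h nu) *: nu =
      (y - dotp y nu *: nu) + (h - dotp h nu *: nu).
    rewrite qE !scalerDl scaleNr; apply/rowP => i; rewrite !mxE; ring.
  have Ph : enorm (h - dotp h nu *: nu) <= n%:R * (1 + n%:R) * `|h|.
    apply: le_trans (enorm_le _) _; rewrite -mulrA; apply: nr.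
    apply: le_trans (ler_normB _ _) _; rewrite mulrDl mul1r lerD2l normrZ.
    apply: le_trans (dotp_le h nu1).
    by rewrite ler_piMr.
  have g1 := gL (y - dotp y nu *: nu + (h - dotp h nu *: nu)) (y - dotp y nu *: nu).
  rewrite [in X in _ <= X](_ : _ - (y - dotp y nu *: nu) = h - dotp h nu *: nu) in g1; last first.
    by rewrite addrAC subrr add0r.
  have g2 : L * enorm (h - dotp h nu *: nu) <= L * (n%:R * (1 + n%:R) * `|h|) by rewrite ler_wpM2l.
  have h1 := dotp_le h nu1.
  have h2 : (1 + n%:R + L * (n%:R * (1 + n%:R))) * `|h| <= d.
    rewrite -ler_pdivlMl; last exact: lt_le_trans D1.
    by rewrite mulrC ltW.
  have hn : 0 <= `|h| by [].
  move: g1; rewrite ler_norml => /andP[g1 _].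
  have := ler_norm (dotp h nu) => h3.
  rewrite ltNge => /negP; apply.
  have h4 : n%:R * `|h| + L * (n%:R * (1 + n%:R) * `|h|) <= d.
    by move: h2; rewrite !mulrDl mul1r !mulrA; lra.
  by move: g1 g2 h1 h3 h4 gy; rewrite !mulrA; lra.
by split => q /main[].
Qed.

End hardy.

Section hardy_domain.
Context {R : realType} {n : nat}.
Variable s : R.
Hypotheses (n_gt0 : (0 < n)%N) (s0 : 0 < s).
Local Notation Rn := (lebesgueRn R n).
Local Notation leb := (@lebesgue R n).
Variable Omega : set 'rV[R]_n.
Hypotheses (oO : open Omega) (bO : bounded_set Omega).

Lemma bounded_norm : exists2 M : R, 0 < M & forall x, Omega x -> `|x| <= M.
Proof.
have [M [_ hM]] := bO; exists (`|M| + 1); first by rewrite ltr_wpDl.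
by move=> x Ox; apply: (hM (`|M| + 1)) Ox; rewrite (le_lt_trans (ler_norm _))// ltrDl.
Qed.

Lemma exterior_box : exists (y0 : 'rV[R]_n) (L : R),
  [/\ 1 <= L, box y0 1 `<=` ~` Omega &
   forall x y, Omega x -> box y0 1 y -> `|x - (y : 'rV[R]_n)| <= L].
Proof.
have [M M0 OM] := bounded_norm.
exists (const_mx (M + 2)), (2 * M + 3); split; first by lra.
  move=> y yb Oy; have := OM y Oy; apply/negP; rewrite -ltNge.
  apply: lt_le_trans (mx_norm_coord y (Ordinal n_gt0)).
  have := yb (Ordinal n_gt0); rewrite mxE ltr_distl => /andP[y1 _].
  by apply: lt_le_trans (ler_norm _); lra.
move=> x y Ox; rewrite boxE//= => yb.
rewrite (_ : x - _ = x - (((y : 'rV[R]_n) - const_mx (M + 2)) + const_mx (M + 2))); last by rewrite subrK.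
apply: le_trans (ler_normB _ _) _.
have := ler_normD ((y : 'rV[R]_n) - const_mx (M + 2)) (const_mx (M + 2)).
have : `|const_mx (M + 2) : 'rV[R]_n| <= M + 2.
  rewrite [leLHS]/Num.norm/= mx_normrE; apply/bigmax_leP; split => [|i _]; first by lra.
  by rewrite mxE gtr0_norm//; lra.
by have := OM x Ox; lra.
Qed.

Let mO : measurable (Omega : set Rn). Proof. exact: open_lebesgue. Qed.
Let mC : measurable (~` Omega : set Rn). Proof. exact: measurableC. Qed.

(** For u vanishing off Omega, the interaction of u with the exterior is the
    integral of |u|^q against this weight. *)
Definition kappa (q : R) (x : Rn) : \bar R := rint leb (~` Omega : set Rn) (fker s q x).

(** Since Omega is bounded, one unit box of the complement lies at bounded
    distance from all its points. *)
Lemma kappa_ge : exists2 c : R, 0 < c & forall q x, 1 <= q <= 2 -> Omega x -> (c%:E <= kappa q x)%E.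
Proof.
have [y0 [L [L1 bC xL]]] := exterior_box.
have L0 : 0 < L by exact: lt_le_trans L1.
have n1 : 1 <= n%:R :> R by rewrite ler1n.
exists ((n%:R * L) `^ (- (n%:R + s * 2)) * (2 * 1) ^+ n).
  by rewrite mulr_gt0 ?exprn_gt0 ?powR_gt0 ?mulr_gt0// (lt_le_trans ltr01).
move=> q x /andP[q1 q2] Ox.
have q0 : 0 <= q by exact: le_trans q1.
have nO : ~ (~` Omega) x by apply.
apply: le_trans (kernel_integral_ge s0 q0 ltr01 L0 mC nO bC (fun y => xL x y Ox)).
rewrite lee_fin ler_wpM2r ?exprn_ge0//; apply: ler_powR.
  by rewrite -[leLHS]mulr1 ler_pM.
by rewrite lerN2 lerD2l ler_wpM2l// ltW.
Qed.

Lemma complement_nonempty : (~` Omega) !=set0.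
Proof.
have [y0 [L [_ bC _]]] := exterior_box.
by exists y0; apply: bC => i; rewrite subrr normr0.
Qed.

(** The distance to the complement, in the sup norm. *)
Definition depth (x : 'rV[R]_n) : R := dist (~` Omega) x.

Lemma depth_gt0 x : Omega x -> 0 < depth x.
Proof.
by move=> Ox; apply: (dist_gt0 complement_nonempty); [rewrite setCK|rewrite /setC/=; apply].
Qed.

Hypothesis lO : lipschitz_boundary Omega.

(** Near a boundary point a box of size comparable to the depth of x lies in
    the complement at a comparable distance from x (exterior_ball); near an
    interior point the depth is bounded below. *)
Lemma hardy_local (z : 'rV[R]_n) : closure Omega z -> exists2 c : R, 0 < c &
  \forall x \near z, Omega x -> ((c * depth x `^ (- s))%:E <= kappa 1 x)%E.
Proof.
move=> cz.
have [Oz|nOz] := pselect (Omega z).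
  have [c c0 kc] := kappa_ge.
  have dz := depth_gt0 Oz.
  exists (c * (depth z / 2) `^ s); first by rewrite mulr_gt0 ?powR_gt0 ?divr_gt0.
  have : nbhs z [set x | `|z - x| < depth z / 2].
    apply/nbhs_ballP; exists (depth z / 2) => /=; first by rewrite divr_gt0.
    by move=> x; rewrite -ball_normE.
  apply: filterS => x /= zx Ox.
  apply: le_trans (kc 1 x _ Ox); last by rewrite lexx ler1n.
  rewrite lee_fin -mulrA ler_piMr ?(ltW c0)//.
  have dx : depth z / 2 <= depth x.
    have := dist_triangle complement_nonempty z x; rewrite -/(depth z) -/(depth x); lra.
  rewrite powRN ler_pdivrMr ?mul1r ?powR_gt0 ?depth_gt0//.
  by apply: ge0_ler_powR; rewrite ?nnegrE ?(ltW s0) ?divr_ge0 ?(ltW dz)// ltW// depth_gt0.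
have ncz : closure (~` Omega) z by apply: subset_closure.
have [nu [r [gamma [enu r0 [L0 gL0] OP]]]] := lO cz ncz.
pose L := `|L0|.
have L_ge0 : 0 <= L by exact: normr_ge0.
have gL x y : `|gamma x - gamma y| <= L * enorm (x - y).
  by apply: le_trans (gL0 x y) _; rewrite ler_wpM2r ?sqrtr_ge0// ler_norm.
pose D := 1 + n%:R + L * (n%:R * (1 + n%:R)).
have D1 : 1 <= D by rewrite /D -addrA lerDl addr_ge0// !mulr_ge0.
have D0 : 0 < D by exact: lt_le_trans D1.
have nR : 0 < n%:R :> R by rewrite ltr0n.
(* The exterior box has radius depth x / D and lies within 4 depth x of x. *)
pose c := ((n%:R * 4)^-1 * (2 / D)) ^+ n * (n%:R * 4) `^ (- s).
exists c.
  by rewrite mulr_gt0 ?exprn_gt0 ?powR_gt0 ?mulr_gt0 ?invr_gt0 ?mulr_gt0.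
have rn0 : 0 < r / (n%:R * 5) by rewrite divr_gt0 ?mulr_gt0.
have : nbhs z [set x | `|z - x| < r / (n%:R * 5)].
  apply/nbhs_ballP; exists (r / (n%:R * 5)) => //=.
  by move=> x; rewrite -ball_normE.
apply: filterS => x /= zx Ox.
have d0 := depth_gt0 Ox.
have [y Cy xy] := dist_approx complement_nonempty x d0.
have dz : depth x <= `|x - z| by exact: (dist_le complement_nonempty).
have xz : n%:R * (5 * `|x - z|) < r.
  by rewrite mulrA mulrC -ltr_pdivlMr ?mulr_gt0// distrC.
have xy2 : `|x - y| <= 2 * depth x by rewrite mulr_natl mulr2n ltW.
have [bC bL] := exterior_ball enu L_ge0 gL OP Cy d0 xy2 dz xz.
have nO : ~ (~` Omega) x by apply.
have rho0 : 0 < depth x / D by rewrite divr_gt0.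
have L40 : 0 < 4 * depth x by rewrite mulr_gt0.
apply: le_trans (kernel_integral_ge s0 ler01 rho0 L40 mC nO bC bL).
rewrite lee_fin mulr1 (_ : 2 * (depth x / D) = ((n%:R * 4)^-1 * (2 / D)) * (n%:R * (4 * depth x))); last first.
  by field; rewrite (gt_eqF nR) (gt_eqF D0).
rewrite powR_scale ?mulr_gt0//; last by rewrite mulr_ge0 ?invr_ge0 ?divr_ge0 ?mulr_ge0 ?(ltW D0).
rewrite /c -mulrA ler_wpM2l//.
  by rewrite exprn_ge0// mulr_ge0 ?invr_ge0 ?divr_ge0 ?mulr_ge0 ?(ltW D0).
by rewrite (mulrA n%:R 4) (@powRM _ (n%:R * 4)) ?mulr_ge0 ?(ltW d0).
Qed.

Lemma compact_closure : compact (closure Omega).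
Proof.
have [M M0 OM] := bounded_norm.
apply: bounded_closed_compact; last exact: closed_closure.
exists M; split; first exact: num_real.
move=> x Mx y; have cM : closed [set y : 'rV[R]_n | `|y| <= M].
  apply: (@closed_comp _ _ (fun y : 'rV[R]_n => `|y|) [set t | t <= M]); last exact: closed_le.
  by move=> t _; exact: norm_continuous.
move=> cy; apply: le_trans (ltW Mx).
have : closure [set y : 'rV[R]_n | `|y| <= M] y.
  by move: cy; apply: closureS => t; exact: OM.
by rewrite -((closure_id _).1 cM).
Qed.

(** Fractional Hardy inequality: compactness of the closure makes the local
    constants uniform. *)
Lemma hardy : exists2 c : R, 0 < c &
  forall x, Omega x -> ((c * depth x `^ (- s))%:E <= kappa 1 x)%E.
Proof.
have /compact_near_coveringP nc := compact_closure.
pose P (k : nat) (x : 'rV[R]_n) := Omega x -> ((k.+1%:R^-1 * depth x `^ (- s))%:E <= kappa 1 x)%E.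
have [x cx|N _ NP] := nc nat \oo P _.
  have [c c0 xc] := hardy_local cx.
  have cN : \forall k \near \oo, k.+1%:R^-1 < c by exact: near_infty_natSinv_lt (PosNum c0).
  exists ([set y | Omega y -> ((c * depth y `^ (- s))%:E <= kappa 1 y)%E],
    [set k : nat | k.+1%:R^-1 < c]) => //= -[y k] [/= h kc] Oy.
  by apply: le_trans (h Oy); rewrite lee_fin ler_wpM2r ?powR_ge0// ltW.
exists N.+1%:R^-1; first by rewrite invr_gt0.
by move=> x Ox; apply: (NP N) => //=; exact: subset_closure.
Qed.

End hardy_domain.

(** * Mollification *)

Section weighted_averages.
Context d (T : measurableType d) {R : realType} (mu : {measure set T -> \bar R}).
Implicit Types (rho v : T -> R).

Definition wavg rho v : R := \int[mu]_z (rho z * v z).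

Variable v : T -> R.
Hypotheses (mv : measurable_fun setT v) (iv : (\int[mu]_z `|v z|%:E < +oo)%E).

Lemma integrable_fun : mu.-integrable setT (EFin \o v).
Proof.
by apply/integrableP; split => //; exact/measurable_EFinP.
Qed.

Lemma integrable_weighted rho (B : R) : measurable_fun setT rho ->
  (forall z, `|rho z| <= B) -> mu.-integrable setT (EFin \o (fun z => rho z * v z)).
Proof.
move=> mr rB; apply: (@le_integrable _ _ _ mu setT measurableT _ (EFin \o (fun z => B * v z))).
- by apply/measurable_EFinP; exact: measurable_funM.
- move=> z _; rewrite /= lee_fin !normrM ler_wpM2r//.
  exact: le_trans (rB z) (ler_norm _).
- apply: (eq_integrable measurableT (fun z => B%:E * (EFin \o v) z)%E) => //.
  by apply: integrableZl => //; exact: integrable_fun.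
Qed.

Definition norm1 : R := fine (\int[mu]_z `|v z|%:E).

Lemma wavg_lip rho1 rho2 (B delta : R) : measurable_fun setT rho1 -> measurable_fun setT rho2 ->
  (forall z, `|rho1 z| <= B) -> (forall z, `|rho2 z| <= B) ->
  (forall z, `|rho1 z - rho2 z| <= delta) ->
  `|wavg rho1 v - wavg rho2 v| <= delta * norm1.
Proof.
move=> m1 m2 b1 b2 h.
have i1 := integrable_weighted m1 b1; have i2 := integrable_weighted m2 b2.
rewrite /wavg -RintegralB//.
have i3 : mu.-integrable setT (EFin \o (fun z => rho1 z * v z - rho2 z * v z)).
  exact: (integrableB measurableT i1 i2).
apply: le_trans (le_normr_Rintegral measurableT i3) _.
have inv : mu.-integrable setT (EFin \o (fun z => `|v z|)).
  exact: (integrable_abse integrable_fun).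
rewrite /norm1 -/(Rintegral mu setT (fun z => `|v z|)) -RintegralZl//.
apply: le_Rintegral => //.
- exact: (integrable_abse i3).
- exact: (integrableZl measurableT delta inv).
- by move=> z _; rewrite -mulrBl normrM ler_wpM2r.
Qed.

Lemma wavg_bound rho (B : R) : measurable_fun setT rho -> (forall z, `|rho z| <= B) ->
  `|wavg rho v| <= B * norm1.
Proof.
move=> m1 b1; have B0 (z : T) : 0 <= B by exact: le_trans (normr_ge0 _) (b1 z).
have := @wavg_lip rho (fun=> 0) B B m1 _ b1 _ _; rewrite {2}/wavg.
under eq_Rintegral do rewrite mul0r.
rewrite Rintegral_cst// mul0r subr0; apply => // [z|z]; first by rewrite normr0 (B0 z).
by rewrite subr0.
Qed.

Lemma wavg_dist rho (B c : R) : measurable_fun setT rho ->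
  (forall z, 0 <= rho z <= B) -> (\int[mu]_z (rho z)%:E = 1)%E ->
  (`|c - wavg rho v|%:E <= \int[mu]_z (rho z * `|c - v z|)%:E)%E.
Proof.
move=> mr rB r1.
have b z : `|rho z| <= B by have /andP[r0 rb] := rB z; rewrite ger0_norm.
have iw := integrable_weighted mr b.
have mrE : measurable_fun setT (EFin \o rho) by exact/measurable_EFinP.
have ir : mu.-integrable setT (EFin \o rho).
  apply/integrableP; split => //.
  rewrite (eq_integral (EFin \o rho)) ?r1 ?ltry// => z _.
  by have /andP[r0 _] := rB z; rewrite /= ger0_norm.
have irc : mu.-integrable setT (EFin \o (fun z => rho z * c)).
  exact: (integrableZr measurableT c ir).
have cE : c = \int[mu]_z (rho z * c).
  by rewrite RintegralZr// /Rintegral r1 mul1r.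
rewrite {1}cE /wavg -RintegralB//.
have i3 : mu.-integrable setT (EFin \o (fun z => rho z * c - rho z * v z)).
  exact: (integrableB measurableT irc iw).
rewrite EFin_normr_Rintegral//.
have /integrableP[m3 _] := i3.
apply: le_trans (le_abse_integral mu measurableT m3) _.
rewrite le_eqVlt; apply/orP; left; apply/eqP; apply: eq_integral => z _.
by have /andP[r0 _] := rB z; rewrite /= -mulrBr normrM (ger0_norm r0).
Qed.

Lemma le_powR_split (tau a p : R) : 0 < tau -> 0 <= a -> 1 <= p ->
  a <= tau + tau `^ (1 - p) * a `^ p.
Proof.
move=> t0 a0 p1; have [at_|ta] := leP a tau.
  by rewrite (le_trans at_)// lerDl mulr_ge0 ?powR_ge0.
have a1 : 0 < a by exact: lt_trans ta.
rewrite -[leLHS]add0r lerD ?(ltW t0)//.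
have e : a = a `^ (1 - p) * a `^ p.
  by rewrite -powRD ?subrK ?powRr1// (gt_eqF a1) implybT.
rewrite [leLHS]e ler_wpM2r ?powR_ge0// -(opprB p 1); apply: ler_powRN => //.
  by rewrite subr_ge0.
exact: ltW.
Qed.

(** The splitting a <= tau + tau^(1-p) a^p bounds a mean deviation by a p-th
    power one, with a constant which stays bounded as p tends to 1. *)
Lemma wavg_dist_pow rho (k : T -> R) (B A c p tau : R) : measurable_fun setT rho ->
  measurable_fun setT k -> (forall z, 0 <= k z) ->
  (forall z, 0 <= rho z <= B) -> (\int[mu]_z (rho z)%:E = 1)%E ->
  1 <= p -> 0 < tau -> 0 <= A -> (forall z, v z <> c -> rho z <= A * k z) ->
  (`|c - wavg rho v|%:E <= tau%:E + (tau `^ (1 - p) * A)%:E * \int[mu]_z (`|c - v z| `^ p * k z)%:E)%E.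
Proof.
move=> mr mk k0 rB r1 p1 t0 A0 rk.
apply: le_trans (wavg_dist c mr rB r1) _.
have tA0 : 0 <= tau `^ (1 - p) * A by rewrite mulr_ge0 ?powR_ge0.
have mrE : measurable_fun setT (EFin \o rho) by exact/measurable_EFinP.
have mck : measurable_fun setT (fun z => (`|c - v z| `^ p * k z)%:E).
  apply/measurable_EFinP; apply: measurable_funM => //; apply: measurable_fun_powR.
  by apply: measurableT_comp => //; exact: measurable_funB.
have ck0 z : [set: T] z -> (0 <= (`|c - v z| `^ p * k z)%:E)%E.
  by rewrite lee_fin mulr_ge0 ?powR_ge0.
have rz0 z : [set: T] z -> (0 <= (EFin \o rho) z)%E.
  by have /andP[r0 _] := rB z; rewrite /= lee_fin.
have mtr : measurable_fun setT (fun z => tau%:E * (EFin \o rho) z)%E.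
  by apply: emeasurable_funM => //; exact: measurable_cst.
have mtA : measurable_fun setT (fun z => (tau `^ (1 - p) * A)%:E * (`|c - v z| `^ p * k z)%:E)%E.
  by apply: emeasurable_funM => //; exact: measurable_cst.
have e1 := ge0_integralZl mu measurableT mrE rz0 (ltW t0 : (0 <= tau%:E)%E).
have e2 := ge0_integralZl mu measurableT mck ck0 (tA0 : (0 <= (tau `^ (1 - p) * A)%:E)%E).
rewrite -[X in (X + _)%E](_ : (\int[mu]_z (tau%:E * (EFin \o rho) z) = _)%E); last first.
  by rewrite e1 r1 mule1.
rewrite -e2 -(ge0_integralD mu measurableT _ mtr _ mtA); first last.
- by move=> z _; apply: mule_ge0; [rewrite lee_fin|exact: ck0].
- by move=> z _; apply: mule_ge0; [rewrite lee_fin ltW|exact: rz0].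
apply: (ge0_le_integral mu measurableT _ _ (emeasurable_funD mtr mtA)).
- by move=> z _; have /andP[r0 _] := rB z; rewrite lee_fin mulr_ge0.
- apply/measurable_EFinP; apply: measurable_funM => //.
  by apply: measurableT_comp => //; exact: measurable_funB.
move=> z _; have /andP[r0 _] := rB z.
rewrite /= -!EFinM -EFinD lee_fin.
have [vc|vc] := eqVneq (v z) c.
  by rewrite vc subrr normr0 mulr0 addr_ge0// mulr_ge0 ?(ltW t0)// mulr_ge0 ?powR_ge0.
apply: (@le_trans _ _ (rho z * (tau + tau `^ (1 - p) * `|c - v z| `^ p))).
  by rewrite ler_wpM2l// le_powR_split.
rewrite mulrDr [tau * _]mulrC lerD2l.
rewrite (_ : tau `^ (1 - p) * A * _ = (A * k z) * (tau `^ (1 - p) * `|c - v z| `^ p)); last by ring.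
by rewrite ler_wpM2r ?mulr_ge0 ?powR_ge0//; apply: rk; exact/eqP.
Qed.

End weighted_averages.

Section mollifier.
Context {R : realType} {n : nat}.
Hypothesis n_gt0 : (0 < n)%N.
Local Notation Rn := (lebesgueRn R n).
Local Notation Bn := (borelRn R n).
Local Notation leb := (@lebesgue R n).
Variable e : R.
Hypothesis e0 : 0 < e.
Implicit Types h x y z : 'rV[R]_n.

Definition bump h : R := Num.max 0 (e - `|h|).

Lemma bump_ge0 h : 0 <= bump h. Proof. by rewrite /bump le_max lexx. Qed.

Lemma bump_le h : bump h <= e.
Proof. by rewrite /bump ge_max (ltW e0)/= lerBlDr lerDl. Qed.

Lemma bump_eq0 h : e <= `|h| -> bump h = 0.
Proof. by move=> eh; apply/max_idPl; rewrite subr_le0. Qed.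

Lemma bump_lip h h' : `|bump h - bump h'| <= `|h - h'|.
Proof.
have a := lerB_dist h h'; have b := lerB_dist h' h; rewrite distrC in b.
rewrite ler_norml /bump; have c : 0 <= `|h - h'| by [].
by case: (leP 0 (e - `|h|)); case: (leP 0 (e - `|h'|)) => ? ?; apply/andP; split; lra.
Qed.

Lemma measurable_bump : measurable_fun [set: Bn] (bump : Bn -> R).
Proof.
apply: continuous_borel => x; apply/cvgrPdist_lt; first exact: nbhs_filter.
move=> t t0.
have : nbhs x [set y | `|bump x - bump y| < t].
  apply/nbhs_ballP; exists t => //= y; rewrite -ball_normE/=.
  by apply: le_lt_trans; exact: bump_lip.
exact.
Qed.

Lemma measurable_bump_shift x : measurable_fun [set: Bn] (fun z : Bn => bump ((z : 'rV[R]_n) - x)).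
Proof. exact: (measurableT_comp measurable_bump (measurable_translate (- x))). Qed.

Lemma measurable_bump_lebesgue x : measurable_fun [set: Rn] (fun z : Rn => bump ((z : 'rV[R]_n) - x)).
Proof. exact: (measurableT_comp (measurable_bump_shift x) measurable_id_borel). Qed.

Lemma integral_bump_shift x :
  (\int[leb]_z (bump ((z : 'rV[R]_n) - x)%R)%:E = \int[leb]_z (bump z)%:E)%E.
Proof.
apply: (@ge0_integral_translate R n (- x) (EFin \o (bump : Bn -> R))).
  by apply/measurable_EFinP; exact: measurable_bump.
by move=> h; rewrite /= lee_fin bump_ge0.
Qed.

Lemma bump_box h : bump h <= e * \1_(box 0 e) (h : Bn).
Proof.
have [eh|he] := leP e `|h|; first by rewrite bump_eq0// mulr_ge0// ltW.
rewrite indicE mem_set ?mulr1 ?bump_le//.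
by rewrite boxE//= subr0.
Qed.

Lemma integral_indic_box (c r : R) : 0 <= c -> 0 < r ->
  (\int[leb]_z (c * \1_(box 0 r : set Rn) z)%:E = (c * (2 * r) ^+ n)%:E)%E.
Proof.
move=> c0 r0; have mb : measurable (box 0 r : set Rn) by exact: measurable_box_lebesgue.
under eq_integral do rewrite EFinM.
have mi : measurable_fun [set: Rn] (EFin \o (\1_(box 0 r : set Rn) : Rn -> R)).
  by apply/measurable_EFinP; exact: measurable_indic.
rewrite (ge0_integralZl leb measurableT mi); [|by move=> z _; rewrite /= lee_fin|by rewrite lee_fin].
by rewrite (integral_indic leb measurableT mb) setIT [X in (_ * X)%E](lebesgue_box 0 r0).
Qed.

Definition bump_mass : R := fine (\int[leb]_z (bump z)%:E).

Let mbE : measurable_fun [set: Rn] (fun z : Rn => (bump z)%:E).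
Proof.
have := measurable_bump_lebesgue 0; under eq_fun do rewrite subr0.
by move=> ?; apply/measurable_EFinP.
Qed.

Let mind (c r : R) : measurable_fun [set: Rn] (fun z : Rn => (c * \1_(box 0 r : set Rn) z)%:E).
Proof.
apply/measurable_EFinP; apply: measurable_funM; first exact: measurable_cst.
by apply: measurable_indic; exact: measurable_box_lebesgue.
Qed.

Lemma integral_bump_le : (\int[leb]_z (bump z)%:E <= (e * (2 * e) ^+ n)%:E)%E.
Proof.
rewrite -(integral_indic_box (ltW e0) e0).
apply: (ge0_le_integral leb measurableT _ mbE (mind _ _)) => z _.
  by rewrite lee_fin bump_ge0.
by rewrite lee_fin bump_box.
Qed.

Lemma integral_bump_ge : ((e / 2 * e ^+ n)%:E <= \int[leb]_z (bump z)%:E)%E.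
Proof.
have e2 : 0 < e / 2 by rewrite divr_gt0.
have := integral_indic_box (ltW e2) e2; rewrite (_ : 2 * (e / 2) = e); last by field.
move=> <-; apply: (ge0_le_integral leb measurableT _ (mind _ _) mbE) => z _.
  by rewrite lee_fin mulr_ge0// ltW.
rewrite lee_fin indicE; case: (boolP (z \in _)) => [/set_mem|_]; last by rewrite mulr0 bump_ge0.
rewrite boxE//= subr0 mulr1 => ze; rewrite /bump le_max; apply/orP; right; lra.
Qed.

Lemma bump_massE : (\int[leb]_z (bump z)%:E)%E = bump_mass%:E.
Proof.
rewrite /bump_mass fineK// ge0_fin_numE; first by apply: le_lt_trans integral_bump_le _; rewrite ltry.
by apply: integral_ge0 => z _; rewrite lee_fin bump_ge0.
Qed.

Lemma bump_mass_ge : e / 2 * e ^+ n <= bump_mass.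
Proof. by rewrite -lee_fin -bump_massE integral_bump_ge. Qed.

Lemma bump_mass_gt0 : 0 < bump_mass.
Proof. by apply: lt_le_trans bump_mass_ge; rewrite mulr_gt0 ?exprn_gt0 ?divr_gt0. Qed.

Definition rho h : R := bump h / bump_mass.

Lemma rho_ge0 h : 0 <= rho h.
Proof. by rewrite divr_ge0 ?bump_ge0// ltW ?bump_mass_gt0. Qed.

Lemma rho_le h : rho h <= 2 / e ^+ n.
Proof.
rewrite ler_pdivrMr ?bump_mass_gt0//; apply: le_trans (bump_le h) _.
have en : 0 < e ^+ n by rewrite exprn_gt0.
rewrite [leLHS](_ : e = 2 / e ^+ n * (e / 2 * e ^+ n)); last by field; rewrite (gt_eqF en).
by rewrite ler_wpM2l ?bump_mass_ge// divr_ge0// ltW.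
Qed.

Lemma rho_bounds h : 0 <= rho h <= 2 / e ^+ n.
Proof. by rewrite rho_ge0 rho_le. Qed.

Lemma rho_eq0 h : e <= `|h| -> rho h = 0.
Proof. by move=> eh; rewrite /rho bump_eq0// mul0r. Qed.

Lemma rho_lip h h' : `|rho h - rho h'| <= `|h - h'| / bump_mass.
Proof.
rewrite /rho -mulrBl normrM (gtr0_norm (_ : 0 < bump_mass^-1)) ?invr_gt0 ?bump_mass_gt0//.
by rewrite ler_wpM2r ?invr_ge0 ?(ltW bump_mass_gt0)// bump_lip.
Qed.

Lemma measurable_rho x : measurable_fun [set: Rn] (fun z : Rn => rho ((z : 'rV[R]_n) - x)).
Proof.
by apply: measurable_funM; [exact: measurable_bump_lebesgue|exact: measurable_cst].
Qed.

Lemma integral_rho x : (\int[leb]_z (rho ((z : 'rV[R]_n) - x)%R)%:E = 1)%E.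
Proof.
under eq_integral do rewrite EFinM.
have mb : measurable_fun [set: Rn] (fun z : Rn => (bump ((z : 'rV[R]_n) - x)%R)%:E).
  by apply/measurable_EFinP; exact: measurable_bump_lebesgue.
have b0 z : [set: Rn] z -> (0 <= (bump ((z : 'rV[R]_n) - x)%R)%:E)%E.
  by move=> _; rewrite lee_fin bump_ge0.
have m0 : (0 <= (bump_mass^-1)%:E)%E by rewrite lee_fin invr_ge0 ltW ?bump_mass_gt0.
rewrite (ge0_integralZr leb measurableT mb b0 m0) integral_bump_shift bump_massE -EFinM.
by rewrite divff// gt_eqF// bump_mass_gt0.
Qed.

Variable v : Rn -> R.

Definition mollify (x : Rn) : R := wavg leb (fun z : Rn => rho ((z : 'rV[R]_n) - x)) v.

Hypotheses (mv : measurable_fun setT v) (iv : (\int[leb]_z `|v z|%:E < +oo)%E).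

Let rho_norm x (z : Rn) : `|rho ((z : 'rV[R]_n) - x)| <= 2 / e ^+ n.
Proof. by rewrite ger0_norm ?rho_ge0 ?rho_le. Qed.

Lemma mollify_lip x y : `|mollify x - mollify y| <= `|x - y| / bump_mass * norm1 leb v.
Proof.
apply: (wavg_lip mv iv (measurable_rho x) (measurable_rho y) (rho_norm x) (rho_norm y)) => z.
apply: le_trans (rho_lip _ _) _; rewrite (_ : _ - _ - _ = y - x); first by rewrite distrC.
by apply/rowP => i; rewrite !mxE; ring.
Qed.

Lemma mollify_bound x : `|mollify x| <= 2 / e ^+ n * norm1 leb v.
Proof. exact: (wavg_bound mv iv (measurable_rho x) (rho_norm x)). Qed.

Lemma mollify_eq0 x : (forall z, `|z - x| < e -> v z = 0) -> mollify x = 0.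
Proof.
move=> v0; rewrite /mollify /wavg.
have h (z : Rn) : rho ((z : 'rV[R]_n) - x) * v z = 0.
  have [ez|ze] := leP e `|(z : 'rV[R]_n) - x|; first by rewrite rho_eq0// mul0r.
  by rewrite v0// mulr0.
under eq_Rintegral do rewrite h.
by rewrite Rintegral_cst ?mul0r//; exact: measurableT.
Qed.

Lemma measurable_mollify : measurable_fun setT mollify.
Proof.
pose L := norm1 leb v / bump_mass.
have lip x y : `|mollify x - mollify y| <= L * `|x - y|.
  by apply: le_trans (mollify_lip x y) _; rewrite /L le_eqVlt; apply/orP; left; apply/eqP; ring.
have cm : continuous (mollify : 'rV[R]_n -> R).
  move=> x; apply/cvgrPdist_lt; first exact: nbhs_filter.
  move=> t t0; have L0 : 0 < `|L| + 1 by rewrite ltr_wpDl.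
  have : nbhs x [set y | `|mollify x - mollify y| < t].
    apply/nbhs_ballP; exists (t / (`|L| + 1)) => /=; first by rewrite divr_gt0.
    move=> y; rewrite -ball_normE/= ltr_pdivlMr// => xy.
    apply: le_lt_trans (lip x y) _; apply: le_lt_trans xy; rewrite mulrC ler_wpM2l//.
    by apply: le_trans (ler_norm _) _; rewrite lerDl.
  exact.
exact: continuous_lebesgue.
Qed.

Variable s : R.
Hypothesis s01 : 0 < s < 1.

(** On the support of rho the kernel is bounded below, so that averages against
    rho are controlled by the fractional seminorm. *)
Lemma rho_le_kernel (p : R) x z : 1 <= p <= 2 -> x != z ->
  rho (z - x) <= 2 / e ^+ n * (n%:R * e) `^ (n%:R + s * p) * frac_kernel s p x z.
Proof.
move=> /andP[p1 p2] xz; have /andP[s0 s1] := s01.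
have nR : 0 < n%:R :> R by rewrite ltr0n.
have sp : 0 <= s * p by rewrite mulr_ge0 ?(ltW s0)// (le_trans _ p1).
have ene : 0 <= 2 / e ^+ n by rewrite divr_ge0// exprn_ge0// ltW.
have [ez|ze] := leP e `|z - x|.
  by rewrite rho_eq0// mulr_ge0 ?frac_kernel_ge0// mulr_ge0 ?powR_ge0.
apply: le_trans (rho_le _) _; rewrite -mulrA ler_peMr//.
have h : (n%:R * e) `^ (- (n%:R + s * p)) <= frac_kernel s p x z.
  apply: frac_kernel_ge => //; rewrite distrC ler_wpM2l//; exact: ltW.
apply: le_trans (ler_wpM2l (powR_ge0 _ _) h).
by rewrite powRN divff// gt_eqF// powR_gt0// mulr_gt0.
Qed.

(** The threshold tau = e^s balances the two terms: tau^(1-p) times the ratio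
    of rho to the kernel is of order e^s as well, for every p in [1, 2]. *)
Lemma mollify_close_pt (p : R) (x : Rn) : 1 <= p <= 2 ->
  (`|v x - mollify x|%:E <= (e `^ s)%:E +
    (2 * n%:R ^+ (n + 2) * e `^ s)%:E * \int[leb]_z powdiff p (fker s p) v v (x, z))%E.
Proof.
move=> p12; have /andP[p1 p2] := p12; have /andP[s0 s1] := s01.
have nR : 0 < n%:R :> R by rewrite ltr0n.
have es0 : 0 < e `^ s by rewrite powR_gt0.
have A0 : 0 <= 2 / e ^+ n * (n%:R * e) `^ (n%:R + s * p).
  by rewrite mulr_ge0 ?powR_ge0// divr_ge0// exprn_ge0// ltW.
have k0 z : 0 <= fker s p x z by exact: frac_kernel_ge0.
have rk z : v z <> v x -> rho ((z : 'rV[R]_n) - (x : 'rV[R]_n)) <=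
    2 / e ^+ n * (n%:R * e) `^ (n%:R + s * p) * fker s p x z.
  by move=> vzx; apply: rho_le_kernel => //; apply: contra_notN vzx => /eqP ->.
have := wavg_dist_pow mv iv (measurable_rho x) (measurable_fker_x s p x) k0
  (fun z => rho_bounds _) (integral_rho x) p1 es0 A0 rk.
move=> h; apply: (le_trans h); apply: leeD2l.
apply: lee_wpmul2r; first by apply: integral_ge0 => z _; rewrite lee_fin mulr_ge0 ?powR_ge0.
rewrite lee_fin.
have -> : (e `^ s) `^ (1 - p) * (2 / e ^+ n * (n%:R * e) `^ (n%:R + s * p)) =
    2 * n%:R `^ (n%:R + s * p) * e `^ s.
  rewrite powRM ?(ltW e0)// -powRrM -(powR_mulrn n (ltW e0)) -powRN.
  rewrite (_ : _ * _ = 2 * n%:R `^ (n%:R + s * p) *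
     (e `^ (s * (1 - p)) * (e `^ (- n%:R) * e `^ (n%:R + s * p)))); last by ring.
  congr (_ * _); rewrite -!powRD ?(gt_eqF e0) ?implybT//; congr (_ `^ _); ring.
rewrite ler_wpM2r ?powR_ge0// ler_wpM2l// -powR_mulrn// ler_powR ?ler1n//.
rewrite natrD lerD2l; apply: (@le_trans _ _ (1 * 2)); last by rewrite mul1r.
by rewrite ler_pM// ?(ltW s0) ?(ltW s1)// (le_trans _ p1).
Qed.

Lemma mollify_close (A : set Rn) (p : R) : 1 <= p <= 2 -> measurable A ->
  (\int[leb]_(x in A) `|v x - mollify x|%:E <=
   (e `^ s)%:E * leb A + (2 * n%:R ^+ (n + 2) * e `^ s)%:E * dint leb A setT (powdiff p (fker s p) v v))%E.
Proof.
move=> p12 mA.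
have mq := measurable_powdiff p (measurable_frac_kernel s p) mv mv.
have q0 (t : Rn * Rn) : (0 <= powdiff p (fker s p) v v t)%E by apply: powdiff_ge0 => x y; exact: frac_kernel_ge0.
have mi := measurable_inner leb mq q0 mA measurableT.
have i0 (x : Rn) : A x -> (0 <= \int[leb]_y powdiff p (fker s p) v v (x, y))%E.
  by move=> _; apply: integral_ge0 => y _; exact: q0.
have es0 : (0 <= (e `^ s)%:E)%E by rewrite lee_fin powR_ge0.
have c0 : (0 <= (2 * n%:R ^+ (n + 2) * e `^ s)%:E)%E.
  by rewrite lee_fin mulr_ge0 ?powR_ge0// mulr_ge0// exprn_ge0.
have mc : measurable_fun A (cst (e `^ s)%:E) by exact: measurable_cst.
have mci : measurable_fun A (fun x => (2 * n%:R ^+ (n + 2) * e `^ s)%:E *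
    \int[leb]_y powdiff p (fker s p) v v (x, y))%E.
  by apply: emeasurable_funM; [exact: measurable_cst|exact: mi].
rewrite /dint -(ge0_integralZl leb mA mi i0 c0).
rewrite -(integral_cst leb mA (e `^ s)%:E) -(ge0_integralD leb mA (fun x _ => es0) mc _ mci); last first.
  by move=> x Ax; apply: mule_ge0 => //; exact: i0.
apply: (ge0_le_integral leb mA _ _ (emeasurable_funD mc mci)) => [x _|//|x _].
- by rewrite lee_fin.
- apply/measurable_EFinP; apply: (measurable_funS measurableT (@subsetT _ A)).
  apply: (measurableT_comp (@normr_measurable _ setT)); apply: measurable_funB; first exact: mv.
  exact: measurable_mollify.
- exact: mollify_close_pt.
Qed.

End mollifier.

Section weighted_difference.
Context d (T : measurableType d) {R : realType} (mu : {measure set T -> \bar R}).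

Lemma wavg_diff (rho f g : T -> R) (B : R) : measurable_fun setT rho ->
  measurable_fun setT f -> measurable_fun setT g ->
  (\int[mu]_z `|f z|%:E < +oo)%E -> (\int[mu]_z `|g z|%:E < +oo)%E ->
  (forall z, 0 <= rho z <= B) ->
  (`|wavg mu rho f - wavg mu rho g|%:E <= \int[mu]_z (rho z * `|f z - g z|)%:E)%E.
Proof.
move=> mr mf mg if_ ig rB.
have b z : `|rho z| <= B by have /andP[r0 rb] := rB z; rewrite ger0_norm.
have i1 := integrable_weighted mf if_ mr b.
have i2 := integrable_weighted mg ig mr b.
rewrite /wavg -RintegralB//.
have i3 : mu.-integrable setT (EFin \o (fun z => rho z * f z - rho z * g z)).
  exact: (integrableB measurableT i1 i2).
rewrite EFin_normr_Rintegral//.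
have /integrableP[m3 _] := i3.
apply: le_trans (le_abse_integral mu measurableT m3) _.
rewrite le_eqVlt; apply/orP; left; apply/eqP; apply: eq_integral => z _.
by have /andP[r0 _] := rB z; rewrite /= -mulrBr normrM (ger0_norm r0).
Qed.

End weighted_difference.

Section triple_fubini.
Context d (T : measurableType d) {R : realType} (mu : {sigma_finite_measure set T -> \bar R}).
Variable F : T -> T -> T -> \bar R.
Hypotheses (mF : measurable_fun setT (fun t : (T * T) * T => F t.1.1 t.1.2 t.2))
  (F0 : forall x y h, (0 <= F x y h)%E).

Let mperm (g : (T * T) * T -> (T * T) * T) : measurable_fun setT g ->
  measurable_fun setT (fun t => F (g t).1.1 (g t).1.2 (g t).2).
Proof. by move=> mg; exact: (measurableT_comp mF mg). Qed.

Lemma measurable_triple_inner : measurable_fun setT (fun z : T * T => \int[mu]_h F z.1 z.2 h)%E.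
Proof. exact: (measurable_fun_fubini_tonelli_F (m2 := mu) _ mF (fun t => F0 _ _ _)). Qed.

Let m13 : measurable_fun setT (fun z : T * T => \int[mu]_y F z.1 y z.2)%E.
Proof.
have m : measurable_fun setT (fun t : (T * T) * T => F t.1.1 t.2 t.1.2).
  apply: (mperm (g := fun t => ((t.1.1, t.2), t.1.2))).
  apply/measurable_fun_pairP; split.
    apply/measurable_fun_pairP; split; last exact: measurable_snd.
    exact: (measurableT_comp measurable_fst measurable_fst).
  exact: (measurableT_comp measurable_snd measurable_fst).
exact: (measurable_fun_fubini_tonelli_F (m2 := mu) _ m (fun t => F0 _ _ _)).
Qed.

Lemma triple_fubini :
  (\int[mu]_x \int[mu]_y \int[mu]_h F x y h = \int[mu]_h \int[mu]_x \int[mu]_y F x y h)%E.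
Proof.
transitivity (\int[mu]_x \int[mu]_h \int[mu]_y F x y h)%E.
  apply: eq_integral => x _.
  have m : measurable_fun setT (fun t : T * T => F x t.1 t.2).
    have mg : measurable_fun setT (fun t : T * T => ((x, t.1), t.2)).
      apply/measurable_fun_pairP; split; last exact: measurable_snd.
      by apply/measurable_fun_pairP; split; [exact: measurable_cst|exact: measurable_fst].
    exact: (measurableT_comp mF mg).
  exact: (fubini_tonelli (m1 := mu) (m2 := mu) _ m (fun t => F0 _ _ _)).
have i0 (z : T * T) : (0 <= \int[mu]_y F z.1 y z.2)%E by apply: integral_ge0.
exact: (fubini_tonelli (m1 := mu) (m2 := mu) _ m13 i0).
Qed.

End triple_fubini.

Section mollify_energy.
Context {R : realType} {n : nat}.
Hypothesis n_gt0 : (0 < n)%N.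
Local Notation Rn := (lebesgueRn R n).
Local Notation Bn := (borelRn R n).
Local Notation leb := (@lebesgue R n).
Variables (e s : R).
Hypothesis e0 : 0 < e.

Lemma integral_translate (a : 'rV[R]_n) (f : Bn -> \bar R) : measurable_fun setT f ->
  (\int[leb]_x f ((x : 'rV[R]_n) + a)%R = \int[leb]_x f x)%E.
Proof.
move=> mf; rewrite integralE [RHS]integralE.
have p := @ge0_integral_translate R n a (f^\+)%E (measurable_funepos mf) (funepos_ge0 f).
have m := @ge0_integral_translate R n a (f^\-)%E (measurable_funeneg mf) (funeneg_ge0 f).
transitivity (\int[leb]_x f^\+ ((x : 'rV[R]_n) + a)%R - \int[leb]_x f^\- ((x : 'rV[R]_n) + a)%R)%E.
  by congr (_ - _)%E; apply: eq_integral => x _; rewrite ?funeposE ?funenegE.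
by rewrite p m.
Qed.

Lemma measurable_frac_kernel_comp d (T : measurableType d) (q : R) (f g : T -> 'rV[R]_n) :
  (forall i, measurable_fun setT (fun t => f t ord0 i)) ->
  (forall i, measurable_fun setT (fun t => g t ord0 i)) ->
  measurable_fun setT (fun t => frac_kernel s q (f t) (g t)).
Proof.
move=> mf mg; under eq_fun do rewrite frac_kernelE.
apply: measurable_fun_powR; apply: measurable_enorm => i.
rewrite (_ : (fun t => _) = (fun t => f t ord0 i) \- (fun t => g t ord0 i)).
  exact: measurable_funB.
by apply/funext => t; rewrite !mxE.
Qed.

Variable v : 'rV[R]_n -> R.
Hypotheses (mv : measurable_fun [set: Bn] (v : Bn -> R)).
Hypothesis iv : (\int[leb]_z `|v z|%:E < +oo)%E.

Let mvR : measurable_fun [set: Rn] (v : Rn -> R).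
Proof. exact: (measurableT_comp mv measurable_id_borel). Qed.

Let mvs (a : 'rV[R]_n) : measurable_fun [set: Bn] (fun x : Bn => v ((x : 'rV[R]_n) + a)).
Proof. exact: (measurableT_comp mv (measurable_translate a)). Qed.

Let mvsR (a : 'rV[R]_n) : measurable_fun [set: Rn] (fun x : Rn => v ((x : 'rV[R]_n) + a)).
Proof. exact: (measurableT_comp (mvs a) measurable_id_borel). Qed.

Let ivs (a : 'rV[R]_n) : (\int[leb]_z `|v ((z : 'rV[R]_n) + a)%R|%:E < +oo)%E.
Proof.
have m : measurable_fun [set: Bn] (fun x : Bn => `|v x|%:E).
  by apply/measurable_EFinP; exact: (measurableT_comp (@normr_measurable _ setT) mv).
by rewrite (integral_translate a m).
Qed.

Let mrho : measurable_fun [set: Rn] (fun h : Rn => rho e (h : 'rV[R]_n)).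
Proof.
have := measurable_rho e (0 : 'rV[R]_n); by under eq_fun do rewrite subr0.
Qed.

Lemma mollify_translate (x : 'rV[R]_n) :
  mollify e v x = wavg leb (fun h : Rn => rho e (h : 'rV[R]_n)) (fun h : Rn => v ((h : 'rV[R]_n) + x)).
Proof.
rewrite /mollify /wavg /Rintegral; congr fine.
have m : measurable_fun [set: Bn] (fun z : Bn => (rho e ((z : 'rV[R]_n) - x) * v z)%:E).
  apply/measurable_EFinP; apply: measurable_funM => //.
  by apply: measurable_funM; [exact: measurable_bump_shift|exact: measurable_cst].
rewrite -(integral_translate x m); apply: eq_integral => h _.
by rewrite addrK.
Qed.

Lemma mollify_diff (x y : 'rV[R]_n) :
  (`|mollify e v x - mollify e v y|%:E <=
   \int[leb]_h (rho e (h : 'rV[R]_n) * `|v ((h : 'rV[R]_n) + x)%R - v ((h : 'rV[R]_n) + y)%R|)%:E)%E.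
Proof.
rewrite !mollify_translate.
exact: (wavg_diff mrho (mvsR x) (mvsR y) (ivs x) (ivs y) (fun h : Rn => rho_bounds e0 (h : 'rV[R]_n))).
Qed.

Local Notation K := (fker s 1).
Local Notation N u := (dint leb setT setT (powdiff 1 K u u)).

Let G (x : Bn) : \bar R := (\int[leb]_y (`|v x - v y| `^ 1 * frac_kernel s 1 x y)%:E)%E.

Let mG : measurable_fun [set: Bn] G.
Proof.
have m : measurable_fun [set: Bn * Rn]
    (fun z : Bn * Rn => (`|v z.1 - v z.2| `^ 1 * frac_kernel s 1 (z.1 : 'rV[R]_n) (z.2 : 'rV[R]_n))%:E).
  apply/measurable_EFinP; apply: measurable_funM.
    apply: measurable_fun_powR; apply: (measurableT_comp (@normr_measurable _ setT)).
    apply: measurable_funB.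
      exact: (measurableT_comp mv measurable_fst).
    exact: (measurableT_comp mvR measurable_snd).
  apply: measurable_frac_kernel_comp => i.
    exact: (measurableT_comp (@measurable_coordRn R n i) measurable_fst).
  exact: (measurableT_comp (measurable_coord i) measurable_snd).
have m0 z : (0 <= (`|v z.1 - v z.2| `^ 1 * frac_kernel s 1 (z.1 : 'rV[R]_n) (z.2 : 'rV[R]_n))%:E)%E.
  by rewrite lee_fin mulr_ge0 ?powR_ge0 ?frac_kernel_ge0.
exact: (measurable_fun_fubini_tonelli_F (m2 := leb) _ m m0).
Qed.

Let G0 x : (0 <= G x)%E.
Proof. by apply: integral_ge0 => y _; rewrite lee_fin mulr_ge0 ?powR_ge0 ?frac_kernel_ge0. Qed.

Lemma seminorm_translate (h : 'rV[R]_n) :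
  (\int[leb]_x \int[leb]_y
     (`|v ((h + (x : 'rV[R]_n)))%R - v (h + (y : 'rV[R]_n))%R| `^ 1 * frac_kernel s 1 x y)%:E = N v)%E.
Proof.
transitivity (\int[leb]_x G ((x : 'rV[R]_n) + h)%R)%E; last first.
  by rewrite (ge0_integral_translate h mG G0).
apply: eq_integral => x _.
have m : measurable_fun [set: Bn] (fun y : Bn =>
    (`|v (x + h)%R - v y| `^ 1 * frac_kernel s 1 ((x : 'rV[R]_n) + h)%R (y : 'rV[R]_n))%:E).
  apply/measurable_EFinP; apply: measurable_funM.
    apply: measurable_fun_powR; apply: (measurableT_comp (@normr_measurable _ setT)).
    by apply: measurable_funB => //; exact: measurable_cst.
  apply: measurable_frac_kernel_comp => i; first exact: measurable_cst.
  exact: measurable_coordRn.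
have m0 (y : Bn) : (0 <= (`|v (x + h)%R - v y| `^ 1 * frac_kernel s 1 ((x : 'rV[R]_n) + h)%R (y : 'rV[R]_n))%:E)%E.
  by rewrite lee_fin mulr_ge0 ?powR_ge0 ?frac_kernel_ge0.
apply: etrans (ge0_integral_translate h m m0); apply: eq_integral => y _.
by rewrite frac_kernel_translate ![h + _]addrC.
Qed.

(** Jensen's inequality and translation invariance: a mollification is an
    average of translates, which all have the same energy. *)
Lemma mollify_energy : (N (mollify e v) <= N v)%E.
Proof.
have mw := measurable_mollify e0 mvR iv.
have mK := @measurable_frac_kernel R n s 1.
have mqw := measurable_powdiff 1 mK mw mw.
have K0 (x y : Rn) : 0 <= K x y by exact: frac_kernel_ge0.
have qw0 (t : Rn * Rn) : (0 <= powdiff 1 K (mollify e v) (mollify e v) t)%E by exact: powdiff_ge0.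
pose Phi (x y h : Rn) : \bar R :=
  (rho e (h : 'rV[R]_n) * (`|v ((h : 'rV[R]_n) + (x : 'rV[R]_n)) -
     v ((h : 'rV[R]_n) + (y : 'rV[R]_n))| `^ 1 * frac_kernel s 1 x y))%:E.
have m11 : measurable_fun [set: (Rn * Rn) * Rn] (fun t : (Rn * Rn) * Rn => t.1.1).
  exact: (measurableT_comp measurable_fst measurable_fst).
have m12 : measurable_fun [set: (Rn * Rn) * Rn] (fun t : (Rn * Rn) * Rn => t.1.2).
  exact: (measurableT_comp measurable_snd measurable_fst).
have m2 : measurable_fun [set: (Rn * Rn) * Rn] (fun t : (Rn * Rn) * Rn => t.2).
  exact: measurable_snd.
have madd (f g : (Rn * Rn) * Rn -> Rn) : measurable_fun setT f -> measurable_fun setT g ->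
    measurable_fun setT (fun t => v ((f t : 'rV[R]_n) + (g t : 'rV[R]_n))).
  move=> mf mg; apply: (measurableT_comp mv); apply: measurable_fun_to_borel => i.
  rewrite (_ : (fun t => _) = (fun t => (f t : 'rV[R]_n) ord0 i) \+ (fun t => (g t : 'rV[R]_n) ord0 i)).
    apply: measurable_funD.
      exact: (measurableT_comp (measurable_coord i) mf).
    exact: (measurableT_comp (measurable_coord i) mg).
  by apply/funext => t; rewrite mxE.
have mPhi : measurable_fun setT (fun t : (Rn * Rn) * Rn => Phi t.1.1 t.1.2 t.2).
  apply/measurable_EFinP; apply: measurable_funM; first exact: (measurableT_comp mrho m2).
  apply: measurable_funM.
    apply: measurable_fun_powR; apply: (measurableT_comp (@normr_measurable _ setT)).
    by apply: measurable_funB; exact: madd.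
  by apply: measurable_frac_kernel_comp => i; apply: (measurableT_comp (measurable_coord i)).
have Phi0 x y h : (0 <= Phi x y h)%E.
  by rewrite lee_fin mulr_ge0 ?rho_ge0// mulr_ge0 ?powR_ge0 ?frac_kernel_ge0.
have mF := measurable_triple_inner leb mPhi Phi0.
apply: (@le_trans _ _ (\int[leb]_x \int[leb]_y \int[leb]_h Phi x y h)%E).
  suff le_pt (x y : Rn) : setT x -> setT y ->
      (powdiff 1 K (mollify e v) (mollify e v) (x, y) <= \int[leb]_h Phi x y h)%E.
    exact: (le_dint leb measurableT measurableT mqw mF qw0 le_pt).
  move=> _ _.
  rewrite /powdiff/= powRr1//.
  have mdh : measurable_fun [set: Rn] (fun h : Rn => (rho e (h : 'rV[R]_n) *
      `|v ((h : 'rV[R]_n) + (x : 'rV[R]_n)) - v ((h : 'rV[R]_n) + (y : 'rV[R]_n))|)%:E).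
    apply/measurable_EFinP; apply: measurable_funM; first exact: mrho.
    apply: (measurableT_comp (@normr_measurable _ setT)); apply: measurable_funB; exact: mvsR.
  have dh0 (h : Rn) : [set: Rn] h -> (0 <= (rho e (h : 'rV[R]_n) *
      `|v ((h : 'rV[R]_n) + (x : 'rV[R]_n)) - v ((h : 'rV[R]_n) + (y : 'rV[R]_n))|)%:E)%E.
    by move=> _; rewrite lee_fin mulr_ge0 ?rho_ge0.
  have Kxy0 : (0 <= (K x y)%:E)%E by rewrite lee_fin K0.
  rewrite EFinM muleC; apply: le_trans (lee_wpmul2l Kxy0 (mollify_diff x y)) _.
  rewrite -(ge0_integralZl leb measurableT mdh dh0 Kxy0).
  rewrite le_eqVlt; apply/orP; left; apply/eqP; apply: eq_integral => h _.
  by rewrite /Phi/= powRr1// -EFinM; congr (_%:E); rewrite /fker; ring.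
rewrite (triple_fubini leb mPhi Phi0).
have E (h : Rn) : (\int[leb]_x \int[leb]_y Phi x y h = (rho e (h : 'rV[R]_n))%:E * N v)%E.
  pose g (z : Rn * Rn) : \bar R := (`|v ((h : 'rV[R]_n) + (z.1 : 'rV[R]_n)) -
     v ((h : 'rV[R]_n) + (z.2 : 'rV[R]_n))| `^ 1 * frac_kernel s 1 z.1 z.2)%:E.
  have mvh : measurable_fun [set: Rn] (fun x : Rn => v ((h : 'rV[R]_n) + (x : 'rV[R]_n))).
    by under eq_fun do rewrite addrC; exact: mvsR.
  have mg : measurable_fun setT g by exact: (measurable_powdiff 1 mK mvh mvh).
  have g0 z : (0 <= g z)%E by rewrite lee_fin mulr_ge0 ?powR_ge0 ?frac_kernel_ge0.
  have r0 : (0 <= (rho e (h : 'rV[R]_n))%:E)%E by rewrite lee_fin rho_ge0.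
  rewrite -(seminorm_translate h).
  rewrite -(ge0_integralZl leb measurableT (measurable_inner leb mg g0 measurableT measurableT)
    (fun x _ => integral_ge0 _ (fun y _ => g0 (x, y))) r0).
  apply: eq_integral => x _.
  have mgx : measurable_fun [set: Rn] (fun y => g (x, y)).
    exact: (measurableT_comp mg (measurable_pair1 x)).
  rewrite -(ge0_integralZl leb measurableT mgx (fun y _ => g0 (x, y)) r0).
  by apply: eq_integral => y _; rewrite /Phi /g EFinM.
under eq_integral do rewrite E.
have N0 : (0 <= N v)%E by apply: dint_ge0 => t; apply: powdiff_ge0.
have mrE : measurable_fun [set: Rn] (fun h : Rn => (rho e (h : 'rV[R]_n))%:E).
  by apply/measurable_EFinP; exact: mrho.
have r0 (h : Rn) : [set: Rn] h -> (0 <= (rho e (h : 'rV[R]_n))%:E)%E by rewrite lee_fin rho_ge0.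
rewrite (ge0_integralZr leb measurableT mrE r0 N0).
have -> : (\int[leb]_h (rho e (h : 'rV[R]_n))%:E = 1)%E.
  by rewrite -(integral_rho e0 (0 : 'rV[R]_n)); apply: eq_integral => h _; rewrite subr0.
by rewrite mul1e.
Qed.

End mollify_energy.

(** * Density of Lipschitz functions with compact support *)

Section seminorms.
Context d (T : measurableType d) {R : realType} (mu : {sigma_finite_measure set T -> \bar R}).
Local Open Scope ereal_scope.
Implicit Types (K : T -> T -> R) (u v w : T -> R).

Lemma dint_ae_eq (A B : set T) p K u u' v v' : measurable A -> measurable B ->
  measurable_fun setT (fun z => K z.1 z.2) -> (forall x y, (0 <= K x y)%R) ->
  measurable_fun setT u -> measurable_fun setT u' ->
  measurable_fun setT v -> measurable_fun setT v' ->
  {ae mu, forall x, A x -> u x = u' x} -> {ae mu, forall x, B x -> v x = v' x} ->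
  dint mu A B (powdiff p K u v) = dint mu A B (powdiff p K u' v').
Proof.
move=> mA mB mK K0 mu_ mu' mv mv' uu' vv'.
have m1 := measurable_powdiff p mK mu_ mv; have m2 := measurable_powdiff p mK mu' mv'.
have q1 z : 0 <= powdiff p K u v z by exact: powdiff_ge0.
have q2 z : 0 <= powdiff p K u' v' z by exact: powdiff_ge0.
apply: (ge0_ae_eq_integral mA (measurable_inner mu m1 q1 mA mB) (measurable_inner mu m2 q2 mA mB)).
- by move=> x _; apply: integral_ge0.
- by move=> x _; apply: integral_ge0.
apply: filterS uu' => x ux Ax.
have s1 (f : T * T -> \bar R) : measurable_fun setT f -> measurable_fun B (fun y => f (x, y)).
  move=> mf; apply: (measurable_funS measurableT (@subsetT _ B)).
  exact: (measurableT_comp mf (measurable_pair1 x)).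
apply: (ge0_ae_eq_integral mB (s1 _ m1) (s1 _ m2)) => [y _//|y _//|].
by apply: filterS vv' => y vy By; rewrite /powdiff/= ux// vy.
Qed.

Lemma dint_exterior (A : set T) p K u : measurable A ->
  measurable_fun setT (fun z => K z.1 z.2) -> (forall x y, (0 <= K x y)%R) ->
  measurable_fun setT u -> (forall x, ~ A x -> u x = 0%R) ->
  dint mu A (~` A) (powdiff p K u u) = \int[mu]_(x in A) ((`|u x| `^ p)%:E * rint mu (~` A) (K x)).
Proof.
move=> mA mK K0 mu_ u0; apply: eq_integral => x _.
have mKx : measurable_fun (~` A) (EFin \o K x).
  apply/measurable_EFinP; apply: (measurable_funS measurableT (@subsetT _ _)).
  exact: (measurableT_comp mK (measurable_pair1 x)).
have Kx0 y : (~` A) y -> 0 <= (EFin \o K x) y by rewrite /= lee_fin.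
have ux0 : 0 <= (`|u x| `^ p)%:E by rewrite lee_fin powR_ge0.
rewrite /rint -(ge0_integralZl mu (measurableC mA) mKx Kx0 ux0).
by apply: eq_integral => y /set_mem Ay; rewrite /powdiff/= (u0 y Ay) subr0 EFinM.
Qed.

(** The integrand vanishes when both points lie off A, and the two mixed
    regions contribute equally. *)
Lemma seminorm_split (A : set T) p K u : (p != 0)%R -> measurable A ->
  measurable_fun setT (fun z => K z.1 z.2) -> (forall x y, (0 <= K x y)%R) ->
  (forall x y, K x y = K y x) ->
  measurable_fun setT u -> (forall x, ~ A x -> u x = 0%R) ->
  dint mu setT setT (powdiff p K u u) = dint mu A A (powdiff p K u u) +
    2%:E * \int[mu]_(x in A) ((`|u x| `^ p)%:E * rint mu (~` A) (K x)).
Proof.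
move=> p0 mA mK K0 Ksym mu_ u0.
have mC : measurable (~` A) by exact: measurableC.
have m1 := measurable_powdiff p mK mu_ mu_.
have q1 z : 0 <= powdiff p K u u z by exact: powdiff_ge0.
have dA : [disjoint A & ~` A]%classic by apply/disj_setPS => x [].
rewrite -(dint_exterior p mA mK K0 mu_ u0).
have -> : dint mu setT setT (powdiff p K u u) = dint mu (A `|` ~` A) (A `|` ~` A) (powdiff p K u u).
  by rewrite setUv.
rewrite dint_setUl//; last exact: measurableU.
rewrite !dint_setUr//.
have -> : dint mu (~` A) (~` A) (powdiff p K u u) = 0.
  rewrite /dint; apply: integral0_eq => x Ax; apply: integral0_eq => y Ay.
  by rewrite /powdiff/= !u0// subr0 normr0 powR0// mul0r.
rewrite adde0 (dint_swap mu m1 q1 mC mA) -addeA; congr (_ + _).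
have -> : dint mu A (~` A) (fun z => powdiff p K u u (z.2, z.1)) = dint mu A (~` A) (powdiff p K u u).
  by apply: eq_integral => x _; apply: eq_integral => y _; rewrite /powdiff/= distrC Ksym.
have d0 : 0 <= dint mu A (~` A) (powdiff p K u u) by exact: dint_ge0.
by rewrite -{1 2}[dint mu A _ _]mul1e -ge0_muleDl.
Qed.

Lemma int_cvg0 (A : set T) (F : nat -> T -> \bar R) (G : T -> \bar R) : measurable A ->
  (forall k, measurable_fun A (F k)) -> measurable_fun A G ->
  (forall k x, A x -> 0 <= F k x) -> (forall k x, A x -> F k x <= G x) ->
  (forall x, A x -> F k x @[k --> \oo] --> 0) ->
  \int[mu]_(x in A) G x < +oo ->
  \int[mu]_(x in A) F k x @[k --> \oo] --> 0.
Proof.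
move=> mA mF mG F0 FG Fc iG.
have G0 x : A x -> 0 <= G x by move=> Ax; apply: le_trans (FG 0%N x Ax); exact: F0.
have iGi : mu.-integrable A G.
  apply/integrableP; split => //; rewrite (eq_integral G)// => x /set_mem Ax.
  by rewrite gee0_abs// G0.
have [_ _] := @dominated_convergence _ _ _ mu A mA F (cst 0) G mF (@measurable_cst _ _ _ _ _ _)
  (nearW _ Fc) iGi (nearW _ (fun x k Ax => eq_ind_r (fun t => t <= G x) (FG k x Ax) (gee0_abs (F0 k x Ax)))).
by rewrite integral_cst// mul0e.
Qed.

Lemma dint_cvg (A B : set T) (F : nat -> T * T -> \bar R) (F0 G : T * T -> \bar R) :
  measurable A -> measurable B ->
  (forall k, measurable_fun setT (F k)) -> measurable_fun setT F0 -> measurable_fun setT G ->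
  (forall k z, 0 <= F k z) -> (forall z, 0 <= F0 z) -> (forall z, 0 <= G z) ->
  (forall k x y, A x -> B y -> F k (x, y) <= G (x, y)) ->
  (forall x y, A x -> B y -> F k (x, y) @[k --> \oo] --> F0 (x, y)) ->
  dint mu A B G < +oo -> dint mu A B (F k) @[k --> \oo] --> dint mu A B F0.
Proof.
move=> mA mB mF mF0 mG Fk0 F00 G0 FG Fc iG.
have mAB : measurable (A `*` B) by exact: measurableX.
under eq_fun do rewrite -(dintE mu (mF _) (Fk0 _) mA mB).
rewrite -(dintE mu mF0 F00 mA mB).
rewrite -(dintE mu mG G0 mA mB) in iG.
have iGi : (mu \x mu).-integrable (A `*` B) G.
  apply/integrableP; split; first exact: measurable_funS mG.
  rewrite (eq_integral G)// => x _.
  by rewrite gee0_abs// G0.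
have mFAB k : measurable_fun (A `*` B) (F k) by exact: measurable_funS (mF k).
have mF0AB : measurable_fun (A `*` B) F0 by exact: measurable_funS mF0.
have Fc' : {ae mu \x mu, forall z, (A `*` B) z -> F k z @[k --> \oo] --> F0 z}.
  by apply: nearW => -[x y] [/= Ax By]; exact: Fc.
have FG' : {ae mu \x mu, forall z k, (A `*` B) z -> `|F k z| <= G z}.
  by apply: nearW => -[x y] k [/= Ax By]; rewrite gee0_abs//; exact: FG.
by have [_ _] := @dominated_convergence _ _ _ (mu \x mu) (A `*` B) mAB F F0 G mFAB
  mF0AB Fc' iGi FG'.
Qed.

Lemma dint_cvg0 (A B : set T) (F : nat -> T * T -> \bar R) (G : T * T -> \bar R) :
  measurable A -> measurable B ->
  (forall k, measurable_fun setT (F k)) -> measurable_fun setT G ->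
  (forall k z, 0 <= F k z) -> (forall z, 0 <= G z) ->
  (forall k x y, A x -> B y -> F k (x, y) <= G (x, y)) ->
  (forall x y, A x -> B y -> F k (x, y) @[k --> \oo] --> 0) ->
  dint mu A B G < +oo -> dint mu A B (F k) @[k --> \oo] --> 0.
Proof.
move=> mA mB mF mG Fk0 G0 FG Fc iG.
have z0 : dint mu A B (cst 0) = 0 by apply: integral0_eq => x _; exact: integral0.
rewrite -z0; exact: (dint_cvg mA mB mF (@measurable_cst _ _ _ _ _ _) mG Fk0 (fun=> lexx 0) G0 FG Fc iG).
Qed.

End seminorms.

Section cutoff.
Context d (T : measurableType d) {R : realType} (mu : {sigma_finite_measure set T -> \bar R}).
Local Open Scope ereal_scope.
Variables (A : set T) (K G : T -> T -> R) (eta : nat -> T -> R) (v : T -> R).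
Hypotheses (mA : measurable A).
Hypotheses (mK : measurable_fun setT (fun z => K z.1 z.2)) (K0 : forall x y, (0 <= K x y)%R).
Hypotheses (mG : measurable_fun setT (fun z => G z.1 z.2)) (G0 : forall x y, (0 <= G x y)%R).
Hypotheses (meta : forall k, measurable_fun setT (eta k)) (eta01 : forall k x, (0 <= eta k x <= 1)%R).
Hypothesis eta_cvg : forall x, A x -> eta k x @[k --> \oo] --> (1%R : R).
Hypothesis eta_G : forall k x y, A x -> A y -> (`|eta k x - eta k y| <= G x y)%R.
Hypotheses (mv : measurable_fun setT v).
Hypothesis iv : dint mu A A (powdiff 1 K v v) < +oo.
Hypothesis iG : dint mu A A (fun z => (`|v z.1| * (G z.1 z.2 * K z.1 z.2))%:E) < +oo.

Let r k x : R := (v x - eta k x * v x)%R.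

Lemma cutoff_diff (a b c e : R) : (0 <= e <= 1)%R ->
  (`|(a - c * a) - (b - e * b)| <= `|a - b| + `|a| * `|c - e|)%R.
Proof.
move=> /andP[e0 e1].
have -> : ((a - c * a) - (b - e * b) = (1 - e) * (a - b) - a * (c - e))%R by ring.
apply: (le_trans (ler_normB _ _)); rewrite !normrM lerD2r ger0_norm ?subr_ge0//.
by rewrite ler_piMl// lerBlDr lerDl.
Qed.

(** Dominated convergence on pairs of points: G dominates the oscillation of
    all the cutoffs at once. *)
Lemma cutoff_cvg_seminorm : dint mu A A (powdiff 1 K (r k) (r k)) @[k --> \oo] --> 0.
Proof.
have mr k : measurable_fun setT (r k) by apply: measurable_funB => //; exact: measurable_funM.
have mv1 : measurable_fun setT (fun z : T * T => v z.1) by exact: (measurableT_comp mv measurable_fst).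
have mgk : measurable_fun setT (fun z : T * T => (`|v z.1| * (G z.1 z.2 * K z.1 z.2))%:E).
  apply/measurable_EFinP; apply: measurable_funM; last exact: measurable_funM.
  exact: measurableT_comp.
have gk0 z : 0 <= (`|v z.1| * (G z.1 z.2 * K z.1 z.2))%:E.
  by rewrite lee_fin mulr_ge0// mulr_ge0.
have mq := measurable_powdiff 1 mK mv mv.
have q0 z : 0 <= powdiff 1 K v v z by exact: powdiff_ge0.
apply: (@dint_cvg0 _ _ _ mu A A (fun k => powdiff 1 K (r k) (r k))
  (fun z => powdiff 1 K v v z + (`|v z.1| * (G z.1 z.2 * K z.1 z.2))%:E) mA mA).
- by move=> k; exact: measurable_powdiff.
- exact: (emeasurable_funD mq mgk).
- by move=> k z; exact: powdiff_ge0.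
- by move=> z; rewrite adde_ge0.
- move=> k x y Ax Ay; rewrite /powdiff/= -EFinD lee_fin !powRr1// mulrA -mulrDl ler_wpM2r//.
  apply: (le_trans (cutoff_diff (v x) (v y) (eta k x) (eta01 k y))).
  by rewrite lerD2l ler_wpM2l// eta_G.
- move=> x y Ax Ay; rewrite /powdiff/=.
  have cr z : A z -> r k z @[k --> \oo] --> (0%R : R).
    move=> Az; have -> : (0%R = v z - 1 * v z :> R)%R by rewrite mul1r subrr.
    exact: (cvgB (cvg_cst _) (cvgM (eta_cvg Az) (cvg_cst _))).
  apply: cvg_EFin; first exact: nearW.
  have -> : (0%R = `|(0 : R) - 0| * K x y :> R)%R by rewrite subr0 normr0 mul0r.
  have -> : (fine \o (fun k => ((`|r k x - r k y| `^ 1)%R * K x y)%:E)) =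
      (fun k => `|r k x - r k y| * K x y)%R by apply/funext => k /=; rewrite powRr1.
  exact: (cvgM (cvg_norm (cvgB (cr x Ax) (cr y Ay))) (cvg_cst _)).
- rewrite (dintD mu mA mA mq mgk q0 gk0); exact: lte_add_pinfty.
Qed.

Lemma cutoff_cvg_weighted (kp : T -> \bar R) : measurable_fun A kp -> (forall x, A x -> 0 <= kp x) ->
  \int[mu]_(x in A) (`|v x|%:E * kp x) < +oo -> (forall x, A x -> kp x < +oo) ->
  \int[mu]_(x in A) (`|r k x|%:E * kp x) @[k --> \oo] --> 0.
Proof.
move=> mkp kp0 ikp kpoo.
have mr k : measurable_fun A (r k).
  apply: (measurable_funS measurableT (@subsetT _ A)).
  by apply: measurable_funB => //; exact: measurable_funM.
have mvA : measurable_fun A v by exact: (measurable_funS measurableT (@subsetT _ A)).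
apply: (@int_cvg0 _ _ _ mu A (fun k x => `|r k x|%:E * kp x) (fun x => `|v x|%:E * kp x)) => //.
- move=> k; apply: emeasurable_funM => //.
  by apply/measurable_EFinP; exact: measurableT_comp.
- apply: emeasurable_funM => //.
  by apply/measurable_EFinP; exact: measurableT_comp.
- by move=> k x Ax; rewrite mule_ge0// ?lee_fin// kp0.
- move=> k x Ax; rewrite lee_wpmul2r// ?kp0// lee_fin /r -[X in (X - _)%R]mul1r -mulrBl normrM.
  have /andP[e0 e1] := eta01 k x.
  by rewrite ler_piMl// ger0_norm ?subr_ge0// lerBlDr lerDl.
- move=> x Ax.
  have /fineK <- : kp x \is a fin_num by rewrite ge0_fin_numE ?kp0// kpoo.
  apply: cvg_EFin; first exact: nearW.
  have -> : (0%R = `|v x - 1 * v x| * fine (kp x) :> R)%R by rewrite mul1r subrr normr0 mul0r.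
  exact: (cvgM (cvg_norm (cvgB (cvg_cst _) (cvgM (eta_cvg Ax) (cvg_cst _)))) (cvg_cst _)).
Qed.

End cutoff.

Section seminorm_triangle.
Context d (T : measurableType d) {R : realType} (mu : {sigma_finite_measure set T -> \bar R}).
Local Open Scope ereal_scope.

Lemma seminorm_triangle (A : set T) (K : T -> T -> R) (u v : T -> R) : measurable A ->
  measurable_fun setT (fun z => K z.1 z.2) -> (forall x y, (0 <= K x y)%R) ->
  measurable_fun setT u -> measurable_fun setT v ->
  dint mu A A (powdiff 1 K u u) <= dint mu A A (powdiff 1 K v v) + dint mu A A (powdiff 1 K (v \- u)%R (v \- u)%R).
Proof.
move=> mA mK K0 mu_ mv.
have mvu : measurable_fun setT (v \- u)%R by exact: measurable_funB.
have m1 := measurable_powdiff 1 mK mu_ mu_; have m2 := measurable_powdiff 1 mK mv mv.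
have m3 := measurable_powdiff 1 mK mvu mvu.
have q1 z : 0 <= powdiff 1 K u u z by exact: powdiff_ge0.
have q2 z : 0 <= powdiff 1 K v v z by exact: powdiff_ge0.
have q3 z : 0 <= powdiff 1 K (v \- u)%R (v \- u)%R z by exact: powdiff_ge0.
rewrite -(dintD mu mA mA m2 m3 q2 q3); apply: le_dint => //.
- exact: emeasurable_funD.
- move=> x y _ _; rewrite /powdiff/= -EFinD lee_fin !powRr1// -mulrDl ler_wpM2r//.
  have -> : (u x - u y = (v x - v y) - ((v x - u x) - (v y - u y)))%R by ring.
  exact: ler_normB.
Qed.

End seminorm_triangle.

Lemma dist_unit_le1 (R : realType) (a b : R) : 0 <= a <= 1 -> 0 <= b <= 1 -> `|a - b| <= 1.
Proof. by move=> /andP[? ?] /andP[? ?]; rewrite ler_norml; apply/andP; split; lra. Qed.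

Lemma cvg0_both_lt (R : realType) (f g : nat -> \bar R) (e : R) :
  f k @[k --> \oo] --> 0%E -> g k @[k --> \oo] --> 0%E -> 0 < e ->
  exists k, (f k < e%:E)%E /\ (g k < e%:E)%E.
Proof.
move=> f0 g0 e0.
have N0 : nbhs (0%E : \bar R) [set t | (t < e%:E)%E].
  by apply: open_nbhs_nbhs; split; [exact: open_ereal_lt_ereal|rewrite /= lte_fin].
have [i _ fi] := f0 _ N0; have [j _ gj] := g0 _ N0.
by exists (maxn i j); split; [apply: fi; exact: leq_maxl|apply: gj; exact: leq_maxr].
Qed.

Section cutoff_domain.
Context {R : realType} {n : nat}.
Variable s : R.
Hypotheses (n_gt0 : (0 < n)%N) (s01 : 0 < s < 1).
Local Notation Rn := (lebesgueRn R n).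
Local Notation leb := (@lebesgue R n).
Variable Omega : set 'rV[R]_n.
Hypotheses (oO : open Omega) (bO : bounded_set Omega).

Let s0 : 0 < s. Proof. by case/andP: s01. Qed.
Let C_ne := complement_nonempty n_gt0 bO.
Let mO : measurable (Omega : set Rn). Proof. exact: open_lebesgue. Qed.

Lemma majorant_cst_ge0 : 0 <= majorant_cst n s.
Proof.
have h := @integral_majorant R n s 1 0 s01 ltr01.
rewrite powR1 mulr1 in h; rewrite -lee_fin; apply: (le_trans _ h).
by apply: integral_ge0 => y _; rewrite lee_fin majorant_ge0.
Qed.

Lemma kappa_ge0 q (x : Rn) : (0 <= kappa s Omega q x)%E.
Proof. by apply: integral_ge0 => y _; rewrite lee_fin frac_kernel_ge0. Qed.

Lemma measurable_kappa q : measurable_fun [set: Rn] (kappa s Omega q).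
Proof.
have mk : measurable_fun [set: Rn * Rn] (fun z : Rn * Rn => (fker s q z.1 z.2)%:E).
  by apply/measurable_EFinP; exact: measurable_frac_kernel.
have k0 (z : Rn * Rn) : (0 <= (fker s q z.1 z.2)%:E)%E by rewrite lee_fin frac_kernel_ge0.
exact: (measurable_inner leb mk k0 measurableT (measurableC mO)).
Qed.

(** The complement is at distance at least r, where the kernel is integrable. *)
Lemma kappa_far (q r : R) (x : Rn) : 1 <= q <= 2 -> 0 < r -> r <= depth Omega x ->
  (kappa s Omega q x <= ((1 + r `^ (- s)) * (majorant_cst n s * r `^ (- s)))%:E)%E.
Proof.
move=> q12 r0 rx.
have c0 : 0 <= 1 + r `^ (- s) by rewrite addr_ge0// powR_ge0.
have mm : measurable_fun [set: Rn] (fun y : Rn => (majorant s r x y)%:E).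
  by apply/measurable_EFinP; exact: measurable_majorant.
have mC := measurableC mO.
have mmC : measurable_fun (~` Omega : set Rn) (fun y : Rn => (majorant s r x y)%:E).
  exact: (measurable_funS measurableT (@subsetT _ _) mm).
have mk : measurable_fun (~` Omega : set Rn) (EFin \o fker s q x).
  apply/measurable_EFinP.
  exact: (measurable_funS measurableT (@subsetT _ _) (measurable_fker_x s q x)).
have m0 (y : Rn) : (~` Omega : set Rn) y -> (0 <= (majorant s r x y)%:E)%E by rewrite lee_fin majorant_ge0.
have k0 (y : Rn) : (~` Omega : set Rn) y -> (0 <= (EFin \o fker s q x) y)%E by rewrite lee_fin frac_kernel_ge0.
have m0' (y : Rn) : [set: Rn] y -> (0 <= (majorant s r x y)%:E)%E by rewrite lee_fin majorant_ge0.
have c0' : (0 <= (1 + r `^ (- s))%:E)%E by rewrite lee_fin.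
rewrite EFinM.
apply: (@le_trans _ _ ((1 + r `^ (- s))%:E * \int[leb]_(y in (~` Omega : set Rn)) (majorant s r x y)%:E)%E); last first.
  apply: (lee_wpmul2l c0'); apply: (le_trans _ (integral_majorant x s01 r0)).
  exact: (@ge0_subset_integral _ _ _ leb (~` Omega : set Rn) setT mC measurableT _ mm m0' (@subsetT _ _)).
rewrite -(ge0_integralZl leb mC mmC m0 c0').
have mmC' : measurable_fun (~` Omega : set Rn) (fun y : Rn => ((1 + r `^ (- s))%:E * (majorant s r x y)%:E)%E).
  exact: measurable_funeM.
apply: (ge0_le_integral leb mC k0 mk mmC').
move=> y Cy; rewrite -EFinM lee_fin; apply: frac_kernel_far => //.
exact: (le_trans rx (dist_le C_ne _ Cy)).
Qed.

(** In Omega it vanishes where the depth is at most dl, and it tends to 1 with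
    dl tending to 0. Off Omega the depth is 0, hence so is its inverse, and the
    value is 1: only products with functions vanishing there are considered. *)
Definition cutoff (dl : R) (x : Rn) : R := Num.max 0 (1 - dl * depth Omega x `^ (-1)).

Lemma cut01 dl x : 0 <= dl -> 0 <= cutoff dl x <= 1.
Proof.
move=> dl0; rewrite le_max lexx/= ge_max ler01/= lerBlDr lerDl.
by rewrite mulr_ge0// powR_ge0.
Qed.

Lemma measurable_depth : measurable_fun [set: Rn] (depth Omega : Rn -> R).
Proof. exact: (continuous_lebesgue (continuous_dist C_ne)). Qed.

Lemma measurable_cut dl : measurable_fun [set: Rn] (cutoff dl).
Proof.
apply: measurable_maxr; first exact: measurable_cst.
apply: measurable_funB; first exact: measurable_cst.
apply: measurable_funM; first exact: measurable_cst.
exact: measurable_fun_powR measurable_depth.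
Qed.

(** The oscillation of the cutoff is at most the relative distance |a - b| / a,
    uniformly in dl, so that one function dominates for all dl. *)
Lemma cutoff_lip (a b t dl : R) : 0 < a -> 0 < b -> 0 <= dl -> `|a - b| <= t ->
  `|Num.max 0 (1 - dl / a) - Num.max 0 (1 - dl / b)| <= t / a.
Proof.
move=> a0 b0 d0 abt; apply: (@le_trans _ _ (`|a - b| / a)); last first.
  by rewrite ler_pM2r ?invr_gt0.
rewrite ler_pdivlMr// -[X in _ * X](gtr0_norm a0) -normrM mulrBl.
have E (c : R) : 0 < c -> Num.max 0 (1 - dl / c) = Num.max 0 (c - dl) / c.
  by move=> c0; rewrite maxr_pMl ?invr_ge0 ?ltW// mul0r mulrBl divff ?gt_eqF.
rewrite !E// divfK ?gt_eqF//.
have -> : Num.max 0 (b - dl) / b * a = Num.max 0 (b - dl) * (a / b) by ring.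
have ab0 : 0 < a / b by rewrite divr_gt0.
have abE : a / b * b = a by rewrite divfK ?gt_eqF.
rewrite ler_norml; apply/andP; split; case: (leP 0 (a - dl)) => h1; case: (leP 0 (b - dl)) => h2;
  rewrite ?mul0r ?subr0 ?sub0r;
  case: (lerP (a - b) 0) => hab;
  rewrite ?(ler0_norm hab) ?(gtr0_norm hab); nra.
Qed.

Let G (x y : Rn) : R := Num.min 1 (enorm ((x : 'rV[R]_n) - (y : 'rV[R]_n)) * depth Omega x `^ (-1)).
Let eta (k : nat) := cutoff k.+1%:R^-1.

Let G0 x y : 0 <= G x y.
Proof. by rewrite le_min ler01/= mulr_ge0 ?powR_ge0 ?sqrtr_ge0. Qed.

Let mG : measurable_fun [set: Rn * Rn] (fun z : Rn * Rn => G z.1 z.2).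
Proof.
apply: measurable_minr; first exact: measurable_cst.
apply: measurable_funM.
  apply: (@measurable_enorm R n _ (Rn * Rn)%type (fun z : Rn * Rn => (z.1 : 'rV[R]_n) - (z.2 : 'rV[R]_n))).
  by move=> i; exact: measurable_coord_sub.
exact: (measurableT_comp (measurable_fun_powR (-1) measurable_depth) measurable_fst).
Qed.

Let eta_cvg x : Omega x -> eta k x @[k --> \oo] --> (1 : R).
Proof.
move=> Ox; have d0 := depth_gt0 n_gt0 oO bO Ox.
apply: (squeeze_cvgr (f := fun k => 1 - k.+1%:R^-1 * depth Omega x `^ (-1)) (h := fun=> 1)).
- apply: nearW => k; have k0 : 0 <= k.+1%:R^-1 :> R by rewrite invr_ge0.
  by have /andP[_ ->] := cut01 x k0; rewrite andbT le_max lexx orbT.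
- rewrite [X in _ --> X](_ : 1 = 1 - 0 * depth Omega x `^ (-1)); last by rewrite mul0r subr0.
  apply: cvgB; first exact: cvg_cst.
  by apply: cvgM; [exact: cvg_harmonic|exact: cvg_cst].
- exact: cvg_cst.
Qed.

Let eta_G k x y : Omega x -> Omega y -> `|eta k x - eta k y| <= G x y.
Proof.
move=> Ox Oy.
have dx := depth_gt0 n_gt0 oO bO Ox; have dy := depth_gt0 n_gt0 oO bO Oy.
have k0 : 0 <= k.+1%:R^-1 :> R by rewrite invr_ge0.
rewrite le_min; apply/andP; split.
  exact: (dist_unit_le1 (cut01 x k0) (cut01 y k0)).
rewrite /eta /cutoff !powR_inv1 ?(ltW dx) ?(ltW dy)//; apply: cutoff_lip => //.
exact: (le_trans (dist_lip C_ne _ _) (enorm_ge _)).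
Qed.

Let GK_le x y : Omega x -> G x y * fker s 1 x y <= n%:R * majorant s (depth Omega x) x y.
Proof.
move=> Ox; have dx := depth_gt0 n_gt0 oO bO Ox.
have n1 : 1 <= n%:R :> R by rewrite ler1n.
have [xy|xy] := eqVneq (x : 'rV[R]_n) (y : 'rV[R]_n).
  have e0 : enorm (0 : 'rV[R]_n) = 0.
    by apply/eqP; rewrite eq_le sqrtr_ge0 (le_trans (enorm_le _))// normr0 mulr0.
  have -> : G x y = 0 by rewrite /G xy subrr e0 mul0r min_r.
  by rewrite mul0r mulr_ge0// majorant_ge0.
rewrite /majorant mulrA; apply: ler_pM => //; first exact: frac_kernel_ge0.
  rewrite /G powR_inv1 ?(ltW dx)//; case: (leP 1 (`|x - y : 'rV[R]_n| / depth Omega x)) => h.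
    by rewrite mulr1 (le_trans _ n1)// ge_min lexx.
  rewrite ge_min; apply/orP; right; rewrite mulrA ler_pM2r ?invr_gt0//; exact: enorm_le.
by have := @frac_kernel_le R n s 1 x y; rewrite mulr1 => /(_ (ltW s0) xy).
Qed.

Hypothesis lO : lipschitz_boundary Omega.
Variable v : Rn -> R.
Hypotheses (mv : measurable_fun [set: Rn] v).
Hypothesis Iv : (dint leb Omega Omega (powdiff 1 (fker s 1) v v) < +oo)%E.
Hypothesis kv : (\int[leb]_(x in (Omega : set Rn)) (`|v x|%:E * kappa s Omega 1 x) < +oo)%E.

(** Hardy's inequality turns the singular weight of the cutoff into kappa. *)
Lemma cutoff_dominator :
  (dint leb Omega Omega (fun z => (`|v z.1| * (G z.1 z.2 * fker s 1 z.1 z.2))%:E) < +oo)%E.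
Proof.
have [c c0 hc] := hardy n_gt0 s0 oO bO lO.
pose b : R := n%:R * majorant_cst n s / c.
have b0 : (0 <= b%:E)%E.
  by rewrite lee_fin; apply: divr_ge0; [rewrite mulr_ge0// majorant_cst_ge0|exact: ltW].
have mF : measurable_fun [set: Rn * Rn]
    (fun z : Rn * Rn => (`|v z.1| * (G z.1 z.2 * fker s 1 z.1 z.2))%:E).
  apply/measurable_EFinP; apply: measurable_funM.
    exact: (measurableT_comp (measurableT_comp (@normr_measurable R setT) mv) measurable_fst).
  exact: (measurable_funM mG (measurable_frac_kernel s 1)).
have F0 (z : Rn * Rn) : (0 <= (`|v z.1| * (G z.1 z.2 * fker s 1 z.1 z.2))%:E)%E.
  by rewrite lee_fin !mulr_ge0// frac_kernel_ge0.
have mi := measurable_inner leb mF F0 mO mO.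
have mw : measurable_fun (Omega : set Rn) (fun x : Rn => (`|v x|%:E * kappa s Omega 1 x)%E).
  apply: emeasurable_funM.
    apply/measurable_EFinP; apply: (measurable_funS measurableT (@subsetT _ _)).
    exact: (measurableT_comp (@normr_measurable R setT) mv).
  exact: (measurable_funS measurableT (@subsetT _ _) (measurable_kappa 1)).
have w0 (x : Rn) : (Omega : set Rn) x -> (0 <= `|v x|%:E * kappa s Omega 1 x)%E.
  by move=> _; apply: mule_ge0; [rewrite lee_fin|exact: kappa_ge0].
apply: (@le_lt_trans _ _ (b%:E * \int[leb]_(x in (Omega : set Rn)) (`|v x|%:E * kappa s Omega 1 x))%E); last first.
  by rewrite lte_mul_pinfty// ltry.
rewrite -(ge0_integralZl leb mO mw w0 b0).
have i0 (x : Rn) : (Omega : set Rn) x ->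
    (0 <= \int[leb]_(y in (Omega : set Rn)) (`|v x| * (G x y * fker s 1 x y))%:E)%E.
  by move=> _; apply: integral_ge0 => y _; exact: (F0 (x, y)).
have mbw : measurable_fun (Omega : set Rn) (fun x : Rn => (b%:E * (`|v x|%:E * kappa s Omega 1 x))%E).
  exact: measurable_funeM.
apply: (ge0_le_integral leb mO i0 mi mbw) => x Ox.
have dx := depth_gt0 n_gt0 oO bO Ox.
pose a : R := `|v x| * n%:R.
have a0 : (0 <= a%:E)%E by rewrite lee_fin mulr_ge0.
have mm : measurable_fun [set: Rn] (fun y : Rn => (majorant s (depth Omega x) x y)%:E).
  by apply/measurable_EFinP; exact: measurable_majorant.
have m0 (y : Rn) : [set: Rn] y -> (0 <= (majorant s (depth Omega x) x y)%:E)%E.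
  by rewrite lee_fin majorant_ge0.
have mmO := measurable_funS measurableT (@subsetT _ (Omega : set Rn)) mm.
have m0O (y : Rn) : (Omega : set Rn) y -> (0 <= (majorant s (depth Omega x) x y)%:E)%E.
  by rewrite lee_fin majorant_ge0.
apply: (@le_trans _ _ (a%:E * (majorant_cst n s * depth Omega x `^ (- s))%:E)%E); last first.
  apply: (@le_trans _ _ (b%:E * (`|v x|%:E * (c * depth Omega x `^ (- s))%:E))%E).
    rewrite -!EFinM lee_fin /a /b le_eqVlt; apply/orP; left; apply/eqP.
    by field; rewrite gt_eqF.
  rewrite lee_wpmul2l// lee_wpmul2l ?lee_fin//.
  exact: hc.
apply: (@le_trans _ _ (a%:E * \int[leb]_(y in (Omega : set Rn)) (majorant s (depth Omega x) x y)%:E)%E); last first.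
  apply: (lee_wpmul2l a0); apply: (le_trans _ (integral_majorant x s01 dx)).
  exact: (@ge0_subset_integral _ _ _ leb (Omega : set Rn) setT mO measurableT _ mm m0 (@subsetT _ _)).
rewrite -(ge0_integralZl leb mO mmO m0O a0).
have mamO : measurable_fun (Omega : set Rn) (fun y : Rn => (a%:E * (majorant s (depth Omega x) x y)%:E)%E).
  exact: measurable_funeM.
have mFx : measurable_fun (Omega : set Rn) (fun y : Rn => (`|v x| * (G x y * fker s 1 x y))%:E).
  exact: (measurable_funS measurableT (@subsetT _ _) (measurableT_comp mF (measurable_pair1 x))).
apply: (ge0_le_integral leb mO (fun y _ => F0 (x, y)) mFx mamO) => y Oy.
by rewrite -EFinM lee_fin /a -mulrA ler_wpM2l// GK_le.
Qed.

Lemma cutoff_density (e : R) : 0 < e -> exists2 dl, 0 < dl &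
  (dint leb Omega Omega (powdiff 1 (fker s 1) (fun x => cutoff dl x * v x)%R (fun x => cutoff dl x * v x)%R)
     <= dint leb Omega Omega (powdiff 1 (fker s 1) v v) + e%:E)%E /\
  (\int[leb]_(x in (Omega : set Rn)) (`|v x - cutoff dl x * v x|%:E * kappa s Omega 1 x) <= e%:E)%E.
Proof.
move=> e0.
have k0 (k : nat) : 0 <= k.+1%:R^-1 :> R by rewrite invr_ge0.
have mK := @measurable_frac_kernel R n s 1.
have K0 (x y : Rn) : 0 <= fker s 1 x y by exact: frac_kernel_ge0.
have meta k : measurable_fun [set: Rn] (eta k) by exact: measurable_cut.
have eta01 k x : 0 <= eta k x <= 1 by exact: cut01.
have C1 := @cutoff_cvg_seminorm _ _ _ leb Omega (fker s 1) G eta v mO mK K0 mG G0 meta eta01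
  eta_cvg eta_G mv Iv cutoff_dominator.
have mkO : measurable_fun (Omega : set Rn) (kappa s Omega 1).
  exact: (measurable_funS measurableT (@subsetT _ _) (measurable_kappa 1)).
have kfin (x : Rn) : Omega x -> (kappa s Omega 1 x < +oo)%E.
  move=> Ox; have dx := depth_gt0 n_gt0 oO bO Ox.
  by apply: (le_lt_trans (kappa_far _ dx (lexx _))); rewrite ?ltry// lexx ler1n.
have C2 := @cutoff_cvg_weighted _ _ _ leb Omega eta v mO meta eta01 eta_cvg mv (kappa s Omega 1)
  mkO (fun x _ => kappa_ge0 1 x) kv kfin.
have E0 : (0 < e%:E)%E by rewrite lte_fin.
have [k [h1 h2]] : exists k, 
  (dint leb Omega Omega (powdiff 1 (fker s 1) (fun x => v x - eta k x * v x)%R (fun x => v x - eta k x * v x)%R) < e%:E)%E /\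
  (\int[leb]_(x in (Omega : set Rn)) (`|v x - eta k x * v x|%:E * kappa s Omega 1 x) < e%:E)%E.
  exact: (cvg0_both_lt C1 C2 e0).
exists k.+1%:R^-1; first by rewrite invr_gt0.
split; last exact: ltW.
have mcv : measurable_fun [set: Rn] (fun x => eta k x * v x) by exact: (measurable_funM (meta k) mv).
have := @seminorm_triangle _ _ _ leb Omega (fker s 1) (fun x => eta k x * v x) v mO mK K0 mcv mv.
by move/le_trans; apply; rewrite leeD2l// ltW.
Qed.

End cutoff_domain.

Lemma ae_mono d (T : measurableType d) (R : realType) (mu : {measure set T -> \bar R})
  (P Q : T -> Prop) : {ae mu, forall x, P x} -> (forall x, P x -> Q x) -> {ae mu, forall x, Q x}.
Proof. by move=> aP PQ; exact: filterS aP. Qed.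

Section weighted_norms.
Context d (T : measurableType d) {R : realType} (mu : {measure set T -> \bar R}).
Local Open Scope ereal_scope.
Variables (A : set T) (kp : T -> \bar R).
Hypotheses (mA : measurable A) (mkp : measurable_fun setT kp) (kp0 : forall x, 0 <= kp x).
Implicit Types u v w : T -> R.

Lemma measurable_weighted u : measurable_fun setT u ->
  measurable_fun A (fun x => `|u x|%:E * kp x).
Proof.
move=> mu_; apply: (measurable_funS measurableT (@subsetT _ A)).
apply: emeasurable_funM => //; apply/measurable_EFinP; exact: measurableT_comp.
Qed.

Lemma weighted_triangle u v w : measurable_fun setT u -> measurable_fun setT v ->
  measurable_fun setT w ->
  \int[mu]_(x in A) (`|u x - w x|%:E * kp x) <=
  \int[mu]_(x in A) (`|u x - v x|%:E * kp x) + \int[mu]_(x in A) (`|v x - w x|%:E * kp x).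
Proof.
move=> mu_ mv mw.
have m1 := measurable_weighted (measurable_funB mu_ mw).
have m2 := measurable_weighted (measurable_funB mu_ mv).
have m3 := measurable_weighted (measurable_funB mv mw).
have w0 (f : T -> R) x : 0 <= `|f x|%:E * kp x by apply: mule_ge0.
rewrite -(ge0_integralD mu mA (fun x _ => w0 (u \- v)%R x) m2 (fun x _ => w0 (v \- w)%R x) m3).
apply: (ge0_le_integral mu mA (fun x _ => w0 (u \- w)%R x) m1).
  exact: (emeasurable_funD m2 m3).
move=> x _; rewrite -ge0_muleDl// lee_wpmul2r//= -EFinD lee_fin.
exact: ler_distD.
Qed.

Lemma weighted_le u v (C : R) : measurable_fun setT u -> measurable_fun setT v ->
  (0 <= C)%R -> {ae mu, forall x, A x -> u x = v x} ->
  (forall x, A x -> u x != 0%R -> kp x <= C%:E) ->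
  \int[mu]_(x in A) (`|u x|%:E * kp x) <= C%:E * \int[mu]_(x in A) `|v x|%:E.
Proof.
move=> mu_ mv C0 uv uk.
have mn (f : T -> R) : measurable_fun setT f -> measurable_fun A (fun x => `|f x|%:E).
  move=> mf; apply/measurable_EFinP; apply: (measurable_funS measurableT (@subsetT _ A)).
  exact: measurableT_comp.
have -> : \int[mu]_(x in A) `|v x|%:E = \int[mu]_(x in A) `|u x|%:E.
  apply: (ge0_ae_eq_integral mA (mn _ mv) (mn _ mu_)) => //.
  by apply: filterS uv => x h Ax; rewrite h.
rewrite -(ge0_integralZl mu mA (mn _ mu_))//.
apply: (ge0_le_integral mu mA _ (measurable_weighted mu_)).
- by move=> x _; apply: mule_ge0.
- exact: (measurable_funeM C%:E (mn _ mu_)).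
move=> x Ax; have [->|ux] := eqVneq (u x) 0%R; first by rewrite normr0 mul0e mule0.
by rewrite muleC lee_wpmul2r// uk.
Qed.

Lemma integral_le_weighted u (c : R) : measurable_fun setT u -> (0 < c)%R ->
  (forall x, A x -> c%:E <= kp x) ->
  \int[mu]_(x in A) `|u x|%:E <= c^-1%:E * \int[mu]_(x in A) (`|u x|%:E * kp x).
Proof.
move=> mu_ c0 ck.
have mn : measurable_fun A (fun x => `|u x|%:E).
  apply/measurable_EFinP; apply: (measurable_funS measurableT (@subsetT _ A)).
  exact: measurableT_comp.
have w0 x : A x -> 0 <= `|u x|%:E * kp x by move=> _; apply: mule_ge0.
have c0' : 0 <= c^-1%:E by rewrite lee_fin invr_ge0 ltW.
rewrite -(ge0_integralZl mu mA (measurable_weighted mu_) w0 c0').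
apply: (ge0_le_integral mu mA _ mn) => //.
  exact: (measurable_funeM _ (measurable_weighted mu_)).
move=> x Ax; rewrite muleCA; apply: (@le_trans _ _ (`|u x|%:E * (c^-1%:E * c%:E))).
  by rewrite -(EFinM c^-1 c) mulVf ?gt_eqF// mule1.
by rewrite lee_wpmul2l// lee_wpmul2l// ck.
Qed.

End weighted_norms.

Lemma ge0_lty_real (R : realType) (x : \bar R) : (0 <= x)%E -> (x < +oo)%E ->
  exists2 r, 0 <= r & x = r%:E.
Proof.
move=> x0 xoo; exists (fine x); first exact: fine_ge0.
by rewrite fineK// ge0_fin_numE.
Qed.

Lemma cancel_weighted (R : realType) (a b W U D : \bar R) :
  (0 <= W)%E -> (W < +oo)%E -> (0 <= D)%E -> (0 <= b)%E ->
  (a + 2%:E * W <= b + 2%:E * U)%E -> (U <= W + D)%E -> (a <= b + 2%:E * D)%E.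
Proof.
move=> W0 Woo D0 b0 h UW.
have Wf : (2%:E * W)%E \is a fin_num by rewrite fin_numM// ge0_fin_numE.
rewrite -(leeD2rE _ _ Wf); apply: (le_trans h).
rewrite -addeA -ge0_muleDr//.
by rewrite leeD2l// lee_wpmul2l// addeC.
Qed.

Lemma small_powR (R : realType) (s X e t : R) : 0 < s -> 0 <= X -> 0 < e -> 0 < t ->
  exists2 r, 0 < r < t & r `^ s * X <= e.
Proof.
move=> s0 X0 e0 t0; pose r0 := (e / (X + 1)) `^ s^-1.
have x1 : 0 < X + 1 by rewrite ltr_wpDl.
have r00 : 0 < r0 by rewrite powR_gt0// divr_gt0.
have m0 : 0 < Num.min r0 (t / 2) by rewrite lt_min r00 divr_gt0.
exists (Num.min r0 (t / 2)).
  by rewrite m0/= gt_min; apply/orP; right; rewrite ltr_pdivrMr// ltr_pMr// ltr1n.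
apply: (@le_trans _ _ (r0 `^ s * X)).
  by rewrite ler_wpM2r// ge0_ler_powR ?nnegrE ?(ltW m0) ?(ltW r00) ?(ltW s0)// ge_min lexx.
rewrite -powRrM mulVf ?gt_eqF// powRr1 ?(ltW (divr_gt0 e0 x1))//.
by rewrite mulrAC ler_pdivrMr// ler_pM2l// lerDl.
Qed.

Lemma far_cst_ge0 (R : realType) (d s c : R) : 0 <= c ->
  0 <= (1 + d `^ (- s)) * (c * d `^ (- s)).
Proof. by move=> c0; rewrite !mulr_ge0 ?powR_ge0// addr_ge0// powR_ge0. Qed.

Lemma close_cst_ge0 (R : realType) (n : nat) (C l N : R) : 0 <= C -> 0 <= l -> 0 <= N ->
  0 <= C * (l + 2 * n%:R ^+ (n + 2) * N).
Proof. by move=> C0 l0 N0; rewrite mulr_ge0// addr_ge0// !mulr_ge0// exprn_ge0. Qed.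

Lemma close_rate_ge0 (R : realType) (n : nat) (r s : R) : 0 <= 2 * n%:R ^+ (n + 2) * r `^ s.
Proof. by rewrite !mulr_ge0// ?exprn_ge0// powR_ge0. Qed.

Lemma close_cstE (R : realType) (n : nat) (C l N t : R) :
  (C%:E * (t%:E * l%:E + (2 * n%:R ^+ (n + 2) * t)%:E * N%:E) =
   (t * (C * (l + 2 * n%:R ^+ (n + 2) * N)))%:E)%E.
Proof. by rewrite -(EFinM t) -(EFinM _ N) -EFinD -(EFinM C); congr EFin; ring. Qed.

Lemma div_swap (R : realType) (a b c : R) : a / b * c = c / b * a.
Proof. by ring. Qed.

Lemma halfD (R : realType) (d : R) : d = d / 2 + d / 2.
Proof. by field. Qed.

Lemma half_lt (R : realType) (d : R) : 0 < d -> d / 2 < d.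
Proof. by move=> ?; lra. Qed.

Lemma split_lty (R : realType) (a b U W : \bar R) : (0 <= a)%E -> (0 <= W)%E ->
  (b < +oo)%E -> (U < +oo)%E -> (a + 2%:E * W <= b + 2%:E * U)%E -> (W < +oo)%E.
Proof.
move=> a0 W0 boo Uoo h; apply: (@le_lt_trans _ _ (b + 2%:E * U)%E).
  apply: (le_trans _ h); apply: (@le_trans _ _ (2%:E * W)%E); last by rewrite leeDr.
  by rewrite -[X in (X <= _)%E]mul1e lee_wpmul2r// lee_fin ler1n.
apply: (lte_add_pinfty boo).
by apply: lte_mul_pinfty.
Qed.

Lemma quarter_le1 (R : realType) (a b D : \bar R) (e : R) : 0 < e -> (a <= b + (e / 4)%:E)%E ->
  (D <= (e / 8)%:E)%E -> (a + 2%:E * D <= b + e%:E)%E.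
Proof.
move=> e0 ab De; apply: (@le_trans _ _ (b + (e / 4)%:E + 2%:E * (e / 8)%:E)%E).
  by apply: leeD => //; apply: lee_wpmul2l.
by rewrite -addeA leeD2l// -EFinM -EFinD lee_fin; lra.
Qed.

Lemma quarter_le2 (R : realType) (a D : \bar R) (e : R) : 0 < e -> (a <= (e / 4)%:E)%E ->
  (D <= (e / 8)%:E)%E -> (a + D <= e%:E)%E.
Proof.
move=> e0 ae De; apply: (@le_trans _ _ ((e / 4)%:E + (e / 8)%:E)%E); first by apply: leeD.
by rewrite -EFinD lee_fin; lra.
Qed.

Section density.
Context {R : realType} {n : nat}.
Variable s : R.
Hypotheses (n_gt0 : (0 < n)%N) (s01 : 0 < s < 1).
Local Notation Rn := (lebesgueRn R n).
Local Notation Bn := (borelRn R n).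
Local Notation leb := (@lebesgue R n).

Lemma borel_null_ae (N : set Bn) : borel_null N -> {ae leb, forall x, ~ N x}.
Proof.
move=> [mN N0]; exists N; split; first exact: borel_lebesgue_measurable.
  by rewrite -N0; exact: lebesgue_borelE.
by move=> x /= /contrapT.
Qed.

Variable Omega : set 'rV[R]_n.
Hypotheses (oO : open Omega) (bO : bounded_set Omega).
Let s0 : 0 < s. Proof. by case/andP: s01. Qed.
Let C_ne := complement_nonempty n_gt0 bO.
Let mO : measurable (Omega : set Rn). Proof. exact: open_lebesgue. Qed.

Lemma lebesgue_bounded_lty : (leb (Omega : set Rn) < +oo)%E.
Proof.
have [M M0 OM] := bounded_norm bO.
have m1 : 0 < M + 1 by rewrite ltr_wpDl// ltW.
apply: (@le_lt_trans _ _ (leb (box 0 (M + 1) : set Rn))).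
  have mb := measurable_box_lebesgue (0 : 'rV[R]_n) (M + 1).
  apply: (le_measure leb _ _ _); rewrite ?inE; [exact: mO|exact: mb|].
  move=> x Ox; rewrite boxE//; apply: (le_lt_trans (y := M)); last by rewrite ltrDl.
  by rewrite subr0 OM.
exact: (eq_ind_r (fun t => (t < +oo)%E) (ltry _) (lebesgue_box (0 : 'rV[R]_n) m1)).
Qed.

Lemma integral_support (f : Rn -> R) : (forall x, ~ Omega x -> f x = 0) ->
  (\int[leb]_x `|f x|%:E = \int[leb]_(x in (Omega : set Rn)) `|f x|%:E)%E.
Proof.
move=> f0; rewrite [RHS]integral_mkcond; apply: eq_integral => x _.
rewrite patchE; case: ifPn => // /negP xO; rewrite f0 ?normr0// => Ox; apply: xO.
exact/mem_set.
Qed.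

Hypothesis lO : lipschitz_boundary Omega.
Variable v : Rn -> R.
Hypotheses (mv : measurable_fun [set: Rn] v) (v0 : forall x, ~ Omega x -> v x = 0).
Hypothesis Iv : (dint leb Omega Omega (powdiff 1 (fker s 1) v v) < +oo)%E.
Hypothesis kv : (\int[leb]_(x in (Omega : set Rn)) (`|v x|%:E * kappa s Omega 1 x) < +oo)%E.

Let mK := @measurable_frac_kernel R n s 1.
Let K0 (x y : Rn) : 0 <= fker s 1 x y. Proof. exact: frac_kernel_ge0. Qed.
Let mk : measurable_fun [set: Rn] (kappa s Omega 1). Proof. exact: measurable_kappa. Qed.
Let k0 (x : Rn) : (0 <= kappa s Omega 1 x)%E. Proof. exact: kappa_ge0. Qed.

(** Mollification does not increase the seminorm over the whole space, which for
    functions vanishing off Omega is the seminorm over Omega plus twice the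
    kappa-weighted norm; the latter converges because the cutoff keeps the
    supports away from the boundary. *)
Theorem lipschitz_density (e : R) : 0 < e -> exists (w : Rn -> R) (dl L M : R),
  [/\ 0 < dl, measurable_fun [set: Rn] w,
      [/\ forall x y : 'rV[R]_n, `|w x - w y| <= L * `|x - y|,
          forall x, `|w x| <= M & forall x, depth Omega x < dl -> w x = 0],
      (dint leb Omega Omega (powdiff 1 (fker s 1) w w) <=
       dint leb Omega Omega (powdiff 1 (fker s 1) v v) + e%:E)%E &
      (\int[leb]_(x in (Omega : set Rn)) (`|v x - w x|%:E * kappa s Omega 1 x) <= e%:E)%E].
Proof.
move=> e0; have e4 : 0 < e / 4 by rewrite divr_gt0.
have [dl0 dl00 [hI hk]] := cutoff_density n_gt0 s01 oO bO lO mv Iv kv e4.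
pose u := fun x : Rn => cutoff Omega dl0 x * v x.
have mu_ : measurable_fun [set: Rn] u by exact: (measurable_funM (measurable_cut n_gt0 bO dl0) mv).
have u0 x : depth Omega x <= dl0 -> u x = 0.
  move=> xd; have [Ox|nOx] := pselect (Omega x); last by rewrite /u v0 ?mulr0.
  have dx := depth_gt0 n_gt0 oO bO Ox.
  rewrite /u /cutoff max_l ?mul0r// powR_inv1 ?(ltW dx)// subr_le0 ler_pdivlMr// mul1r.
  exact: xd.
have u0' x : ~ Omega x -> u x = 0 by move=> nOx; rewrite /u v0 ?mulr0.
have uv x : `|u x| <= `|v x|.
  have /andP[c0 c1] := cut01 Omega x (ltW dl00).
  by rewrite /u normrM ger0_norm// ler_piMl.
have mwt (f : Rn -> R) : measurable_fun setT f ->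
    measurable_fun (Omega : set Rn) (fun x : Rn => (`|f x|%:E * kappa s Omega 1 x)%E).
  by move=> mf; exact: measurable_weighted.
have w0 (f : Rn -> R) (x : Rn) : (0 <= `|f x|%:E * kappa s Omega 1 x)%E by exact: (mule_ge0 _ (k0 x)).
have [c c0 ck] := kappa_ge n_gt0 s0 oO bO.
have q12 : 1 <= (1 : R) <= 2 by rewrite lexx ler1n.
have iu : (\int[leb]_x `|u x|%:E < +oo)%E.
  rewrite (integral_support u0').
  apply: (le_lt_trans (@integral_le_weighted _ _ _ leb Omega (kappa s Omega 1) mO mk k0 u c mu_ c0
    (fun x Ox => ck 1 x q12 Ox))).
  rewrite lte_mul_pinfty ?lee_fin ?invr_ge0 ?(ltW c0)//.
  apply: (le_lt_trans _ kv).
  apply: (ge0_le_integral leb mO (fun x _ => w0 u x) (mwt u mu_) (mwt v mv)) => x _.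
  by apply: (lee_wpmul2r (k0 x)); rewrite lee_fin.
have [N N0 mu'] := borel_version mu_.
pose u' := fun x : Bn => u x * \1_(~` N) x.
have uu' : {ae leb, forall x, u x = u' x}.
  apply: (ae_mono (borel_null_ae N0)) => x nNx.
  by rewrite /u' indicE mem_set// mulr1.
have mu'R : measurable_fun [set: Rn] (u' : Rn -> R).
  exact: (measurableT_comp mu' measurable_id_borel).
have u'0 x : depth Omega x <= dl0 -> u' x = 0 by move=> /u0 h; rewrite /u' h mul0r.
have u'0' x : ~ Omega x -> u' x = 0 by move=> /u0' h; rewrite /u' h mul0r.
have iu' : (\int[leb]_x `|u' x|%:E < +oo)%E.
  apply: (le_lt_trans _ iu).
  have mn (f : Rn -> R) : measurable_fun setT f -> measurable_fun [set: Rn] (fun x => `|f x|%:E).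
    by move=> mf; apply/measurable_EFinP; exact: (measurableT_comp (@normr_measurable R setT) mf).
  apply: (ge0_le_integral leb measurableT _ (mn _ mu'R) (mn _ mu_)) => [x _|x _]; first by rewrite lee_fin.
  by rewrite lee_fin /u' normrM ler_piMr// indicE normr_nat lern1 leq_b1.
have Ksym (x y : Rn) : fker s 1 x y = fker s 1 y x by exact: frac_kernel_sym.
have N1 := @seminorm_split _ _ _ leb Omega 1 (fker s 1) u (oner_neq0 _) mO mK K0 Ksym mu_ u0'.
have NE : dint leb setT setT (powdiff 1 (fker s 1) u' u') = dint leb setT setT (powdiff 1 (fker s 1) u u).
  have au : {ae leb, forall x, setT x -> u' x = u x} by apply: (ae_mono uu') => x ->.
  exact: (dint_ae_eq 1 measurableT measurableT mK K0 mu'R mu_ mu'R mu_ au au).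
pose U := (\int[leb]_(x in (Omega : set Rn)) (`|u x|%:E * kappa s Omega 1 x))%E.
have pE (f : Rn -> R) : (\int[leb]_(x in (Omega : set Rn)) ((`|f x| `^ 1)%:E * rint leb (~` Omega) (fker s 1 x)) =
    \int[leb]_(x in (Omega : set Rn)) (`|f x|%:E * kappa s Omega 1 x))%E.
  by apply: eq_integral => x _; rewrite powRr1.
rewrite pE -/U in N1.
pose Iu := dint leb Omega Omega (powdiff 1 (fker s 1) u u).
have Iuoo : (Iu < +oo)%E by apply: (le_lt_trans hI); exact: (lte_add_pinfty Iv (ltry _)).
have Uoo : (U < +oo)%E.
  apply: (le_lt_trans _ kv).
  apply: (ge0_le_integral leb mO (fun x _ => w0 u x) (mwt u mu_) (mwt v mv)) => x _.
  by apply: (lee_wpmul2r (k0 x)); rewrite lee_fin.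
have U0 : (0 <= U)%E by apply: integral_ge0 => x _; exact: w0.
have Iu0 : (0 <= Iu)%E by apply: dint_ge0 => z; exact: powdiff_ge0.
have Noo : (dint leb setT setT (powdiff 1 (fker s 1) u' u') < +oo)%E.
  rewrite NE N1; apply: (lte_add_pinfty Iuoo).
  exact: (lte_mul_pinfty _ _ Uoo).
have N0' : (0 <= dint leb setT setT (powdiff 1 (fker s 1) u' u'))%E.
  by apply: dint_ge0 => z; exact: powdiff_ge0.
have [Nr Nr0 NrE] := ge0_lty_real N0' Noo.
have [lr lr0 lrE] := ge0_lty_real (measure_ge0 leb (Omega : set Rn)) lebesgue_bounded_lty.
pose dl := dl0 / 2; have dl_gt0 : 0 < dl by rewrite divr_gt0.
pose Ck := (1 + dl `^ (- s)) * (majorant_cst n s * dl `^ (- s)).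
have Ck0 : 0 <= Ck := far_cst_ge0 dl s (@majorant_cst_ge0 R n s s01).
pose X := Ck * (lr + 2 * n%:R ^+ (n + 2) * Nr).
have X0 : 0 <= X := close_cst_ge0 n Ck0 lr0 Nr0.
(* A scale below half the depth of the support keeps w away from the boundary. *)
have [r /andP[r0 rdl] rX] := small_powR s0 X0 (divr_gt0 e0 (ltr0n R 8)) dl_gt0.
pose w := mollify r u' : Rn -> R.
have mw : measurable_fun [set: Rn] w := measurable_mollify r0 mu'R iu'.
have wd x : depth Omega x < dl -> w x = 0.
  move=> xd; apply: mollify_eq0 => z zx; apply: u'0.
  apply: (le_trans (dist_triangle C_ne z x)).
  rewrite (halfD dl0); exact: (lerD (ltW xd) (ltW (lt_trans zx rdl))).
have w00 x : ~ Omega x -> w x = 0.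
  by move=> nOx; apply: wd; rewrite /depth (dist_eq0 C_ne nOx).
have N2 := @seminorm_split _ _ _ leb Omega 1 (fker s 1) w (oner_neq0 _) mO mK K0 Ksym mw w00.
rewrite pE in N2.
pose W := (\int[leb]_(x in (Omega : set Rn)) (`|w x|%:E * kappa s Omega 1 x))%E.
pose Iw := dint leb Omega Omega (powdiff 1 (fker s 1) w w).
pose D := (\int[leb]_(x in (Omega : set Rn)) (`|u x - w x|%:E * kappa s Omega 1 x))%E.
have W0 : (0 <= W)%E by apply: integral_ge0 => x _; exact: w0.
have Iw0 : (0 <= Iw)%E by apply: dint_ge0 => z; exact: powdiff_ge0.
have D0 : (0 <= D)%E by apply: integral_ge0 => x _; exact: (w0 (fun x => u x - w x)).
have NN := mollify_energy s r0 mu' iu'.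
have h : (Iw + 2%:E * W <= Iu + 2%:E * U)%E.
  rewrite -/w N2 NE N1 in NN; exact: NN.
have Woo : (W < +oo)%E := split_lty Iw0 W0 Iuoo Uoo h.
have UWD : (U <= W + D)%E.
  have c0E (f : Rn -> R) : (\int[leb]_(x in (Omega : set Rn)) (`|f x - cst 0 x|%:E * kappa s Omega 1 x) =
      \int[leb]_(x in (Omega : set Rn)) (`|f x|%:E * kappa s Omega 1 x))%E.
    by apply: eq_integral => x _; rewrite /cst subr0.
  have wt := @weighted_triangle _ _ _ leb _ _ mO mk k0 u w (cst 0) mu_ mw (@measurable_cst _ _ Rn R setT 0).
  rewrite (c0E u) (c0E w) in wt.
  by rewrite addeC; exact: wt.
have Dle : (D <= (e / 8)%:E)%E.
  have du x : u x - w x != 0 -> dl <= depth Omega x.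
    apply: contraNT; rewrite -ltNge => xd; rewrite (wd x xd) u0 ?subr0; first exact: eqxx.
    exact: (ltW (lt_trans xd (half_lt dl00))).
  have ae' : {ae leb, forall x, (Omega : set Rn) x -> u x - w x = u' x - w x}.
    by apply: (ae_mono uu') => x -> _.
  have := weighted_le mO mk k0 (measurable_funB mu_ mw) (measurable_funB mu'R mw) Ck0 ae'
    (fun x _ hx => kappa_far n_gt0 s01 oO bO q12 dl_gt0 (du x hx)).
  move=> /le_trans; apply.
  apply: (@le_trans _ _ (Ck%:E * ((r `^ s)%:E * leb (Omega : set Rn) + (2 * n%:R ^+ (n + 2) * r `^ s)%:E *
       dint leb Omega setT (powdiff 1 (fker s 1) u' u')))%E).
    apply: lee_wpmul2l; [rewrite lee_fin; exact: Ck0|exact: (mollify_close n_gt0 r0 mu'R iu' s01 q12 mO)].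
  apply: (@le_trans _ _ (Ck%:E * ((r `^ s)%:E * lr%:E + (2 * n%:R ^+ (n + 2) * r `^ s)%:E * Nr%:E))%E).
    apply: lee_wpmul2l; first by rewrite lee_fin; exact: Ck0.
    rewrite lrE -NrE; apply: (leeD2l ((r `^ s)%:E * lr%:E)%E); apply: lee_wpmul2l.
      by rewrite lee_fin; exact: close_rate_ge0.
    have mq := measurable_powdiff 1 mK mu'R mu'R.
    have q0 z : (0 <= powdiff 1 (fker s 1) u' u' z)%E by exact: powdiff_ge0.
    have mi := measurable_inner leb mq q0 measurableT measurableT.
    have i0 (x : Rn) : [set: Rn] x -> (0 <= \int[leb]_y powdiff 1 (fker s 1) u' u' (x, y))%E.
      by move=> _; apply: integral_ge0 => y _; exact: q0.
    exact: (@ge0_subset_integral _ _ _ leb (Omega : set Rn) setT mO measurableT _ mi i0 (@subsetT _ _)).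
  rewrite (close_cstE n Ck lr Nr (r `^ s)) lee_fin; exact: rX.
have hh := cancel_weighted W0 Woo D0 Iu0 h UWD.
have wL (x y : 'rV[R]_n) : `|w x - w y| <= norm1 leb u' / @bump_mass R n r * `|x - y|.
  rewrite (div_swap (norm1 leb u')); exact: (@mollify_lip R n r r0 u' mu'R iu' x y).
exists w, dl, (norm1 leb u' / @bump_mass R n r), (2 / r ^+ n * norm1 leb u'); split.
- exact: dl_gt0.
- exact: mw.
- split; [exact: wL|exact: (mollify_bound r0 mu'R iu')|exact: wd].
- apply: (le_trans hh); exact: (quarter_le1 e0 hI Dle).
- apply: (le_trans (@weighted_triangle _ _ _ leb _ _ mO mk k0 v u w mv mu_ mw)).
  exact: (quarter_le2 e0 hk Dle).
Qed.
End density.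

(** * Energies of Lipschitz competitors *)

Lemma cvg_quot (R : realType) (a b p k : nat -> R) (a0 b0 k0 : R) :
  (forall j, 1 <= p j) -> p j @[j --> \oo] --> (1 : R) ->
  a j @[j --> \oo] --> a0 -> b j @[j --> \oo] --> b0 -> k j @[j --> \oo] --> k0 ->
  ((`|a j - b j| `^ p j * k j)%:E @[j --> \oo] --> (`|a0 - b0| `^ 1 * k0)%:E)%E.
Proof.
move=> p1 pc ac bc kc; apply: cvg_EFin; first exact: nearW.
rewrite powRr1//; apply: cvgM => //.
by apply: cvg_powR_to1 => //; exact: (cvg_norm (cvgB ac bc)).
Qed.

Section limits.
Context d (T : measurableType d) {R : realType} (mu : {sigma_finite_measure set T -> \bar R}).
Variables (A : set T) (p : nat -> R) (K_ : nat -> T -> T -> R) (K : T -> T -> R).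
Hypotheses (mA : measurable A) (p1 : forall k, 1 <= p k) (pc : p k @[k --> \oo] --> (1 : R)).
Hypotheses (mK_ : forall k, measurable_fun setT (fun z => K_ k z.1 z.2))
  (mK : measurable_fun setT (fun z => K z.1 z.2)).
Hypotheses (K_0 : forall k x y, 0 <= K_ k x y) (K0 : forall x y, 0 <= K x y)
  (K_cvg : forall x y, A x -> A y -> K_ k x y @[k --> \oo] --> K x y).
Local Open Scope ereal_scope.

Lemma seminorm_fatou (u_ : nat -> T -> R) (u : T -> R) :
  (forall k, measurable_fun setT (u_ k)) -> measurable_fun setT u ->
  (forall x, A x -> u_ k x @[k --> \oo] --> u x) ->
  dint mu A A (powdiff 1 K u u) <= limn_einf (fun k => dint mu A A (powdiff (p k) (K_ k) (u_ k) (u_ k))).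
Proof.
move=> mu_ mu0 uc.
have mq k := measurable_powdiff (p k) (mK_ k) (mu_ k) (mu_ k).
have q0 k z : 0 <= powdiff (p k) (K_ k) (u_ k) (u_ k) z by exact: powdiff_ge0.
have mq' := measurable_powdiff 1 mK mu0 mu0.
have q0' z : 0 <= powdiff 1 K u u z by exact: powdiff_ge0.
have mAA : measurable (A `*` A) by exact: measurableX.
rewrite -(dintE mu mq' q0' mA mA).
have -> : (fun k => dint mu A A (powdiff (p k) (K_ k) (u_ k) (u_ k))) =
    (fun k => \int[mu \x mu]_(z in A `*` A) powdiff (p k) (K_ k) (u_ k) (u_ k) z).
  by apply/funext => k; rewrite (dintE mu (mq k) (q0 k) mA mA).
apply: (fatou_ae mAA (fun k => measurable_funS measurableT (@subsetT _ _) (mq k))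
  (measurable_funS measurableT (@subsetT _ _) mq') (fun k z _ => q0 k z) (fun z _ => q0' z)).
apply: nearW => -[x y] [/= Ax Ay].
have h := cvg_quot p1 pc (uc x Ax) (uc y Ay) (K_cvg Ax Ay).
by have [-> _] := cvg_limn_einf_sup h.
Qed.

Lemma seminorm_cvg (w : T -> R) (G : T * T -> \bar R) :
  measurable_fun setT w -> measurable_fun setT G -> (forall z, 0 <= G z) ->
  (forall k x y, A x -> A y -> powdiff (p k) (K_ k) w w (x, y) <= G (x, y)) ->
  dint mu A A G < +oo ->
  dint mu A A (powdiff (p k) (K_ k) w w) @[k --> \oo] --> dint mu A A (powdiff 1 K w w).
Proof.
move=> mw mG G0 wG iG.
have mq k := measurable_powdiff (p k) (mK_ k) mw mw.
have q0 k z : 0 <= powdiff (p k) (K_ k) w w z by exact: powdiff_ge0.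
have mq' := measurable_powdiff 1 mK mw mw.
have q0' z : 0 <= powdiff 1 K w w z by exact: powdiff_ge0.
apply: (dint_cvg mA mA mq mq' mG q0 q0' G0 wG _ iG) => x y Ax Ay.
exact: (cvg_quot p1 pc (cvg_cst _) (cvg_cst _) (K_cvg Ax Ay)).
Qed.

End limits.

(** The quotients of a Lipschitz function, of all orders p in [1, 2], are
    dominated by one multiple of e^(1-n-s), which is integrable. *)
Lemma lip_quot_le (R : realType) (n : nat) (s p L D e a : R) : 0 < s < 1 -> 1 <= p <= 2 ->
  1 <= L -> 1 <= D -> 0 <= e <= D -> 0 <= a <= L * e ->
  a `^ p * (e `^ (n%:R + s * p))^-1 <= L ^+ 2 * D * (e * (e `^ (n%:R + s * 1))^-1).
Proof.
move=> /andP[s0 s1] /andP[p1 p2] L1 D1 /andP[e0 eD] /andP[a0 aL].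
have p0 : 0 < p by lra.
have L0 : 0 < L by lra.
have D0 : 0 < D by lra.
have := e0; rewrite le_eqVlt => /predU1P[e00|e_gt0].
  move: aL; rewrite -e00 mulr0 => a_le0.
  have -> : a = 0 by apply/eqP; rewrite eq_le a_le0.
  by rewrite powR0 ?gt_eqF// !mul0r mulr0.
apply: (@le_trans _ _ ((L * e) `^ p * (e `^ (n%:R + s * p))^-1)).
  rewrite ler_wpM2r ?invr_ge0 ?powR_ge0//.
  by apply: ge0_ler_powR; rewrite ?nnegrE ?(ltW p0)// mulr_ge0// ltW.
rewrite powRM ?(ltW L0)//.
apply: (@le_trans _ _ (L ^+ 2 * (e `^ p * (e `^ (n%:R + s * p))^-1))).
  rewrite -mulrA; apply: ler_wpM2r; first by rewrite mulr_ge0 ?invr_ge0 ?powR_ge0.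
  by rewrite -powR_mulrn ?(ltW L0)//; apply: ler_powR.
rewrite -[leRHS]mulrA ler_pM2l ?exprn_gt0//.
have ne b : b ==> (e != 0) by rewrite (gt_eqF e_gt0) implybT.
rewrite -!powRN -(powRD (ne _)).
have -> : e * e `^ (- (n%:R + s * 1)) = e `^ (1 - (n%:R + s * 1)).
  by rewrite -{1}(powRr1 e0) -(powRD (ne _)).
have -> : p - (n%:R + s * p) = ((p - 1) * (1 - s)) + (1 - (n%:R + s * 1)) by ring.
rewrite (powRD (ne _)); apply: ler_wpM2r; first exact: powR_ge0.
have q0 : 0 <= (p - 1) * (1 - s) by rewrite mulr_ge0// subr_ge0// ltW.
apply: (@le_trans _ _ (D `^ ((p - 1) * (1 - s)))).
  by rewrite ge0_ler_powR ?nnegrE// ltW.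
rewrite -[leRHS]powRr1 ?(ltW D0)// ler_powR//.
by nra.
Qed.

Section competitor.
Context {R : realType} {n : nat}.
Variable s : R.
Hypotheses (n_gt0 : (0 < n)%N) (s01 : 0 < s < 1).
Local Notation Rn := (lebesgueRn R n).
Local Notation leb := (@lebesgue R n).
Variable Omega : set 'rV[R]_n.
Hypotheses (oO : open Omega) (bO : bounded_set Omega).
Let s0 : 0 < s. Proof. by case/andP: s01. Qed.
Let mO : measurable (Omega : set Rn). Proof. exact: open_lebesgue. Qed.

Let ker (z : Rn * Rn) : \bar R :=
  (enorm ((z.1 : 'rV[R]_n) - (z.2 : 'rV[R]_n)) * fker s 1 z.1 z.2)%:E.

Let mker : measurable_fun setT ker.
Proof.
apply/measurable_EFinP; apply: measurable_funM; last exact: measurable_frac_kernel.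
apply: (@measurable_enorm R n _ (Rn * Rn)%type (fun z : Rn * Rn => (z.1 : 'rV[R]_n) - (z.2 : 'rV[R]_n))).
by move=> i; exact: measurable_coord_sub.
Qed.

Let ker0 z : (0 <= ker z)%E.
Proof. by rewrite lee_fin; apply: mulr_ge0; [exact: sqrtr_ge0|exact: frac_kernel_ge0]. Qed.

Lemma enorm_kernel_le (D : R) (x y : 'rV[R]_n) : 0 < D -> `|x - y| <= D ->
  enorm (x - y) * frac_kernel s 1 x y <= n%:R * D * majorant s D x y.
Proof.
move=> D0 xyD.
have [xy|xy] := eqVneq x y.
  have e0 : enorm (0 : 'rV[R]_n) = 0.
    by apply/eqP; rewrite eq_le sqrtr_ge0 (le_trans (enorm_le _))// normr0 mulr0.
  by rewrite {1}xy subrr e0 mul0r mulr_ge0// ?majorant_ge0// mulr_ge0// ltW.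
have m1 : Num.min 1 (`|x - y| / D) = `|x - y| / D by rewrite min_r// ler_pdivrMr// mul1r.
rewrite /majorant m1.
have -> : n%:R * D * (`|x - y| / D * `|x - y| `^ (- (n%:R + s))) =
    (n%:R * `|x - y|) * `|x - y| `^ (- (n%:R + s)) by field; rewrite gt_eqF.
apply: ler_pM; [exact: sqrtr_ge0|exact: frac_kernel_ge0|exact: enorm_le|].
by have := @frac_kernel_le R n s 1 x y; rewrite mulr1 => /(_ (ltW s0) xy).
Qed.

Lemma enorm_kernel_lty : (dint leb Omega Omega ker < +oo)%E.
Proof.
have [M M0 OM] := bounded_norm bO.
have D0 : 0 < 2 * M by rewrite mulr_gt0.
pose c := n%:R * (2 * M) * (majorant_cst n s * (2 * M) `^ (- s)).
have mi := measurable_inner leb mker ker0 mO mO.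
have i0 (x : Rn) : (Omega : set Rn) x -> (0 <= \int[leb]_(y in (Omega : set Rn)) ker (x, y))%E.
  by move=> _; apply: integral_ge0 => y _; exact: ker0.
apply: (@le_lt_trans _ _ (\int[leb]_(x in (Omega : set Rn)) c%:E)%E); last first.
  have [l l0 lE] := ge0_lty_real (measure_ge0 leb (Omega : set Rn)) (lebesgue_bounded_lty oO bO).
  by rewrite (integral_cst leb mO) lE -EFinM ltry.
apply: (ge0_le_integral leb mO i0 mi (@measurable_cst _ _ Rn _ (Omega : set Rn) c%:E)) => x Ox.
have mm : measurable_fun [set: Rn] (fun y : Rn => (majorant s (2 * M) x y)%:E).
  by apply/measurable_EFinP; exact: measurable_majorant.
have m0 (y : Rn) : [set: Rn] y -> (0 <= (majorant s (2 * M) x y)%:E)%E.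
  by move=> _; rewrite lee_fin; exact: majorant_ge0.
have mmO := measurable_funS measurableT (@subsetT _ (Omega : set Rn)) mm.
have m0O (y : Rn) : (Omega : set Rn) y -> (0 <= (majorant s (2 * M) x y)%:E)%E.
  by move=> _; exact: m0.
have a0 : (0 <= (n%:R * (2 * M))%:E)%E by rewrite lee_fin mulr_ge0// ltW.
apply: (@le_trans _ _ ((n%:R * (2 * M))%:E * \int[leb]_(y in (Omega : set Rn)) (majorant s (2 * M) x y)%:E)%E); last first.
  rewrite /c (EFinM (n%:R * (2 * M))); apply: (lee_wpmul2l a0); apply: (le_trans _ (integral_majorant x s01 D0)).
  exact: (@ge0_subset_integral _ _ _ leb (Omega : set Rn) setT mO measurableT _ mm m0 (@subsetT _ _)).
rewrite -(ge0_integralZl leb mO mmO m0O a0).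
have mamO : measurable_fun (Omega : set Rn) (fun y : Rn => ((n%:R * (2 * M))%:E * (majorant s (2 * M) x y)%:E)%E).
  exact: measurable_funeM.
have mkx : measurable_fun (Omega : set Rn) (fun y : Rn => ker (x, y)).
  exact: (measurable_funS measurableT (@subsetT _ _) (measurableT_comp mker (measurable_pair1 x))).
apply: (ge0_le_integral leb mO (fun y _ => ker0 (x, y)) mkx mamO) => y Oy.
rewrite -EFinM lee_fin; apply: enorm_kernel_le => //.
by rewrite (le_trans (ler_normB _ _))// mulrDl mul1r lerD// OM.
Qed.

Variable (p : nat -> R).
Hypotheses (p12 : forall k, 1 <= p k <= 2) (pc : p k @[k --> \oo] --> (1 : R)).
Variables (w : Rn -> R) (L M dl : R).
Hypotheses (mw : measurable_fun [set: Rn] w) (dl0 : 0 < dl).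
Hypotheses (wL : forall x y : 'rV[R]_n, `|w x - w y| <= L * `|x - y|).
Hypotheses (wM : forall x, `|w x| <= M) (wd : forall x, depth Omega x < dl -> w x = 0).

Lemma lip_quot_dominated : exists2 c : R, 0 <= c & forall q (x y : Rn), 1 <= q <= 2 ->
  Omega x -> Omega y -> (powdiff q (fker s q) w w (x, y) <= c%:E * ker (x, y))%E.
Proof.
have [N N0 ON] := bounded_norm bO.
pose L' := `|L| + 1; pose D := n%:R * (2 * N) + 1.
have L1 : 1 <= L' by rewrite lerDr.
have D1 : 1 <= D by rewrite lerDr mulr_ge0// mulr_ge0// ltW.
exists (L' ^+ 2 * D).
  by apply: mulr_ge0; [exact: sqr_ge0|exact: le_trans ler01 D1].
move=> q x y q12 Ox Oy; rewrite /powdiff /ker -EFinM lee_fin; apply: lip_quot_le => //.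
  rewrite sqrtr_ge0/= (le_trans (enorm_le _))// /D ler_wpDr// ler_wpM2l//.
  by rewrite (le_trans (ler_normB _ _))// mulrDl mul1r lerD// ON.
rewrite normr_ge0/= (le_trans (wL x y))//.
apply: (@le_trans _ _ (L' * `|(x : 'rV[R]_n) - y|)).
  by rewrite ler_wpM2r// (le_trans (ler_norm _))// lerDl.
by rewrite ler_wpM2l ?(le_trans ler01 L1)// enorm_ge.
Qed.

Lemma dint_cker_lty (c : R) : 0 <= c -> (dint leb Omega Omega (fun z => c%:E * ker z) < +oo)%E.
Proof.
move=> c0; have c0' : (0 <= c%:E)%E by rewrite lee_fin.
have mi := measurable_inner leb mker ker0 mO mO.
have i0 (x : Rn) : (Omega : set Rn) x -> (0 <= \int[leb]_(y in (Omega : set Rn)) ker (x, y))%E.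
  by move=> _; apply: integral_ge0 => y _; exact: ker0.
have -> : dint leb Omega Omega (fun z => c%:E * ker z)%E = (c%:E * dint leb Omega Omega ker)%E.
  rewrite /dint -(ge0_integralZl leb mO mi i0 c0'); apply: eq_integral => x _.
  have mkx : measurable_fun (Omega : set Rn) (fun y : Rn => ker (x, y)).
    exact: (measurable_funS measurableT (@subsetT _ _) (measurableT_comp mker (measurable_pair1 x))).
  exact: (ge0_integralZl leb mO mkx (fun y _ => ker0 (x, y)) c0').
exact: (lte_mul_pinfty c0' (erefl : c%:E \is a fin_num) enorm_kernel_lty).
Qed.

Lemma lip_seminorm_lty : (dint leb Omega Omega (powdiff 1 (fker s 1) w w) < +oo)%E.
Proof.
have [c c0 cP] := lip_quot_dominated.
have mG : measurable_fun setT (fun z => c%:E * ker z)%E by exact: measurable_funeM.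
have mq := measurable_powdiff 1 (@measurable_frac_kernel R n s 1) mw mw.
have q0 z : (0 <= powdiff 1 (fker s 1) w w z)%E by apply: powdiff_ge0 => x y; exact: frac_kernel_ge0.
have q12 : 1 <= (1 : R) <= 2 by rewrite lexx ler1n.
apply: (le_lt_trans _ (dint_cker_lty c0)).
have le (x y : Rn) : (Omega : set Rn) x -> (Omega : set Rn) y ->
    (powdiff 1 (fker s 1) w w (x, y) <= c%:E * ker (x, y))%E.
  by move=> Ox Oy; exact: (cP 1 x y q12 Ox Oy).
exact: (@le_dint _ _ _ leb Omega Omega _ (fun z => c%:E * ker z)%E mO mO mq mG q0 le).
Qed.

Lemma lip_seminorm_cvg :
  dint leb Omega Omega (powdiff (p k) (fker s (p k)) w w) @[k --> \oo] -->
  dint leb Omega Omega (powdiff 1 (fker s 1) w w).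
Proof.
have [c c0 cP] := lip_quot_dominated.
have c0' : (0 <= c%:E)%E by rewrite lee_fin.
have p1 k : 1 <= p k by have /andP[] := p12 k.
have K_cvg (x y : Rn) : (Omega : set Rn) x -> (Omega : set Rn) y ->
    fker s (p k) x y @[k --> \oo] --> fker s 1 x y.
  by move=> _ _; exact: cvg_frac_kernel.
have mG : measurable_fun setT (fun z => c%:E * ker z)%E by exact: measurable_funeM.
exact: (@seminorm_cvg _ _ _ leb Omega p (fun k => fker s (p k)) (fker s 1) mO p1 pc
  (fun k => @measurable_frac_kernel R n s (p k)) (@measurable_frac_kernel R n s 1)
  (fun k x y => frac_kernel_ge0 s (p k) x y) (fun x y => frac_kernel_ge0 s 1 x y) K_cvg w
  (fun z => c%:E * ker z)%E mw mG (fun z => mule_ge0 c0' (ker0 z))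
  (fun k x y Ox Oy => cP (p k) x y (p12 k) Ox Oy) (dint_cker_lty c0)).
Qed.

(** The weight kappa blows up only at the boundary, where w vanishes. *)
Lemma competitor_weight : exists2 h : R, 0 <= h & forall q x, 1 <= q <= 2 -> Omega x ->
  ((2 * `|w x| `^ q)%:E * kappa s Omega q x <= h%:E)%E.
Proof.
pose c := (1 + dl `^ (- s)) * (majorant_cst n s * dl `^ (- s)).
have c0 : 0 <= c := far_cst_ge0 dl s (@majorant_cst_ge0 R n s s01).
have h0 : 0 <= 2 * (`|M| + 1) ^+ 2 :> R.
  by apply: mulr_ge0; [exact: ler0n|exact: sqr_ge0].
exists (2 * (`|M| + 1) ^+ 2 * c); first exact: mulr_ge0.
move=> q x q12 Ox; have /andP[q1 q2] := q12.
have [xd|xd] := ltP (depth Omega x) dl.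
  rewrite (wd xd) normr0 powR0; last by rewrite gt_eqF// (lt_le_trans ltr01).
  by rewrite mulr0 mul0e lee_fin; exact: mulr_ge0.
rewrite [X in (_ <= X)%E]EFinM; apply: lee_pmul.
- by rewrite lee_fin; apply: mulr_ge0; [exact: ler0n|exact: powR_ge0].
- exact: kappa_ge0.
- rewrite lee_fin; apply: ler_wpM2l; first exact: ler0n.
  have M1 : 1 <= `|M| + 1 by rewrite lerDr.
  rewrite -powR_mulrn ?(le_trans ler01)//; apply: (@le_trans _ _ ((`|M| + 1) `^ q)); last exact: ler_powR.
  have wM' : `|w x| <= `|M| + 1.
    by rewrite (le_trans (wM x))// (le_trans (ler_norm _))// lerDl.
  exact: (ge0_ler_powR (le_trans ler01 q1) (normr_ge0 (w x)) (le_trans ler01 M1) wM').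
- exact: (kappa_far n_gt0 s01 oO bO q12 dl0 xd).
Qed.

End competitor.

(** * Compactness *)

Section ultrafilters.
Context {R : realType}.

Lemma ultra_fmap (T S : Type) (f : T -> S) (U : set_system T) :
  UltraFilter U -> UltraFilter [set A | U (f @^-1` A)].
Proof.
move=> UU; have PF : ProperFilter [set A | U (f @^-1` A)] by exact: fmap_proper_filter.
split => // G GF UG; rewrite predeqE => A; split; last exact: UG.
move=> GA; have [//|UnA] := in_ultra_setVsetC (f @^-1` A) UU.
have GnA : G (~` A) by apply: UG.
by have /filter_ex [? []] : G (A `&` (~` A)) by exact: filterI.
Qed.

Lemma ultra_cvg_bounded (U : set_system nat) (w : nat -> R) (B : R) :
  UltraFilter U -> (forall k, `|w k| <= B) -> exists l : R, w k @[k --> U] --> l.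
Proof.
move=> UU wB.
have cB : compact (`[- B, B]%classic : set R) by exact: segment_compact.
rewrite compact_ultra in cB.
have [|l [_ wl]] := cB _ (ultra_fmap w UU); last by exists l.
have UF : ProperFilter U by exact: ultra_proper.
by apply: (@filterS _ U _ setT) filterT => k _ /=; rewrite in_itv/= -ler_norml.
Qed.

Lemma ultra_frechet : exists2 U : set_system nat, UltraFilter U & \oo `<=` U.
Proof. by have [U [UU sU]] := ultraFilterLemma (F := \oo) _; exists U. Qed.

(** Equicontinuous bounded functions on a compact set are Cauchy along any
    ultrafilter, uniformly: this is the Arzela-Ascoli theorem. *)
Lemma ultra_uniform_cauchy (V : normedModType R) (C : set V) (U : set_system nat)
    (w : nat -> V -> R) (L B e : R) :
  UltraFilter U -> compact C -> (forall k x, `|w k x| <= B) ->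
  (forall k x y, `|w k x - w k y| <= L * `|x - y|) -> 0 < e ->
  exists2 S, U S & forall k l x, S k -> S l -> C x -> `|w k x - w l x| <= e.
Proof.
move=> UU /compact_near_coveringP nc wB wL e0.
have L0 : 0 < `|L| + 1 by rewrite ltr_wpDl.
have d0 : 0 < e / 4 / (`|L| + 1) by rewrite !divr_gt0.
have UF : ProperFilter U by exact: ultra_proper.
have UUF : Filter (filter_prod U U) by exact: filter_prod_filter.
have [x Cx|[S S'] /= [US US'] SP] := nc (nat * nat)%type (filter_prod U U)
    (fun kl x => `|w kl.1 x - w kl.2 x| <= e) UUF; last first.
  exists (S `&` S'); first exact: filterI.
  move=> k l x [Sk _] [_ Sl] Cx.
  exact: (SP (k, l) (conj Sk Sl) x Cx).
have [l wl] := ultra_cvg_bounded UU (wB^~ x).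
have e4 : 0 < e / 4 by rewrite divr_gt0.
have US : U [set k | `|l - w k x| < e / 4].
  by move/cvgrPdist_lt : wl => /(_ _ e4).
exists ([set y | `|x - y| < e / 4 / (`|L| + 1)],
  [set k | `|l - w k x| < e / 4] `*` [set k | `|l - w k x| < e / 4]).
  split => /=.
    by apply/nbhs_ballP; exists (e / 4 / (`|L| + 1)) => // y; rewrite -ball_normE.
  by exists ([set k | `|l - w k x| < e / 4], [set k | `|l - w k x| < e / 4]).
move=> [y [k j]] /= [xy [kx jx]].
have wy i : `|w i x - w i y| <= e / 4.
  apply: (le_trans (wL i x y)); apply: (@le_trans _ _ ((`|L| + 1) * `|x - y|)).
    by rewrite ler_wpM2r// (le_trans (ler_norm _))// lerDl.
  by rewrite mulrC -ler_pdivlMr// ltW.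
have := wy k; have := wy j; move: kx jx.
rewrite !ltr_norml !ler_norml => /andP[? ?] /andP[? ?] /andP[? ?] /andP[? ?].
by apply/andP; split; lra.
Qed.

(** Finite intersections of members of the ultrafilter are infinite, which
    allows to choose the indices k one after the other. *)
Lemma ultra_extract (U : set_system nat) (D : nat -> nat -> \bar R) :
  UltraFilter U -> \oo `<=` U ->
  (forall e, 0 < e -> exists2 S, U S & forall k l, S k -> S l -> (D k l <= e%:E)%E) ->
  exists2 k : nat -> nat, {homo k : i j / (i < j)%N} &
    forall i j, (i <= j)%N -> (D (k i) (k j) <= ((2^-1) ^+ i)%:E)%E.
Proof.
move=> UU ooU H.
have UF : ProperFilter U by exact: ultra_proper.
have h0 i : 0 < (2^-1 : R) ^+ i by rewrite exprn_gt0// invr_gt0.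
have H' i : exists S, U S /\ forall k l, S k -> S l -> (D k l <= ((2^-1) ^+ i)%:E)%E.
  by have [S US SP] := H _ (h0 i); exists S.
have [S SP] := choice H'.
pose T i := \bigcap_(j in [set j | (j <= i)%N]) S j.
have UT i : U (T i).
  elim: i => [|i IH].
    by apply: filterS (SP 0%N).1 => x Sx j /=; rewrite leqn0 => /eqP ->.
  apply: filterS (filterI IH (SP i.+1).1) => x [Tx Sx] j /=.
  by rewrite leq_eqVlt => /predU1P[->//|]; rewrite ltnS => /Tx.
have next N i : exists m, T i m /\ (N < m)%N.
  have UN : U [set m | (N < m)%N] by apply: ooU; exists N.+1.
  by have [m [Tm Nm]] := filter_ex (filterI (UT i) UN); exists m.
have [f fP] := choice (fun Ni => next Ni.1 Ni.2).
pose k := fix k i := if i is j.+1 then f (k j, j.+1) else f (0%N, 0%N).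
have kT i : T i (k i) by case: i => [|i]; [exact: (fP (0%N, 0%N)).1|exact: (fP (k i, i.+1)).1].
have kS i : (k i < k i.+1)%N by exact: (fP (k i, i.+1)).2.
exists k.
  by apply: homo_ltn => //; exact: ltn_trans.
by move=> i j ij; apply: (SP i).2; [exact: (kT i i (leqnn i))|exact: (kT j i ij)].
Qed.

End ultrafilters.

Section fast_cauchy.
Context d (T : measurableType d) {R : realType} (mu : {measure set T -> \bar R}).
Variables (A : set T) (v : nat -> T -> R).
Hypotheses (mA : measurable A) (mv : forall j, measurable_fun A (v j)).
Hypothesis vc : forall i j, (i <= j)%N ->
  (\int[mu]_(x in A) `|v i x - v j x|%:E <= ((2^-1) ^+ i)%:E)%E.

(** The distances are summable, so the sum of the increments is integrable,
    hence finite almost everywhere. *)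
Lemma fast_cauchy_ae : {ae mu, forall x, A x -> cvgn (v ^~ x)}.
Proof.
pose F j x := (`|v j.+1 x - v j x|)%:E.
have F0 j x : A x -> (0 <= F j x)%E by rewrite /F lee_fin.
have mF j : measurable_fun A (F j).
  apply/measurable_EFinP; apply: (measurableT_comp (@normr_measurable R setT)).
  exact: measurable_funB.
have i2 : (0 : R) < 2^-1 by rewrite invr_gt0.
have i21 : `|2^-1 : R| < 1 by rewrite gtr0_norm// invf_lt1// ltr1n.
have iF : (\int[mu]_(x in A) (\sum_(j <oo) F j x) < +oo)%E.
  rewrite (integral_nneseries mu mA mF F0).
  apply: (@le_lt_trans _ _ (1 / (1 - 2^-1))%:E); last by rewrite ltry.
  have cv : cvgn (fun k => \sum_(0 <= j < k) (\int[mu]_(x in A) F j x))%E.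
    by apply: is_cvg_nneseries => i _ _; apply: integral_ge0 => x; exact: F0.
  apply: (lime_le cv); apply: nearW => m.
  apply: (@le_trans _ _ (\sum_(0 <= j < m) ((2^-1) ^+ j)%:E)%E).
    apply: lee_sum => j _; apply: le_trans (vc (leqnSn j)).
    by rewrite le_eqVlt; apply/orP; left; apply/eqP; apply: eq_integral => x _; rewrite /F distrC.
  rewrite sumEFin lee_fin.
  have := @geometric_le_lim R m 1 2^-1 ler01 i2 i21.
  by rewrite /series/=; under eq_bigr do rewrite mul1r.
have mS : measurable_fun A (fun x => \sum_(j <oo) F j x)%E.
  by apply: ge0_emeasurable_sum => // j x Ax _; exact: F0.
have S0 x : A x -> (0 <= \sum_(j <oo) F j x)%E.
  by move=> Ax; apply: nneseries_ge0 => j _ _; exact: F0.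
have iS : mu.-integrable A (fun x => \sum_(j <oo) F j x)%E.
  apply/integrableP; split => //.
  under eq_integral => x /set_mem Ax do rewrite gee0_abs ?S0//.
  exact: iF.
apply: filterS (integrable_ae mA iS) => x fx Ax; have := fx Ax => {}fx.
have cs : cvgn [normed series (telescope (v ^~ x))].
  apply: nondecreasing_is_cvgn.
    by apply: nondecreasing_series => i _ _; exact: normr_ge0.
  exists (fine (\sum_(j <oo) F j x)%E) => _ [m _ <-].
  rewrite -lee_fin fineK// /series/= -sumEFin.
  exact: (nneseries_lim_ge m (fun j _ _ => F0 j x Ax)).
have := normed_cvg cs.
rewrite telescopeK => c.
have -> : (v ^~ x) = (fun j => (v j x - v 0%N x) + v 0%N x) by apply/funext => j; rewrite subrK.
by apply: is_cvgD => //; exact: is_cvg_cst.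
Qed.

(** Fatou's lemma in the second index of the Cauchy estimate. *)
Lemma fast_cauchy_L1 (u : T -> R) : measurable_fun A u ->
  {ae mu, forall x, A x -> v j x @[j --> \oo] --> u x} ->
  (\int[mu]_(x in A) `|v j x - u x|%:E)%E @[j --> \oo] --> 0%E.
Proof.
move=> mu_ vu.
have mn (f g : T -> R) : measurable_fun A f -> measurable_fun A g ->
    measurable_fun A (fun x => `|f x - g x|%:E).
  move=> mf mg; apply/measurable_EFinP; apply: (measurableT_comp (@normr_measurable R setT)).
  exact: measurable_funB.
have le i : (\int[mu]_(x in A) `|v i x - u x|%:E <= ((2^-1) ^+ i)%:E)%E.
  have fa : {ae mu, forall x, A x -> (`|v i x - u x|%:E <=
      limn_einf (fun j => `|v i x - v (i + j)%N x|%:E))%E}.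
    apply: filterS vu => x vx Ax.
    have c : (`|v i x - v (i + j)%N x|%:E @[j --> \oo] --> `|v i x - u x|%:E)%E.
      apply: cvg_EFin; first exact: nearW.
      apply: cvg_norm; apply: cvgB; first exact: cvg_cst.
      by have := vx Ax; rewrite -(cvg_shiftn i); under eq_fun do rewrite addnC.
    by have [-> _] := cvg_limn_einf_sup c.
  apply: (le_trans (fatou_ae mA (fun j => mn _ _ (mv i) (mv (i + j)%N)) (mn _ _ (mv i) mu_) _ _ fa)).
  - by [].
  - by [].
  - by apply: limn_einf_le_cst => j; apply: vc; exact: leq_addr.
have i21 : `|2^-1 : R| < 1 by rewrite gtr0_norm ?invr_gt0// invf_lt1// ltr1n.
apply: (@squeeze_cvge _ _ _ _ (cst 0%E) _ (fun i => ((2^-1) ^+ i)%:E)).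
- by apply: nearW => i; rewrite le /cst integral_ge0.
- exact: cvg_cst.
- by apply: cvg_EFin; [exact: nearW|exact: cvg_expr].
Qed.

End fast_cauchy.

Section L1_comparison.
Context d (T : measurableType d) {R : realType} (mu : {measure set T -> \bar R}).
Local Open Scope ereal_scope.

Lemma L1_triangle3 (A : set T) (f g f' g' : T -> R) : measurable A ->
  measurable_fun setT f -> measurable_fun setT g ->
  measurable_fun setT f' -> measurable_fun setT g' ->
  \int[mu]_(x in A) `|f x - g x|%:E <= \int[mu]_(x in A) `|f x - f' x|%:E +
    (\int[mu]_(x in A) `|f' x - g' x|%:E + \int[mu]_(x in A) `|g x - g' x|%:E).
Proof.
move=> mA mf mg mf' mg'.
have mn (a b : T -> R) : measurable_fun setT a -> measurable_fun setT b ->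
    measurable_fun A (fun x => `|a x - b x|%:E).
  move=> ma mb; apply/measurable_EFinP; apply: (measurable_funS measurableT (@subsetT _ A)).
  by apply: (measurableT_comp (@normr_measurable R setT)); exact: measurable_funB.
have n0 (a b : T -> R) x : A x -> 0 <= `|a x - b x|%:E by rewrite lee_fin.
rewrite -(ge0_integralD mu mA (n0 f' g') (mn _ _ mf' mg') (n0 g g') (mn _ _ mg mg')).
rewrite -(ge0_integralD mu mA (n0 f f') (mn _ _ mf mf')); first last.
- by apply: emeasurable_funD; exact: mn.
- by move=> x Ax; apply: adde_ge0; exact: n0.
apply: (ge0_le_integral mu mA (n0 f g) (mn _ _ mf mg)).
  by apply: emeasurable_funD; [exact: mn|apply: emeasurable_funD; exact: mn].
move=> x _; rewrite -!EFinD lee_fin.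
have -> : (f x - g x = (f x - f' x) + ((f' x - g' x) - (g x - g' x)))%R by ring.
by rewrite (le_trans (ler_normD _ _))// lerD2l ler_normB.
Qed.

Lemma L1_uniform (A : set T) (f g : T -> R) (e : R) : measurable A ->
  measurable_fun setT f -> measurable_fun setT g -> (0 <= e)%R ->
  (forall x, A x -> (`|f x - g x| <= e)%R) ->
  \int[mu]_(x in A) `|f x - g x|%:E <= e%:E * mu A.
Proof.
move=> mA mf mg e0 fg; rewrite -(integral_cst mu mA).
have mn : measurable_fun A (fun x => `|f x - g x|%:E).
  apply/measurable_EFinP; apply: (measurable_funS measurableT (@subsetT _ A)).
  by apply: (measurableT_comp (@normr_measurable R setT)); exact: measurable_funB.
have n0 x : A x -> 0 <= `|f x - g x|%:E by rewrite lee_fin.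
apply: (ge0_le_integral mu mA n0 mn (@measurable_cst _ _ _ _ A e%:E)) => x Ax.
by rewrite lee_fin; exact: fg.
Qed.

End L1_comparison.

Lemma four_quarters (R : realType) (a b c : \bar R) (e : R) : (a <= (e / 4)%:E)%E ->
  (b <= (e / 2)%:E)%E -> (c <= (e / 4)%:E)%E -> (a + (b + c) <= e%:E)%E.
Proof.
move=> ha hb hc; apply: (@le_trans _ _ ((e / 4)%:E + ((e / 2)%:E + (e / 4)%:E))%E).
  by apply: leeD => //; exact: leeD.
by rewrite -!EFinD lee_fin le_eqVlt; apply/orP; left; apply/eqP; field.
Qed.

Lemma uniform_cst (R : realType) (e l : R) : 0 < e -> 0 <= l ->
  0 < e / (2 * (l + 1)) /\ e / (2 * (l + 1)) * l <= e / 2.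
Proof.
move=> e0 l0; have l1 : 0 < l + 1 by rewrite ltr_wpDl.
have l2 : 0 < 2 * (l + 1) by rewrite mulr_gt0.
split; first exact: divr_gt0.
rewrite mulrAC ler_pdivrMr//.
have -> : e / 2 * (2 * (l + 1)) = e * (l + 1) by field.
by rewrite ler_wpM2l ?(ltW e0)// lerDl.
Qed.

Section compactness.
Context {R : realType} {n : nat}.
Variable s : R.
Hypotheses (n_gt0 : (0 < n)%N) (s01 : 0 < s < 1).
Local Notation Rn := (lebesgueRn R n).
Local Notation leb := (@lebesgue R n).
Variable Omega : set 'rV[R]_n.
Hypotheses (oO : open Omega) (bO : bounded_set Omega).
Let s0 : 0 < s. Proof. by case/andP: s01. Qed.
Let mO : measurable (Omega : set Rn). Proof. exact: open_lebesgue. Qed.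

Variables (p : nat -> R) (v : nat -> Rn -> R) (B : R).
Hypotheses (p12 : forall k, 1 <= p k <= 2).
Hypotheses (mv : forall k, measurable_fun [set: Rn] (v k)).
Hypothesis v0 : forall k x, ~ Omega x -> v k x = 0.
Hypothesis vB : forall k, (\int[leb]_(x in (Omega : set Rn)) `|v k x|%:E <= B%:E)%E.
Hypothesis NB : forall k,
  (dint leb setT setT (powdiff (p k) (fker s (p k)) (v k) (v k)) <= B%:E)%E.

Let iv k : (\int[leb]_x `|v k x|%:E < +oo)%E.
Proof. by rewrite (integral_support (v0 k)); apply: (le_lt_trans (vB k)); exact: ltry. Qed.

Let B0 : 0 <= B.
Proof. by rewrite -lee_fin; apply: (le_trans _ (vB 0%N)); apply: integral_ge0 => x _; rewrite lee_fin. Qed.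

Let norm1B k : norm1 leb (v k) <= B.
Proof.
have i0 : (0 <= \int[leb]_x `|v k x|%:E)%E by apply: integral_ge0 => x _; rewrite lee_fin.
have [b b0 bE] := ge0_lty_real i0 (iv k).
rewrite /norm1 bE -lee_fin /= -bE (integral_support (v0 k)); exact: vB.
Qed.

Let close (r : R) k : 0 < r -> (\int[leb]_(x in (Omega : set Rn)) `|v k x - mollify r (v k) x|%:E <=
  (r `^ s)%:E * leb (Omega : set Rn) + (2 * n%:R ^+ (n + 2) * r `^ s)%:E * B%:E)%E.
Proof.
move=> r0; apply: (le_trans (mollify_close n_gt0 r0 (mv k) (iv k) s01 (p12 k) mO)).
apply: leeD; first exact: lexx.
apply: lee_wpmul2l; first by rewrite lee_fin; exact: close_rate_ge0.
apply: (le_trans _ (NB k)).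
have mK := @measurable_frac_kernel R n s (p k).
have mq := measurable_powdiff (p k) mK (mv k) (mv k).
have K0 (x y : Rn) : 0 <= fker s (p k) x y by exact: frac_kernel_ge0.
have q0 z : (0 <= powdiff (p k) (fker s (p k)) (v k) (v k) z)%E by exact: powdiff_ge0.
have mi := measurable_inner leb mq q0 measurableT measurableT.
have i0 (x : Rn) : [set: Rn] x -> (0 <= \int[leb]_y powdiff (p k) (fker s (p k)) (v k) (v k) (x, y))%E.
  by move=> _; apply: integral_ge0 => y _; exact: q0.
exact: (@ge0_subset_integral _ _ _ leb (Omega : set Rn) setT mO measurableT _ mi i0 (@subsetT _ _)).
Qed.

(** Mollifying at a fixed scale makes the sequence precompact in the uniform
    norm, and costs in L^1 a power of the scale times the seminorm, uniformly
    in the exponent. *)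
Theorem seminorm_compactness : exists2 k : nat -> nat, {homo k : i j / (i < j)%N} &
  forall i j, (i <= j)%N ->
    (\int[leb]_(x in (Omega : set Rn)) `|v (k i) x - v (k j) x|%:E <= ((2^-1) ^+ i)%:E)%E.
Proof.
have [U UU ooU] := ultra_frechet.
apply: (@ultra_extract R U (fun i j => \int[leb]_(x in (Omega : set Rn)) `|v i x - v j x|%:E)%E UU ooU).
move=> e e0.
have [lr lr0 lrE] := ge0_lty_real (measure_ge0 leb (Omega : set Rn)) (lebesgue_bounded_lty oO bO).
have X0 := close_cst_ge0 n (@ler01 R) lr0 B0.
have [r /andP[r0 _] rX] := small_powR s0 X0 (divr_gt0 e0 (ltr0n R 4)) (@ltr01 R).
have cl k : (\int[leb]_(x in (Omega : set Rn)) `|v k x - mollify r (v k) x|%:E <= (e / 4)%:E)%E.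
  apply: (le_trans (close k r0)); rewrite lrE.
  have := close_cstE n 1 lr B (r `^ s); rewrite mul1e => ->; rewrite lee_fin; exact: rX.
have [t0 tl] := uniform_cst e0 lr0.
have mw k : measurable_fun [set: Rn] (mollify r (v k)) := measurable_mollify r0 (mv k) (iv k).
have bm : 0 < @bump_mass R n r by exact: bump_mass_gt0.
have wL k (x y : 'rV[R]_n) : `|mollify r (v k) x - mollify r (v k) y| <= B / @bump_mass R n r * `|x - y|.
  rewrite (div_swap B); apply: (le_trans (mollify_lip r0 (mv k) (iv k) x y)).
  apply: ler_wpM2l; last exact: norm1B.
  by apply: divr_ge0; [exact: normr_ge0|exact: ltW].
have wB k (x : 'rV[R]_n) : `|mollify r (v k) x| <= 2 / r ^+ n * B.
  apply: (le_trans (mollify_bound r0 (mv k) (iv k) x)).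
  apply: ler_wpM2l; last exact: norm1B.
  by apply: divr_ge0; [exact: ler0n|rewrite exprn_ge0// ltW].
have [S US SP] := ultra_uniform_cauchy UU (compact_closure bO) wB wL t0.
exists S => // k l Sk Sl.
apply: (le_trans (@L1_triangle3 _ _ _ leb _ _ _ (mollify r (v k)) (mollify r (v l)) mO (mv k) (mv l) (mw k) (mw l))).
apply: four_quarters; [exact: cl| |exact: cl].
have U1 (x : Rn) : (Omega : set Rn) x -> `|mollify r (v k) x - mollify r (v l) x| <= e / (2 * (lr + 1)).
  by move=> Ox; apply: SP => //; exact: subset_closure.
apply: (le_trans (L1_uniform leb mO (mw k) (mw l) (ltW t0) U1)).
by rewrite lrE -EFinM lee_fin.
Qed.

End compactness.

(** * Interactions with the exterior *)

Section interactions.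
Context d (T : measurableType d) {R : realType} (mu : {sigma_finite_measure set T -> \bar R}).
Local Open Scope ereal_scope.
Variables (A C : set T) (K : T -> T -> R).
Hypotheses (mA : measurable A) (mC : measurable C).
Hypotheses (mK : measurable_fun setT (fun z => K z.1 z.2)) (K0 : forall x y, (0 <= K x y)%R).
Implicit Types u v w : T -> R.

Definition gtail p u x := rint mu C (fun y => `|u y| `^ p * K x y)%R.

Lemma gtailE p u x : gtail p u x = \int[mu]_(y in C) powdiff p K (cst 0%R) u (x, y).
Proof. by apply: eq_integral => y _; rewrite /powdiff/= sub0r normrN. Qed.

Lemma measurable_gtail p u : measurable_fun setT u -> measurable_fun setT (gtail p u).
Proof.
move=> mu_; have m := measurable_powdiff p mK (@measurable_cst _ _ T R setT 0%R) mu_.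
have q0 z : 0 <= powdiff p K (cst 0%R) u z by exact: powdiff_ge0.
rewrite (_ : gtail p u = fun x => \int[mu]_(y in C) powdiff p K (cst 0%R) u (x, y)).
  exact: (measurable_inner mu m q0 measurableT mC).
by apply/funext => x; exact: gtailE.
Qed.

Lemma gtail_ge0 p u x : 0 <= gtail p u x.
Proof. by apply: integral_ge0 => y _; rewrite lee_fin mulr_ge0// powR_ge0. Qed.

Let msec (f : T * T -> \bar R) x : measurable_fun setT f -> measurable_fun C (fun y => f (x, y)).
Proof.
move=> mf; apply: (measurable_funS measurableT (@subsetT _ C)).
exact: (measurableT_comp mf (measurable_pair1 x)).
Qed.

Let mKE x : measurable_fun C (EFin \o K x).
Proof. exact: (msec (f := fun z => (K z.1 z.2)%:E) x ((measurable_EFinP _ _).2 mK)). Qed.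

Let mkap : measurable_fun A (fun x => rint mu C (K x)).
Proof.
have mKE' : measurable_fun setT (fun z : T * T => (K z.1 z.2)%:E) by exact/measurable_EFinP.
have k0 (z : T * T) : 0 <= (K z.1 z.2)%:E by rewrite lee_fin.
exact: (measurable_inner mu mKE' k0 mA mC).
Qed.

Let kap0 x : 0 <= rint mu C (K x).
Proof. by apply: integral_ge0 => y _; rewrite lee_fin. Qed.

(** |u x|^p is at most 2 (|u x - u y|^p + |u y|^p), integrated against K. *)
Lemma weighted_le_interaction p u : (1 <= p <= 2)%R -> measurable_fun setT u ->
  \int[mu]_(x in A) ((`|u x| `^ p)%:E * rint mu C (K x)) <=
  2%:E * (dint mu A C (powdiff p K u u) + \int[mu]_(x in A) gtail p u x).
Proof.
move=> /andP[p1 p2] mu_.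
have mq := measurable_powdiff p mK mu_ mu_.
have q0 z : 0 <= powdiff p K u u z by exact: powdiff_ge0.
have mi := measurable_inner mu mq q0 mA mC.
have i0 x : A x -> 0 <= \int[mu]_(y in C) powdiff p K u u (x, y).
  by move=> _; apply: integral_ge0 => y _; exact: q0.
have mt : measurable_fun A (gtail p u).
  exact: (measurable_funS measurableT (@subsetT _ A) (measurable_gtail p mu_)).
have t0 x : A x -> 0 <= gtail p u x by move=> _; exact: gtail_ge0.
rewrite /dint -(ge0_integralD mu mA i0 mi t0 mt).
have it0 x : A x -> 0 <= \int[mu]_(y in C) powdiff p K u u (x, y) + gtail p u x.
  by move=> Ax; apply: adde_ge0; [exact: i0|exact: t0].
have two0 : 0 <= 2%:E :> \bar R by rewrite lee_fin.
rewrite -(ge0_integralZl mu mA (emeasurable_funD mi mt) it0 two0).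
have mup : measurable_fun A (fun x => (`|u x| `^ p)%:E).
  apply/measurable_EFinP; apply: measurable_fun_powR.
  apply: (measurable_funS measurableT (@subsetT _ A)).
  exact: (measurableT_comp (@normr_measurable R setT)).
apply: (ge0_le_integral mu mA _ (emeasurable_funM mup mkap)).
- by move=> x _; apply: mule_ge0; [rewrite lee_fin powR_ge0|exact: kap0].
- exact: (measurable_funeM 2%:E (emeasurable_funD mi mt)).
move=> x Ax.
have up0 : 0 <= (`|u x| `^ p)%:E by rewrite lee_fin powR_ge0.
have k0 y : C y -> 0 <= (EFin \o K x) y by rewrite /= lee_fin.
rewrite /rint -(ge0_integralZl mu mC (mKE x) k0 up0) gtailE.
have m2 : measurable_fun setT (powdiff p K (cst 0%R) u) by exact: measurable_powdiff.
have q20 y : C y -> 0 <= powdiff p K (cst 0%R) u (x, y) by move=> _; exact: powdiff_ge0.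
rewrite -(ge0_integralD mu mC (fun y _ => q0 (x, y)) (msec x mq) q20 (msec x m2)).
have s0 y : C y -> 0 <= powdiff p K u u (x, y) + powdiff p K (cst 0%R) u (x, y).
  by move=> Cy; apply: adde_ge0; [exact: q0|exact: q20].
have ms := emeasurable_funD (msec x mq) (msec x m2).
rewrite -(ge0_integralZl mu mC ms s0 two0).
apply: (ge0_le_integral mu mC _ (measurable_funeM _ (mKE x)) (measurable_funeM _ ms)).
  by move=> y Cy; apply: mule_ge0 => //; exact: k0.
move=> y _; rewrite /powdiff/= -EFinM -EFinD -EFinM lee_fin -mulrDl mulrA ler_wpM2r//.
apply: (@le_trans _ _ ((`|u x - u y| + `|0 - u y|) `^ p)%R).
  apply: ge0_ler_powR; rewrite ?nnegrE ?addr_ge0//; first exact: le_trans p1.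
  by rewrite sub0r normrN -[X in (`|X| <= _)%R](subrK (u y)) ler_normD.
apply: (le_trans (powR_triangle p1 (normr_ge0 _) (normr_ge0 _))).
apply: ler_wpM2r; first by rewrite addr_ge0// powR_ge0.
rewrite -[leRHS](powRr1 (ler0n R 2)); apply: ler_powR; first by rewrite ler1n.
by rewrite lerBlDr.
Qed.

Lemma interaction_triangle u v w : measurable_fun setT u -> measurable_fun setT v ->
  measurable_fun setT w ->
  dint mu A C (powdiff 1 K w u) <= dint mu A C (powdiff 1 K v u) +
    \int[mu]_(x in A) (`|v x - w x|%:E * rint mu C (K x)).
Proof.
move=> mu_ mv mw.
have mq := measurable_powdiff 1 mK mv mu_; have mq' := measurable_powdiff 1 mK mw mu_.
have q0 z : 0 <= powdiff 1 K v u z by exact: powdiff_ge0.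
have q0' z : 0 <= powdiff 1 K w u z by exact: powdiff_ge0.
have mi := measurable_inner mu mq q0 mA mC; have mi' := measurable_inner mu mq' q0' mA mC.
have i0 x : A x -> 0 <= \int[mu]_(y in C) powdiff 1 K v u (x, y).
  by move=> _; apply: integral_ge0 => y _; exact: q0.
have md : measurable_fun A (fun x => `|v x - w x|%:E).
  apply/measurable_EFinP; apply: (measurable_funS measurableT (@subsetT _ A)).
  by apply: (measurableT_comp (@normr_measurable R setT)); exact: measurable_funB.
have mt := emeasurable_funM md mkap.
have t0 x : A x -> 0 <= `|v x - w x|%:E * rint mu C (K x).
  by move=> _; apply: mule_ge0; [rewrite lee_fin|exact: kap0].
rewrite /dint -(ge0_integralD mu mA i0 mi t0 mt).
apply: (ge0_le_integral mu mA _ mi' (emeasurable_funD mi mt)).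
  by move=> x _; apply: integral_ge0 => y _; exact: q0'.
move=> x _.
have up0 : 0 <= (`|v x - w x|)%:E by rewrite lee_fin.
have k0 y : C y -> 0 <= (EFin \o K x) y by rewrite /= lee_fin.
rewrite /rint -(ge0_integralZl mu mC (mKE x) k0 up0).
have mkx := measurable_funeM `|v x - w x|%:E (mKE x).
have k0' y : C y -> 0 <= `|v x - w x|%:E * (EFin \o K x) y.
  by move=> Cy; apply: mule_ge0 => //; exact: k0.
rewrite -(ge0_integralD mu mC (fun y _ => q0 (x, y)) (msec x mq) k0' mkx).
apply: (ge0_le_integral mu mC (fun y _ => q0' (x, y)) (msec x mq') (emeasurable_funD (msec x mq) mkx)).
move=> y _; rewrite /powdiff/= -EFinM -EFinD lee_fin !powRr1// -mulrDl ler_wpM2r//.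
have -> : (w x - u y = (v x - u y) - (v x - w x))%R by ring.
exact: ler_normB.
Qed.

Lemma dint_negligible (N B B' : set T) f : measurable N -> mu N = 0 ->
  measurable B -> measurable B' ->
  measurable_fun setT f -> (forall z, 0 <= f z) ->
  dint mu (B `\` N) B' f = dint mu B B' f.
Proof.
move=> mN N0 mB mB' mf f0; rewrite /dint.
have i0 x : B x -> 0 <= \int[mu]_(y in B') f (x, y).
  by move=> _; apply: integral_ge0 => y _; exact: f0.
by rewrite -(ge0_negligible_integral mN mB (measurable_inner mu mf f0 mB mB') i0 N0).
Qed.

Lemma dint_negligible2 (N B : set T) f : measurable N -> mu N = 0 ->
  measurable B -> measurable_fun setT f -> (forall z, 0 <= f z) ->
  dint mu (B `\` N) (B `\` N) f = dint mu B B f.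
Proof.
move=> mN N0 mB mf f0.
rewrite (dint_negligible mN N0 mB (measurableD mB mN) mf f0); apply: eq_integral => x _.
have mfx : measurable_fun B (fun y => f (x, y)).
  apply: (measurable_funS measurableT (@subsetT _ B)).
  exact: (measurableT_comp mf (measurable_pair1 x)).
by rewrite -(ge0_negligible_integral mN mB mfx (fun y _ => f0 (x, y)) N0).
Qed.

End interactions.

Section tail_limit.
Context d (T : measurableType d) {R : realType} (mu : {sigma_finite_measure set T -> \bar R}).
Variables (C : set T) (p : nat -> R) (K_ : nat -> T -> T -> R) (K : T -> T -> R).
Hypotheses (mC : measurable C) (p12 : forall k, 1 <= p k <= 2) (pc : p k @[k --> \oo] --> (1 : R)).
Hypotheses (mK_ : forall k, measurable_fun setT (fun z => K_ k z.1 z.2))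
  (mK : measurable_fun setT (fun z => K z.1 z.2)) (K_0 : forall k x y, 0 <= K_ k x y).
Variables (u_ : nat -> T -> R) (u : T -> R).
Hypotheses (mu_ : forall k, measurable_fun setT (u_ k)) (mu0 : measurable_fun setT u).
Hypothesis u_C : {ae mu, forall y, C y -> u_ k y @[k --> \oo] --> u y}.

Lemma gtail_limit_le (x : T) (c : \bar R) :
  (forall y, K_ k x y @[k --> \oo] --> K x y) ->
  (forall k, (gtail mu C (K_ k) (p k) (u_ k) x <= c)%E) -> (gtail mu C K 1 u x <= c)%E.
Proof.
move=> Kc tc.
have msec (f : T * T -> R) : measurable_fun setT f -> measurable_fun C (fun y => f (x, y)).
  move=> mf; apply: (measurable_funS measurableT (@subsetT _ C)).
  exact: (measurableT_comp mf (measurable_pair1 x)).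
have mC' (v : T -> R) : measurable_fun setT v -> measurable_fun C v.
  by move=> mv; exact: (measurable_funS measurableT (@subsetT _ C) mv).
have tE q (L : T -> T -> R) (v : T -> R) : gtail mu C L q v x =
    rint mu C (fun y => `|0 - v y| `^ q * L x y)%R.
  by apply: eq_integral => y _; rewrite sub0r normrN.
rewrite tE; apply: (le_trans (@shifted_fatou _ _ _ mu C mC p (fun k => K_ k x) (K x) u_ u p12 pc
  (fun k => msec _ (mK_ k)) (msec _ mK) (fun k => mC' _ (mu_ k)) (mC' _ mu0)
  (fun k y _ => K_0 k x y) (fun y _ => Kc y) u_C (fun=> 0) 0 (cvg_cst 0))).
by apply: limn_einf_le_cst => k; rewrite -tE.
Qed.

End tail_limit.

Section combination.
Context {R : realType}.
Local Open Scope ereal_scope.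

(** The interaction B_k of the competitor with the exterior datum need not
    converge, but it enters both inequalities and cancels. *)
Lemma combine_limits (I A J B : \bar R) (I_ A_ J_ B_ : nat -> \bar R) :
  0 <= I -> I < +oo -> 0 <= A -> A < +oo -> 0 <= J -> J < +oo -> 0 <= B -> B < +oo ->
  (forall k, 0 <= I_ k) -> (forall k, 0 <= A_ k) ->
  (forall k, 0 <= J_ k) -> (forall k, 0 <= B_ k) -> (forall k, A_ k < +oo) ->
  I <= limn_einf I_ -> J_ k @[k --> \oo] --> J ->
  (forall e : R, (0 < e)%R -> \forall k \near \oo, A + B_ k <= A_ k + B + e%:E) ->
  (\forall k \near \oo, I_ k + 2%:E * A_ k <= J_ k + 2%:E * B_ k) ->
  I + 2%:E * A <= J + 2%:E * B.
Proof.
move=> I0 Ioo A0 Aoo J0 Joo B0 Boo I_0 A_0 J_0 B_0 A_oo IF Jc AB min.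
have [i i0 iE] := ge0_lty_real I0 Ioo; have [a a0 aE] := ge0_lty_real A0 Aoo.
have [j j0 jE] := ge0_lty_real J0 Joo; have [b b0 bE] := ge0_lty_real B0 Boo.
apply/lee_addgt0Pr => e e0; have e4 : (0 < e / 4)%R by rewrite divr_gt0.
(* All quantities are finite for some large k, and the inequalities add up. *)
have h1 : \forall k \near \oo, (i - e / 4)%:E < I_ k.
  apply: limn_einf_gt; apply: (lt_le_trans _ IF); rewrite iE lte_fin.
  by rewrite ltrBlDr ltrDl.
have h2 : \forall k \near \oo, J_ k < (j + e / 4)%:E.
  have NJ : nbhs J [set t | t < (j + e / 4)%:E].
    apply: open_nbhs_nbhs; split; first exact: open_ereal_lt_ereal.
    by rewrite /= jE lte_fin ltrDl.
  exact: Jc _ NJ.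
have [k [[[ck1 ck2] ck3] ck4]] := filter_ex (filterI (filterI (filterI h1 h2) (AB _ e4)) min).
have [ak ak0 akE] := ge0_lty_real (A_0 k) (A_oo k).
have Blt : B_ k < +oo.
  apply: (@le_lt_trans _ _ (A + B_ k)); first by rewrite leeDr.
  by apply: (le_lt_trans ck3); rewrite akE bE -!EFinD ltry.
have [bk bk0 bkE] := ge0_lty_real (B_0 k) Blt.
have Rlt : I_ k + 2%:E * A_ k < +oo.
  apply: (le_lt_trans ck4); rewrite bkE; apply: lte_add_pinfty; last by rewrite -EFinM ltry.
  by apply: (lt_trans ck2); rewrite ltry.
have Ilt : I_ k < +oo.
  by apply: le_lt_trans Rlt; rewrite leeDl// mule_ge0.
have [ik ik0 ikE] := ge0_lty_real (I_0 k) Ilt.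
have [jk jk0 jkE] := ge0_lty_real (J_0 k) (lt_trans ck2 (ltry _)).
move: ck1 ck2 ck3 ck4; rewrite iE aE jE bE ikE akE bkE jkE.
rewrite -!EFinM -!EFinD !lte_fin !lee_fin => ? ? ? ?.
by lra.
Qed.

End combination.

(** * Bounds for minimizers *)

Section minimizers.
Context {R : realType} {n : nat}.
Variable s : R.
Hypotheses (n_gt0 : (0 < n)%N) (s01 : 0 < s < 1).
Local Notation Rn := (lebesgueRn R n).
Local Notation leb := (@lebesgue R n).
Variable Omega : set 'rV[R]_n.
Hypotheses (oO : open Omega) (bO : bounded_set Omega).
Local Notation O := (Omega : set Rn).
Local Notation C := (~` Omega : set Rn).
Let s0 : 0 < s. Proof. by case/andP: s01. Qed.
Let mO : measurable O. Proof. exact: open_lebesgue. Qed.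
Let mC : measurable C. Proof. exact: measurableC mO. Qed.
Let mK q := @measurable_frac_kernel R n s q.
Let K0 q (x y : Rn) : 0 <= fker s q x y. Proof. exact: frac_kernel_ge0. Qed.

Lemma calW_intro q (v : Rn -> R) : 0 < q -> measurable_fun setT v ->
  (\int[leb]_(x in O) (`|v x| `^ q)%:E < +oo)%E ->
  (dint leb O O (powdiff q (fker s q) v v) < +oo)%E -> calW O s q v.
Proof.
move=> q0 mv iv Iv; split; first exact: mv.
split; first by split; [exact: (measurable_funS measurableT (@subsetT _ O) mv)|exact: iv].
exact: (gagliardo_lty O s v q0).2.
Qed.

Lemma half_inv_mul_le (q : R) (a b : \bar R) : 0 < q ->
  ((2 * q)^-1%:E * a <= (2 * q)^-1%:E * b)%E -> (a <= b)%E.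
Proof. by move=> q0; rewrite lee_pmul2l// lte_fin invr_gt0 mulr_gt0. Qed.

(** The cross region splits into Omega x Omega and two copies of
    Omega x ~Omega, and the common factor of the energies cancels. *)
Lemma minimizer_le q (u v : Rn -> R) : 1 <= q -> minimizer O s q u -> calW O s q v -> ae_eq leb C v u ->
  (dint leb O O (powdiff q (fker s q) u u) + 2%:E * dint leb O C (powdiff q (fker s q) u u) <=
   dint leb O O (powdiff q (fker s q) v v) + 2%:E * dint leb O C (powdiff q (fker s q) v v))%E.
Proof.
move=> q1 [Wu _ umin] Wv vu.
have := umin v Wv vu.
rewrite (energy_dint s q mO Wu.1) (energy_dint s q mO Wv.1).
by apply: half_inv_mul_le; exact: lt_le_trans q1.
Qed.

(** Competitors of u are obtained by changing it inside Omega only. *)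
Definition glue (w u : Rn -> R) (x : Rn) : R := w x * \1_O x + u x * \1_C x.

Lemma glue_in w u x : O x -> glue w u x = w x.
Proof.
move=> Ox; rewrite /glue !indicE mem_set// memNset ?mulr0 ?addr0 ?mulr1//.
Qed.

Lemma glue_out w u x : C x -> glue w u x = u x.
Proof. by move=> Cx; rewrite /glue !indicE (mem_set Cx) memNset// mulr0 add0r mulr1. Qed.

Lemma measurable_glue (w u : Rn -> R) : measurable_fun setT w -> measurable_fun setT u ->
  measurable_fun setT (glue w u).
Proof.
move=> mw mu_; apply: measurable_funD.
  by apply: measurable_funM; [exact: mw|exact: measurable_indic mO].
by apply: measurable_funM; [exact: mu_|exact: measurable_indic mC].
Qed.

Definition zero_extension (u : Rn -> R) : Rn -> R := glue u (fun=> 0).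

Lemma dint_glue_in q w u :
  dint leb O O (powdiff q (fker s q) (glue w u) (glue w u)) = dint leb O O (powdiff q (fker s q) w w).
Proof.
apply: eq_integral => x /set_mem Ox; apply: eq_integral => y /set_mem Oy.
by rewrite /powdiff/= (glue_in w u Ox) (glue_in w u Oy).
Qed.

Lemma dint_glue_out q w u :
  dint leb O C (powdiff q (fker s q) (glue w u) (glue w u)) = dint leb O C (powdiff q (fker s q) w u).
Proof.
apply: eq_integral => x /set_mem Ox; apply: eq_integral => y /set_mem Cy.
by rewrite /powdiff/= (glue_in w u Ox) (glue_out w u Cy).
Qed.

Lemma minimizer_le_glue q (u w : Rn -> R) : 1 <= q -> minimizer O s q u -> measurable_fun setT w ->
  (\int[leb]_(x in O) (`|w x| `^ q)%:E < +oo)%E ->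
  (dint leb O O (powdiff q (fker s q) w w) < +oo)%E ->
  (dint leb O O (powdiff q (fker s q) u u) + 2%:E * dint leb O C (powdiff q (fker s q) u u) <=
   dint leb O O (powdiff q (fker s q) w w) + 2%:E * dint leb O C (powdiff q (fker s q) w u))%E.
Proof.
move=> q1 um mw iw Iw; have [[mu_ _] _ _] := um.
rewrite -(dint_glue_in q w u) -(dint_glue_out q w u); apply: (minimizer_le q1 um).
  apply: calW_intro; [exact: lt_le_trans q1|exact: measurable_glue| |by rewrite dint_glue_in].
  rewrite (eq_integral (fun x => (`|w x| `^ q)%:E)) => [|x /set_mem Ox]; first exact: iw.
  by rewrite (glue_in w u Ox).
by apply: aeW => x Cx; exact: glue_out.
Qed.

Variables (q : R) (u : Rn -> R) (g : Rn -> R) (G : R).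
Hypotheses (q12 : 1 <= q <= 2) (um : minimizer O s q u).
Hypotheses (mg : measurable_fun O g) (iG : (rint leb O g <= G%:E)%E) (g0 : forall x, O x -> 0 <= g x).
Hypothesis tg : {ae leb, forall x, O x -> (gtail leb C (fker s q) q u x <= (g x)%:E)%E}.

Let mu_ : measurable_fun setT u. Proof. by have [[]] := um. Qed.
Let q1 : 1 <= q. Proof. by case/andP: q12. Qed.
Let q_gt0 : 0 < q. Proof. exact: lt_le_trans q1. Qed.

Lemma tail_bound : (\int[leb]_(x in O) gtail leb C (fker s q) q u x <= G%:E)%E.
Proof.
apply: (le_trans _ iG).
have mt : measurable_fun O (gtail leb C (fker s q) q u).
  exact: (measurable_funS measurableT (@subsetT _ O) (measurable_gtail leb mC (mK q) (K0 q) q mu_)).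
have mgE : measurable_fun O (EFin \o g) by exact/measurable_EFinP.
apply: (ae_ge0_le_integral mO _ mt _ mgE tg).
- by move=> x _; exact: gtail_ge0.
- by move=> x Ox; rewrite /= lee_fin; exact: g0.
Qed.

(** For the competitor vanishing in Omega, the interaction with the exterior is
    the integral of the tail of u. *)
Lemma minimizer_bound :
  (dint leb O O (powdiff q (fker s q) u u) + 2%:E * dint leb O C (powdiff q (fker s q) u u) <= (2 * G)%:E)%E.
Proof.
pose z : Rn -> R := fun=> 0.
have mz : measurable_fun setT z by exact: measurable_cst.
have z0 : (\int[leb]_(x in O) (`|z x| `^ q)%:E = 0)%E.
  by apply: integral0_eq => x _; rewrite /z normr0 powR0// gt_eqF.
have z1 : dint leb O O (powdiff q (fker s q) z z) = 0%E.
  apply: integral0_eq => x _; apply: integral0_eq => y _.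
  by rewrite /powdiff/= subrr normr0 powR0 ?mul0r// gt_eqF.
have := @minimizer_le_glue q u z q1 um mz; rewrite z0 z1 add0e.
move=> /(_ (ltry 0) (ltry 0)) /le_trans; apply.
rewrite EFinM; apply: lee_wpmul2l; first by rewrite lee_fin.
apply: (le_trans _ tail_bound); rewrite le_eqVlt; apply/orP; left; apply/eqP.
by apply: eq_integral => x _; rewrite gtailE.
Qed.

Let X := dint leb O C (powdiff q (fker s q) u u).
Let I := dint leb O O (powdiff q (fker s q) u u).
Let X0 : (0 <= X)%E. Proof. by apply: dint_ge0 => z; exact: powdiff_ge0. Qed.
Let I0 : (0 <= I)%E. Proof. by apply: dint_ge0 => z; exact: powdiff_ge0. Qed.

Lemma half_bound (a b : \bar R) (c : R) : (0 <= a)%E -> (0 <= b)%E ->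
  (a + 2%:E * b <= (2 * c)%:E)%E -> (a <= (2 * c)%:E)%E /\ (b <= c%:E)%E.
Proof.
move=> a0 b0 h; split; first by apply: (le_trans _ h); rewrite leeDl// mule_ge0.
have : (2%:E * b <= 2%:E * c%:E)%E by rewrite -EFinM; apply: (le_trans _ h); rewrite leeDr.
by rewrite lee_pmul2l.
Qed.

Lemma interaction_bound : (X <= G%:E)%E.
Proof. exact: (half_bound I0 X0 minimizer_bound).2. Qed.

(** The value at x is compared with the exterior values, whose contribution is
    the tail. *)
Lemma weighted_bound : (\int[leb]_(x in O) ((`|u x| `^ q)%:E * kappa s Omega q x) <= (4 * G)%:E)%E.
Proof.
apply: (le_trans (@weighted_le_interaction _ _ _ leb O C (fker s q) mO mC (mK q) (K0 q) q u q12 mu_)).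
have -> : (4 * G)%:E = (2%:E * (G%:E + G%:E))%E :> \bar R.
  by rewrite -EFinD -EFinM; congr EFin; ring.
apply: lee_wpmul2l; first by rewrite lee_fin.
exact: (leeD interaction_bound tail_bound).
Qed.

Lemma zero_extension_bound :
  (dint leb setT setT (powdiff q (fker s q) (zero_extension u) (zero_extension u)) <= (10 * G)%:E)%E.
Proof.
have m0 : measurable_fun setT ((fun=> 0) : Rn -> R) by exact: measurable_cst.
have mz := measurable_glue mu_ m0.
have z0 (x : Rn) : ~ O x -> zero_extension u x = 0 by move=> Cx; rewrite /zero_extension (glue_out u (fun=> 0) Cx).
have Ksym (x y : Rn) : fker s q x y = fker s q y x by exact: frac_kernel_sym.
have qn0 : q != 0 by rewrite gt_eqF.
rewrite (@seminorm_split _ _ _ leb O q (fker s q) _ qn0 mO (mK q) (K0 q) Ksym mz z0).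
have -> : (\int[leb]_(x in O) ((`|zero_extension u x| `^ q)%:E * rint leb (~` O) (fker s q x)) =
    \int[leb]_(x in O) ((`|u x| `^ q)%:E * kappa s Omega q x))%E.
  by apply: eq_integral => x /set_mem Ox; rewrite /zero_extension (glue_in u (fun=> 0) Ox).
rewrite dint_glue_in.
have -> : (10 * G)%:E = ((2 * G)%:E + 2%:E * (4 * G)%:E)%E :> \bar R.
  by rewrite -EFinM -EFinD; congr EFin; ring.
apply: leeD; first exact: (half_bound I0 X0 minimizer_bound).1.
by apply: lee_wpmul2l; [rewrite lee_fin|exact: weighted_bound].
Qed.

Lemma powR_ge_lin (a : R) : 0 <= a -> a <= 1 + a `^ q.
Proof.
move=> a0; have [a1|a1] := leP a 1; first by rewrite (le_trans a1)// lerDl powR_ge0.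
apply: (@le_trans _ _ (a `^ q)); last by rewrite lerDr.
by rewrite -[X in X <= _](powRr1 a0) ler_powR// ltW.
Qed.

(** The weight kappa is bounded below, and |a| <= 1 + |a|^q. *)
Lemma L1_bound (c l : R) : 0 < c -> (forall x, O x -> (c%:E <= kappa s Omega q x)%E) ->
  leb O = l%:E -> (\int[leb]_(x in O) `|u x|%:E <= (l + c^-1 * (4 * G))%:E)%E.
Proof.
move=> c0 ck lE.
have mup : measurable_fun setT (fun x => `|u x| `^ q).
  by apply: measurable_fun_powR; exact: (measurableT_comp (@normr_measurable R setT)).
have mn (f : Rn -> R) : measurable_fun setT f -> measurable_fun O (fun x => `|f x|%:E).
  move=> mf; apply/measurable_EFinP; apply: (measurable_funS measurableT (@subsetT _ O)).
  exact: (measurableT_comp (@normr_measurable R setT) mf).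
have n0 (f : Rn -> R) (x : Rn) : O x -> (0 <= `|f x|%:E)%E by rewrite lee_fin.
have one0 (x : Rn) : O x -> (0 <= (1 : R)%:E)%E by rewrite lee_fin.
apply: (@le_trans _ _ (\int[leb]_(x in O) (1%:E + `|(`|u x| `^ q)%R|%:E))%E).
  apply: (ge0_le_integral leb mO (n0 u) (mn _ mu_)
    (emeasurable_funD (@measurable_cst _ _ Rn _ O 1%:E) (mn _ mup))) => x _.
  rewrite -EFinD lee_fin (ger0_norm (powR_ge0 _ _)); exact: (powR_ge_lin (normr_ge0 _)).
rewrite (ge0_integralD leb mO one0 (@measurable_cst _ _ Rn _ O 1%:E) (n0 _) (mn _ mup)).
have ic : (\int[leb]_(x in O) 1%:E = l%:E)%E.
  exact: (etrans (integral_cst leb mO 1) (etrans (mul1e _) lE)).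
rewrite ic EFinD; apply: leeD; first exact: lexx.
have mk : measurable_fun [set: Rn] (kappa s Omega q) by exact: measurable_kappa.
have k0 (x : Rn) : (0 <= kappa s Omega q x)%E by exact: kappa_ge0.
apply: (le_trans (@integral_le_weighted _ _ _ leb O (kappa s Omega q) mO mk k0 _ c mup c0 ck)).
rewrite EFinM; apply: lee_wpmul2l; first by rewrite lee_fin invr_ge0 ltW.
apply: (le_trans _ weighted_bound); rewrite le_eqVlt; apply/orP; left; apply/eqP.
by apply: eq_integral => x _; rewrite (ger0_norm (powR_ge0 _ _)).
Qed.

End minimizers.

(** * Passage to the limit in the minimality *)

Lemma ae_and d (T : measurableType d) (R : realType) (mu : {measure set T -> \bar R})
  (P Q : T -> Prop) : {ae mu, forall x, P x} -> {ae mu, forall x, Q x} ->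
  {ae mu, forall x, P x /\ Q x}.
Proof. by move=> aP aQ; apply: filterS2 aP aQ. Qed.

Lemma ae_negligible d (T : measurableType d) (R : realType) (mu : {measure set T -> \bar R})
  (P : T -> Prop) : {ae mu, forall x, P x} ->
  exists N, [/\ measurable N, mu N = 0%E & forall x, ~ N x -> P x].
Proof.
move=> [N [mN N0 NP]]; exists N; split => // x nNx; apply: contrapT => nP.
by apply: nNx; exact: NP.
Qed.

Lemma three_quarters (R : realType) (x y a b : \bar R) (e : R) : 0 < e ->
  (0 <= a)%E -> (0 <= b)%E ->
  (x <= a + (e / 4)%:E)%E -> (y <= b + (e / 4)%:E)%E -> (x + 2%:E * y <= a + 2%:E * b + e%:E)%E.
Proof.
move=> e0 a0 b0 xa yb.
apply: (@le_trans _ _ (a + (e / 4)%:E + 2%:E * (b + (e / 4)%:E))%E).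
  by apply: leeD => //; apply: lee_wpmul2l.
rewrite ge0_muleDr//; last by rewrite lee_fin divr_ge0// ltW.
rewrite addeACA leeD2l// -EFinM -EFinD lee_fin; lra.
Qed.

Lemma le_add_infty (R : realType) (x a b : \bar R) : (0 <= a)%E -> b = +oo%E ->
  (x <= a + 2%:E * b)%E.
Proof.
move=> a0 ->; rewrite gt0_muley ?lte_fin// addeC addye ?leey//.
by rewrite gt_eqF// (lt_le_trans _ a0)// ltNy0.
Qed.

Section limit.
Context {R : realType} {n : nat}.
Variable s : R.
Hypotheses (n_gt0 : (0 < n)%N) (s01 : 0 < s < 1).
Local Notation Rn := (lebesgueRn R n).
Local Notation leb := (@lebesgue R n).
Variable Omega : set 'rV[R]_n.
Hypotheses (oO : open Omega) (bO : bounded_set Omega) (lO : lipschitz_boundary Omega).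
Local Notation O := (Omega : set Rn).
Local Notation C := (~` Omega : set Rn).
Let s0 : 0 < s. Proof. by case/andP: s01. Qed.
Let mO : measurable O. Proof. exact: open_lebesgue. Qed.
Let mC : measurable C. Proof. exact: measurableC mO. Qed.
Let mK q := @measurable_frac_kernel R n s q.
Let K0 q (x y : Rn) : 0 <= fker s q x y. Proof. exact: frac_kernel_ge0. Qed.

Variables (p : nat -> R) (u_ : nat -> Rn -> R) (u : Rn -> R) (g : Rn -> R) (G : R).
Hypotheses (p12 : forall k, 1 <= p k <= 2) (pc : p k @[k --> \oo] --> (1 : R)).
Hypothesis um : forall k, minimizer O s (p k) (u_ k).
Hypotheses (mg : measurable_fun O g) (iG : (rint leb O g <= G%:E)%E) (g0 : forall x, O x -> 0 <= g x).
Hypothesis tg : {ae leb, forall x, O x -> forall k, (gtail leb C (fker s (p k)) (p k) (u_ k) x <= (g x)%:E)%E}.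
Hypotheses (mu0 : measurable_fun setT u) (u_cvg : {ae leb, forall x, u_ k x @[k --> \oo] --> u x}).

Let p1 k : 1 <= p k. Proof. by case/andP: (p12 k). Qed.
Let mu_ k : measurable_fun setT (u_ k). Proof. by have [[]] := um k. Qed.
Let K_cvg (x y : Rn) : fker s (p k) x y @[k --> \oo] --> fker s 1 x y.
Proof. exact: cvg_frac_kernel. Qed.
Let tgk k : {ae leb, forall x, O x -> (gtail leb C (fker s (p k)) (p k) (u_ k) x <= (g x)%:E)%E}.
Proof. by apply: (ae_mono tg) => x h Ox; exact: h. Qed.
Let u_C : {ae leb, forall y, C y -> u_ k y @[k --> \oo] --> u y}.
Proof. by apply: (ae_mono u_cvg) => x h _. Qed.

Let good : exists N, [/\ measurable (N : set Rn), leb N = 0%E &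
  forall x, ~ N x -> u_ k x @[k --> \oo] --> u x /\
  (O x -> forall k, (gtail leb C (fker s (p k)) (p k) (u_ k) x <= (g x)%:E)%E)].
Proof. exact: (ae_negligible (ae_and u_cvg tg)). Qed.

Let qE q (a b : Rn -> R) z : (0 <= powdiff q (fker s q) a b z)%E.
Proof. by apply: powdiff_ge0 => x y; exact: K0. Qed.

Let mqE q (a b : Rn -> R) : measurable_fun setT a -> measurable_fun setT b ->
  measurable_fun setT (powdiff q (fker s q) a b).
Proof. by move=> ma mb; exact: (measurable_powdiff q (mK q) ma mb). Qed.

Let II k := dint leb O O (powdiff (p k) (fker s (p k)) (u_ k) (u_ k)).
Let I1 := dint leb O O (powdiff 1 (fker s 1) u u).
Let AA k := dint leb O C (powdiff (p k) (fker s (p k)) (u_ k) (u_ k)).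
Let A1 := dint leb O C (powdiff 1 (fker s 1) u u).

Let II0 k : (0 <= II k)%E. Proof. by apply: dint_ge0 => z; exact: qE. Qed.
Let AA0 k : (0 <= AA k)%E. Proof. by apply: dint_ge0 => z; exact: qE. Qed.

Let AAG k : (AA k <= G%:E)%E.
Proof. exact: (interaction_bound oO (p12 k) (um k) mg iG g0 (tgk k)). Qed.

Let IIG k : (II k <= (2 * G)%:E)%E.
Proof. exact: (half_bound (II0 k) (AA0 k) (minimizer_bound oO (p12 k) (um k) mg iG g0 (tgk k))).1. Qed.

Lemma limit_seminorm_le : (I1 <= limn_einf II)%E.
Proof.
have [N [mN N0 NP]] := good.
have mD : measurable (O `\` N) by exact: measurableD.
rewrite /I1 -(dint_negligible2 mN N0 mO (mqE 1 mu0 mu0) (qE 1 u u)).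
have -> : II = fun k => dint leb (O `\` N) (O `\` N) (powdiff (p k) (fker s (p k)) (u_ k) (u_ k)).
  apply/funext => k.
  by rewrite (dint_negligible2 mN N0 mO (mqE (p k) (mu_ k) (mu_ k)) (qE (p k) (u_ k) (u_ k))).
have h := (@seminorm_fatou _ _ _ leb (O `\` N) p (fun k => fker s (p k)) (fker s 1) mD p1 pc
  (fun k => mK (p k)) (mK 1) (fun k => K0 (p k)) (K0 1) (fun x y _ _ => @K_cvg x y) u_ u mu_ mu0
  (fun x Dx => (NP x Dx.2).1)).
exact: h.
Qed.

Let I1G : (I1 <= (2 * G)%:E)%E.
Proof. apply: (le_trans limit_seminorm_le); exact: (limn_einf_le_cst IIG). Qed.

Let A1G : (A1 <= G%:E)%E.
Proof.
have [N [mN N0 NP]] := good.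
have mD : measurable (O `\` N) by exact: measurableD.
rewrite /A1 -(dint_negligible mN N0 mO mC (mqE 1 mu0 mu0) (qE 1 u u)).
apply: (@limit_interaction_le _ _ _ leb (O `\` N) C mD mC p (fun k => fker s (p k)) (fker s 1) u_ u G
  p12 pc (fun k => mK (p k)) (mK 1) (fun k => K0 (p k)) (K0 1) (fun x y _ _ => @K_cvg x y) mu_ mu0
  u_C (fun x Dx => (NP x Dx.2).1)) => k.
have := dint_negligible mN N0 mO mC (mqE (p k) (mu_ k) (mu_ k)) (qE (p k) (u_ k) (u_ k)).
rewrite /dint => ->; exact: AAG.
Qed.

Lemma limit_tail_bound : (\int[leb]_(x in O) gtail leb C (fker s 1) 1 u x <= G%:E)%E.
Proof.
have [N [mN N0 NP]] := good.
apply: (le_trans _ iG).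
have mt : measurable_fun O (gtail leb C (fker s 1) 1 u).
  exact: (measurable_funS measurableT (@subsetT _ O) (measurable_gtail leb mC (mK 1) (K0 1) 1 mu0)).
have mgE : measurable_fun O (EFin \o g) by exact/measurable_EFinP.
have ae : {ae leb, forall x, O x -> (gtail leb C (fker s 1) 1 u x <= (EFin \o g) x)%E}.
  apply: (ae_mono tg) => x tx Ox.
  exact: (@gtail_limit_le _ _ _ leb C p (fun k => fker s (p k)) (fker s 1) mC p12 pc
    (fun k => mK (p k)) (mK 1) (fun k => K0 (p k)) u_ u mu_ mu0 u_C x (g x)%:E (fun y => @K_cvg x y) (tx Ox)).
apply: (ae_ge0_le_integral mO _ mt _ mgE ae).
- by move=> x _; exact: gtail_ge0.
- by move=> x Ox; rewrite /= lee_fin; exact: g0.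
Qed.

Lemma limit_L1 : (\int[leb]_(x in O) `|u x|%:E < +oo)%E.
Proof.
have [c c0 ck] := kappa_ge n_gt0 s0 oO bO.
have [l l0 lE] := ge0_lty_real (measure_ge0 leb O) (lebesgue_bounded_lty oO bO).
apply: (@le_lt_trans _ _ (l + c^-1 * (4 * G))%:E); last exact: ltry.
have mn (f : Rn -> R) : measurable_fun setT f -> measurable_fun O (fun x => `|f x|%:E).
  move=> mf; apply/measurable_EFinP; apply: (measurable_funS measurableT (@subsetT _ O)).
  exact: (measurableT_comp (@normr_measurable R setT) mf).
apply: (le_trans (@fatou_ae _ _ _ leb O mO (fun k x => `|u_ k x|%:E)%E (fun x => `|u x|%:E)%E
  (fun k => mn _ (mu_ k)) (mn _ mu0) _ _ _)).
- by move=> k x _; rewrite lee_fin.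
- by move=> x _; rewrite lee_fin.
- apply: (ae_mono u_cvg) => x ux _.
  have cE : (`|u_ k x|%:E @[k --> \oo] --> `|u x|%:E)%E.
    by apply: cvg_EFin; [exact: nearW|exact: (cvg_norm ux)].
  by have [-> _] := cvg_limn_einf_sup cE.
apply: limn_einf_le_cst => k.
exact: (L1_bound oO (p12 k) (um k) mg iG g0 (tgk k) c0 (fun x Ox => ck (p k) x (p12 k) Ox) lE).
Qed.

Lemma limit_calW : calW O s 1 u.
Proof.
apply: calW_intro; [exact: ltr01|exact: mu0| |exact: (le_lt_trans I1G (ltry _))].
rewrite (eq_integral (fun x => `|u x|%:E)%E); first exact: limit_L1.
by move=> x _; rewrite powRr1.
Qed.

Section competitor.
Variables (w : Rn -> R) (L M dl : R).
Hypotheses (mw : measurable_fun [set: Rn] w) (dl0 : 0 < dl).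
Hypotheses (wL : forall x y : 'rV[R]_n, `|w x - w y| <= L * `|x - y|).
Hypotheses (wM : forall x, `|w x| <= M) (wd : forall x, depth Omega x < dl -> w x = 0).

Let JJ k := dint leb O O (powdiff (p k) (fker s (p k)) w w).
Let J1 := dint leb O O (powdiff 1 (fker s 1) w w).
Let BB k := dint leb O C (powdiff (p k) (fker s (p k)) w (u_ k)).
Let B1 := dint leb O C (powdiff 1 (fker s 1) w u).

Let C_ne := complement_nonempty n_gt0 bO.
Let J_cvg : JJ k @[k --> \oo] --> J1.
Proof. exact: (lip_seminorm_cvg s01 oO bO p12 pc mw wL). Qed.

Let Kb (x y : Rn) : R := (1 + depth Omega x `^ (- s)) * majorant s (depth Omega x) x y.

Let mKb (x : Rn) : measurable_fun C (Kb x).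
Proof.
have m : measurable_fun C (fun y : Rn => majorant s (depth Omega x) x y).
  exact: (measurable_funS measurableT (@subsetT _ C) (measurable_majorant s (depth Omega x) x)).
by apply: measurable_funM; [exact: measurable_cst|exact: m].
Qed.

Let K_b k (x y : Rn) : O x -> C y -> fker s (p k) x y <= Kb x y.
Proof.
by move=> Ox Cy; exact: (frac_kernel_far s0 (p12 k) (depth_gt0 n_gt0 oO bO Ox) (dist_le C_ne x Cy)).
Qed.

Let iKb (x : Rn) : O x -> (rint leb C (Kb x) < +oo)%E.
Proof.
move=> Ox; have dx := depth_gt0 n_gt0 oO bO Ox.
pose c := 1 + depth Omega x `^ (- s).
have c0 : (0 <= c%:E)%E by rewrite lee_fin addr_ge0// powR_ge0.
have mm : measurable_fun [set: Rn] (fun y : Rn => (majorant s (depth Omega x) x y)%:E).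
  by apply/measurable_EFinP; exact: measurable_majorant.
have mmC := measurable_funS measurableT (@subsetT _ C) mm.
have m0 (y : Rn) : [set: Rn] y -> (0 <= (majorant s (depth Omega x) x y)%:E)%E.
  by move=> _; rewrite lee_fin; exact: majorant_ge0.
have m0C (y : Rn) : C y -> (0 <= (majorant s (depth Omega x) x y)%:E)%E by move=> _; exact: m0.
have -> : rint leb C (Kb x) = (c%:E * \int[leb]_(y in C) (majorant s (depth Omega x) x y)%:E)%E.
  exact: (ge0_integralZl leb mC mmC m0C c0).
have fin : (\int[leb]_(y in C) (majorant s (depth Omega x) x y)%:E < +oo)%E.
  apply: (@le_lt_trans _ _ (\int[leb]_y (majorant s (depth Omega x) x y)%:E)%E).
    exact: (@ge0_subset_integral _ _ _ leb C setT mC measurableT _ mm m0 (@subsetT _ _)).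
  exact: (le_lt_trans (integral_majorant x s01 dx) (ltry _)).
exact: (lte_mul_pinfty c0 (erefl : c%:E \is a fin_num) fin).
Qed.

Let wp_lty k : (\int[leb]_(x in O) (`|w x| `^ p k)%:E < +oo)%E.
Proof.
have [l l0 lE] := ge0_lty_real (measure_ge0 leb O) (lebesgue_bounded_lty oO bO).
have mwp : measurable_fun O (fun x => (`|w x| `^ p k)%:E).
  apply/measurable_EFinP; apply: measurable_fun_powR.
  apply: (measurable_funS measurableT (@subsetT _ O)).
  exact: (measurableT_comp (@normr_measurable R setT) mw).
apply: (@le_lt_trans _ _ (\int[leb]_(x in O) (`|M| `^ p k)%:E)%E).
  apply: (ge0_le_integral leb mO _ mwp (@measurable_cst _ _ Rn _ O (`|M| `^ p k)%:E)).
    by move=> x _; rewrite lee_fin powR_ge0.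
  move=> x _; rewrite lee_fin; apply: ge0_ler_powR.
  - exact: (le_trans ler01 (p1 k)).
  - exact: normr_ge0.
  - exact: normr_ge0.
  - exact: (le_trans (wM x) (ler_norm M)).
have ic := integral_cst leb mO (`|M| `^ p k)%:E.
by rewrite ic lE -EFinM; exact: ltry.
Qed.

(** The competitor for u_ k is w inside Omega and u_ k outside: the limits of
    its interactions with the exterior are those of outer_limit. *)
Lemma limit_minimal_lip : (I1 + 2%:E * A1 <= J1 + 2%:E * B1)%E.
Proof.
have [N [mN N0 NP]] := good.
have mD : measurable (O `\` N) by exact: measurableD.
have [h h0 hw] := competitor_weight n_gt0 s01 oO bO dl0 wM wd.
have [l l0 lE] := ge0_lty_real (measure_ge0 leb O) (lebesgue_bounded_lty oO bO).
have DO : O `\` N `<=` O by exact: subDsetl.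
have mgE : measurable_fun O (EFin \o g) by exact/measurable_EFinP.
have mgD : measurable_fun (O `\` N) g := measurable_funS mO DO mg.
have igD : (rint leb (O `\` N) g < +oo)%E.
  apply: (le_lt_trans _ (le_lt_trans iG (ltry G))).
  exact: (@ge0_subset_integral _ _ _ leb (O `\` N) O mD mO _ mgE (fun x Ox => g0 Ox) DO).
have tD k x : (O `\` N) x ->
    (rint leb C (fun y => (`|u_ k y| `^ p k * fker s (p k) x y)%R) <= (g x)%:E)%E.
  move=> [Ox Nx]; rewrite -/(gtail leb C (fker s (p k)) (p k) (u_ k) x); exact: ((NP x Nx).2 Ox k).
have iH : (rint leb (O `\` N) (cst h) < +oo)%E.
  have -> : (rint leb (O `\` N) (cst h) = h%:E * leb (O `\` N))%E by exact: (integral_cst leb mD h%:E).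
  apply: (@le_lt_trans _ _ (h%:E * leb O)%E); last by rewrite lE -EFinM ltry.
  apply: lee_wpmul2l; first by rewrite lee_fin.
  by apply: (le_measure leb); [rewrite inE; exact: mD|rewrite inE; exact: mO|exact: DO].
have hD k x : (O `\` N) x -> ((2 * `|w x| `^ p k)%:E * rint leb C (fker s (p k) x) <= (cst h x)%:E)%E.
  by move=> [Ox _]; exact: (hw (p k) x (p12 k) Ox).
have dD q (a b : Rn -> R) : measurable_fun setT a -> measurable_fun setT b ->
    dint leb (O `\` N) C (powdiff q (fker s q) a b) = dint leb O C (powdiff q (fker s q) a b).
  by move=> ma mb; exact: (dint_negligible mN N0 mO mC (mqE q ma mb) (qE q a b)).
have A_M k : (\int[leb]_(x in O `\` N) \int[leb]_(y in C) powdiff (p k) (fker s (p k)) (u_ k) (u_ k) (x, y) <= G%:E)%E.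
  have := dD (p k) _ _ (mu_ k) (mu_ k); rewrite {1}/dint => ->; exact: AAG.
have lim := @outer_limit _ _ _ leb (O `\` N) C mD mC p (fun k => fker s (p k)) (fker s 1) Kb u_ u w g (cst h) G
  p12 pc (fun k => mK (p k)) (mK 1) (fun x _ => mKb x) (fun k => K0 (p k)) (K0 1) (fun x y _ _ => @K_cvg x y)
  (fun k x y Dx Cy => K_b k Dx.1 Cy) (fun x Dx => iKb Dx.1) mu_ mu0 mw u_C (fun x Dx => (NP x Dx.2).1)
  mgD (fun x Dx => g0 Dx.1) igD tD (@measurable_cst _ _ Rn _ (O `\` N) h) (fun x _ => h0) iH hD A_M.
have B1oo : (B1 < +oo)%E.
  rewrite /B1 -(dD 1 w u mw mu0).
  exact: (@competitor_interaction_lt _ _ _ leb (O `\` N) C mD mC p (fun k => fker s (p k)) (fker s 1) u_ u w g (cst h)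
    p12 pc (fun k => mK (p k)) (mK 1) (fun k => K0 (p k)) (K0 1) (fun x y _ _ => @K_cvg x y)
    mu_ mu0 mw u_C mgD (fun x Dx => g0 Dx.1) igD tD (@measurable_cst _ _ Rn _ (O `\` N) h) (fun x _ => h0) iH hD).
have lim' e : 0 < e -> \forall k \near \oo, (A1 + BB k <= AA k + B1 + e%:E)%E.
  move=> e0; have := lim e e0; apply: filterS => k.
  rewrite /A1 /BB /AA /B1 -(dD 1 u u mu0 mu0) -(dD (p k) w (u_ k) mw (mu_ k)).
  by rewrite -(dD (p k) (u_ k) (u_ k) (mu_ k) (mu_ k)) -(dD 1 w u mw mu0).
have J1oo : (J1 < +oo)%E by exact: (lip_seminorm_lty s01 oO bO mw wL).
have J10 : (0 <= J1)%E by apply: dint_ge0 => z; exact: qE.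
have B10 : (0 <= B1)%E by apply: dint_ge0 => z; exact: qE.
have I10 : (0 <= I1)%E by apply: dint_ge0 => z; exact: qE.
have A10 : (0 <= A1)%E by apply: dint_ge0 => z; exact: qE.
have JJ0 k : (0 <= JJ k)%E by apply: dint_ge0 => z; exact: qE.
have BB0 k : (0 <= BB k)%E by apply: dint_ge0 => z; exact: qE.
have minw : \forall k \near \oo, (II k + 2%:E * AA k <= JJ k + 2%:E * BB k)%E.
  have NJ : nbhs J1 [set t | (t < +oo)%E].
    by apply: open_nbhs_nbhs; split; [exact: open_ereal_lt_ereal|exact: J1oo].
  have NJk : \forall k \near \oo, (JJ k < +oo)%E by exact: (J_cvg NJ).
  apply: (filterS _ NJk) => k Jk.
  exact: (minimizer_le_glue oO (p1 k) (um k) mw (wp_lty k) Jk).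
exact: (combine_limits I10 (le_lt_trans I1G (ltry _)) A10 (le_lt_trans A1G (ltry _)) J10 J1oo
  B10 B1oo II0 AA0 JJ0 BB0 (fun k => le_lt_trans (AAG k) (ltry _)) limit_seminorm_le J_cvg lim' minw).
Qed.

End competitor.

Let gtail_ae (v : Rn -> R) x : measurable_fun setT v -> ae_eq leb C v u ->
  gtail leb C (fker s 1) 1 v x = gtail leb C (fker s 1) 1 u x.
Proof.
move=> mv vu; rewrite !gtailE.
have m0 : measurable_fun setT ((fun=> 0) : Rn -> R) by exact: measurable_cst.
have msec (a : Rn -> R) : measurable_fun setT a ->
    measurable_fun C (fun y => powdiff 1 (fker s 1) (cst 0) a (x, y)).
  move=> ma; apply: (measurable_funS measurableT (@subsetT _ C)).
  exact: (measurableT_comp (mqE 1 m0 ma) (measurable_pair1 x)).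
apply: (ge0_ae_eq_integral mC (msec v mv) (msec u mu0)).
- by move=> y _; exact: qE.
- by move=> y _; exact: qE.
- by apply: (ae_mono vu) => y h Cy; rewrite /powdiff /= h.
Qed.

(** A competitor of finite energy is replaced by a Lipschitz one vanishing near
    the boundary, at an arbitrarily small cost. *)
Theorem limit_minimizer : minimizer O s 1 u.
Proof.
have I10 : (0 <= I1)%E by apply: dint_ge0 => z; exact: qE.
have A10 : (0 <= A1)%E by apply: dint_ge0 => z; exact: qE.
have h0 : (0 <= ((2 * 1)^-1 : R)%:E)%E by rewrite lee_fin invr_ge0 mulr_ge0.
split; first exact: limit_calW.
  rewrite (energy_dint s 1 mO mu0); apply: (lte_mul_pinfty h0 (erefl : _%:E \is a fin_num)).
  apply: (lte_add_pinfty (le_lt_trans I1G (ltry _))).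
  by apply: (lte_mul_pinfty _ (erefl : 2%:E \is a fin_num) (le_lt_trans A1G (ltry _))); rewrite lee_fin.
move=> v Wv vu; have mv : measurable_fun setT v := Wv.1.
rewrite (energy_dint s 1 mO mu0) (energy_dint s 1 mO mv); apply: (lee_wpmul2l h0).
pose Iv := dint leb O O (powdiff 1 (fker s 1) v v).
pose Xv := dint leb O C (powdiff 1 (fker s 1) v v).
rewrite -/I1 -/A1 -/Iv -/Xv.
have Iv0 : (0 <= Iv)%E by apply: dint_ge0 => z; exact: qE.
have Xv0 : (0 <= Xv)%E by apply: dint_ge0 => z; exact: qE.
have Ivoo : (Iv < +oo)%E by exact: (gagliardo_lty O s v ltr01).1 Wv.2.2.
have [/eqP Xoo|Xn] := boolP (Xv == +oo%E).
  exact: (le_add_infty _ Iv0 Xoo).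
have Xvoo : (Xv < +oo)%E by rewrite ltey; exact: Xn.
have q12 : 1 <= (1 : R) <= 2 by rewrite lexx ler1n.
have m0 : measurable_fun setT ((fun=> 0) : Rn -> R) by exact: measurable_cst.
pose v' := zero_extension Omega v.
have mv' : measurable_fun setT v' := measurable_glue oO mv m0.
have v'0 (x : Rn) : ~ O x -> v' x = 0 by exact: (glue_out v (fun=> 0)).
have v'O (x : Rn) : O x -> v' x = v x by exact: (glue_in v (fun=> 0)).
have Iv' : dint leb O O (powdiff 1 (fker s 1) v' v') = Iv := dint_glue_in s Omega 1 v (fun=> 0).
have kv' : (\int[leb]_(x in O) (`|v' x|%:E * kappa s Omega 1 x) < +oo)%E.
  have -> : (\int[leb]_(x in O) (`|v' x|%:E * kappa s Omega 1 x) =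
      \int[leb]_(x in O) ((`|v x| `^ 1)%:E * rint leb C (fker s 1 x)))%E.
    by apply: eq_integral => x /set_mem Ox; rewrite (v'O x Ox) powRr1.
  apply: (le_lt_trans (@weighted_le_interaction _ _ _ leb O C (fker s 1) mO mC (mK 1) (K0 1) 1 v q12 mv)).
  have -> : (\int[leb]_(x in O) gtail leb C (fker s 1) 1 v x =
      \int[leb]_(x in O) gtail leb C (fker s 1) 1 u x)%E.
    by apply: eq_integral => x _; exact: gtail_ae.
  apply: (lte_mul_pinfty _ (erefl : 2%:E \is a fin_num)); first by rewrite lee_fin.
  exact: (lte_add_pinfty Xvoo (le_lt_trans limit_tail_bound (ltry _))).
have Iv'oo : (dint leb O O (powdiff 1 (fker s 1) v' v') < +oo)%E by rewrite Iv'; exact: Ivoo.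
apply/lee_addgt0Pr => e e0; have e4 : 0 < e / 4 by rewrite divr_gt0.
have [w [dl [L [M [dl0 mw [wL wM wd] wI wk]]]]] :=
  lipschitz_density n_gt0 s01 oO bO lO mv' v'0 Iv'oo kv' e4.
apply: (le_trans (limit_minimal_lip mw dl0 wL wM wd)).
apply: (three_quarters e0 Iv0 Xv0); first by rewrite Iv' in wI; exact: wI.
have -> : dint leb O C (powdiff 1 (fker s 1) w u) = dint leb O C (powdiff 1 (fker s 1) w v).
  have ww : {ae leb, forall x, O x -> w x = w x} by apply: aeW => x _.
  have uv : {ae leb, forall x, C x -> u x = v x} by apply: (ae_mono vu) => x h Cx; rewrite h.
  exact: (dint_ae_eq 1 mO mC (mK 1) (K0 1) mw mw mu0 mv ww uv).
apply: (le_trans (@interaction_triangle _ _ _ leb O C (fker s 1) mO mC (mK 1) (K0 1) v v' w mv mv' mw)).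
have -> : dint leb O C (powdiff 1 (fker s 1) v' v) = Xv.
  by apply: eq_integral => x /set_mem Ox; apply: eq_integral => y _; rewrite /powdiff/= (v'O x Ox).
by apply: leeD; [exact: lexx|exact: wk].
Qed.

End limit.

(** * Convergence of minimizers *)

Lemma ae_all d (T : measurableType d) (R : realType) (mu : {measure set T -> \bar R})
  (P : nat -> T -> Prop) : (forall k, {ae mu, forall x, P k x}) ->
  {ae mu, forall x, forall k, P k x}.
Proof. by move=> aP; apply/ae_foralln. Qed.

Lemma homo_leq_self (k : nat -> nat) : {homo k : i j / (i < j)%N} -> forall i, (i <= k i)%N.
Proof.
by move=> kh; elim=> [//|i IH]; apply: (leq_ltn_trans IH); exact: kh.
Qed.

Lemma cvg_subsequence (T : topologicalType) (f : nat -> T) (k : nat -> nat) (l : T) :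
  {homo k : i j / (i < j)%N} -> f j @[j --> \oo] --> l -> f (k j) @[j --> \oo] --> l.
Proof.
move=> kh fl; apply: (@cvg_comp _ _ _ k f) fl.
move=> A [N _ NA]; exists N => // j /= Nj; apply: NA => /=.
exact: (leq_trans Nj (homo_leq_self kh j)).
Qed.

Section pointwise_limit.
Context d (T : measurableType d) {R : realType}.

(** The lower limit is measurable whether or not the sequence converges, and
    its real part is the limit wherever it does. *)
Definition pointwise_limit (v : nat -> T -> R) (x : T) : R :=
  fine (limn_einf (fun j => (v j x)%:E)).

Lemma pointwise_limitE (v : nat -> T -> R) x l :
  v j x @[j --> \oo] --> l -> pointwise_limit v x = l.
Proof.
move=> vl; have c : ((v j x)%:E @[j --> \oo] --> l%:E)%E by apply: cvg_EFin; [exact: nearW|exact: vl].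
by rewrite /pointwise_limit; have [-> _] := cvg_limn_einf_sup c.
Qed.

Lemma measurable_pointwise_limit (v : nat -> T -> R) :
  (forall j, measurable_fun setT (v j)) -> measurable_fun setT (pointwise_limit v).
Proof.
move=> mv; have m : measurable_fun setT (fun x => limn_einf (fun j => (v j x)%:E)).
  by apply: measurable_limn_einf => j; exact/measurable_EFinP.
exact: measurableT_comp m.
Qed.

End pointwise_limit.

Lemma sup_fine_bound (R : realType) (S : \bar R) : (0 <= S)%E -> ((fine S)%:E <= S)%E.
Proof. by case: S => [r| |] //=; rewrite lexx. Qed.

Lemma eventually_le2 (R : realType) (p : nat -> R) : p k @[k --> \oo] --> (1 : R) ->
  exists N, forall k, p (k + N)%N <= 2.
Proof.
move=> pc; have [N _ Np] : \forall k \near \oo, p k < 2.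
  by have := cvgr_lt 1 pc 2; apply; rewrite ltr1n.
by exists N => k; apply/ltW/Np => /=; exact: leq_addl.
Qed.

Section domination.
Context d (T : measurableType d) {R : realType} (mu : {measure set T -> \bar R}).

(** An integrable supremum is finite almost everywhere; unlike the supremum,
    the resulting bounds pass to subsequences as they stand. *)
Lemma integrable_sup_majorant (A : set T) (f : nat -> T -> \bar R) : measurable A ->
  (forall k x, A x -> (0 <= f k x)%E) ->
  mu.-integrable A (fun x => ereal_sup (range (fun k => f k x))) ->
  exists (g : T -> R) (G : R),
    [/\ measurable_fun A g, forall x, A x -> 0 <= g x, (rint mu A g <= G%:E)%E &
        {ae mu, forall x, A x -> forall k, (f k x <= (g x)%:E)%E}].
Proof.
move=> mA f0 iS; set S := fun x => _ in iS.
have fS k x : (f k x <= S x)%E by apply: ereal_sup_ubound; exists k.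
have S0 x : A x -> (0 <= S x)%E by move=> Ax; apply: (le_trans (f0 0%N x Ax)).
have /integrableP[mS iSoo] := iS.
have iS' : (\int[mu]_(x in A) S x < +oo)%E.
  rewrite (eq_integral (fun x => `|S x|)%E)// => x /set_mem Ax.
  by rewrite gee0_abs// S0.
have i0 : (0 <= \int[mu]_(x in A) S x)%E by apply: integral_ge0.
have [G G0 GE] := ge0_lty_real i0 iS'.
have mg : measurable_fun A (fun x => fine (S x)) by exact: measurableT_comp mS.
exists (fun x => fine (S x)), G; split => //.
- by move=> x Ax; apply: fine_ge0; exact: S0.
- rewrite -GE; apply: ge0_le_integral => //.
  + by move=> x Ax; rewrite lee_fin fine_ge0// S0.
  + exact/measurable_EFinP.
  + by move=> x Ax; apply: sup_fine_bound; exact: S0.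
- apply: filterS (integrable_ae mA iS) => x Sx Ax k.
  by rewrite fineK ?Sx.
Qed.

End domination.

Section tails.
Context {R : realType} {n : nat}.
Local Notation Rn := (lebesgueRn R n).
Local Notation leb := (@lebesgue R n).

(** The exterior datum is measurable because Lebesgue measure is complete. *)
Lemma tail_ae (Omega : set Rn) (s q : R) (phi u : Rn -> R) (x : Rn) : measurable Omega ->
  measurable_fun setT u -> ae_eq leb (~` Omega) u phi ->
  tail Omega s q phi x = gtail leb (~` Omega) (fker s q) q u x.
Proof.
move=> mO mu_ up.
have mC : measurable (~` Omega) by exact: measurableC.
have mf : measurable_fun (~` Omega) (fun y => (`|u y| `^ q * fker s q x y)%:E).
  apply/measurable_EFinP; apply: measurable_funM.
    apply: measurable_fun_powR; apply: (measurable_funS measurableT (@subsetT _ _)).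
    exact: (measurableT_comp (@normr_measurable R setT) mu_).
  exact: (measurable_funS measurableT (@subsetT _ _) (measurable_fker_x s q x)).
have ae : ae_eq leb (~` Omega) (fun y => (`|u y| `^ q * fker s q x y)%:E)
    (fun y => (`|phi y| `^ q * fker s q x y)%:E).
  by apply: (ae_mono up) => y h Cy; rewrite (h Cy).
have mg := ae_measurable_fun (@lebesgue_complete R n) ae mf.
apply/esym; apply: (ge0_ae_eq_integral mC mf mg _ _ ae).
- by move=> y _; rewrite lee_fin; apply: mulr_ge0; [exact: powR_ge0|exact: frac_kernel_ge0].
- by move=> y _; rewrite lee_fin; apply: mulr_ge0; [exact: powR_ge0|exact: frac_kernel_ge0].
Qed.

End tails.

(** The zero extensions have bounded seminorm over the whole space: their
    interaction with the exterior is bounded by the energy and the tail. *)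
Lemma minimizers_compactness (R : realType) (n : nat) (s : R) (Omega : set 'rV[R]_n)
    (p : nat -> R) (u : nat -> lebesgueRn R n -> R) (g : lebesgueRn R n -> R) (G : R) :
  (0 < n)%N -> 0 < s < 1 -> open Omega -> bounded_set Omega ->
  (forall k, 1 <= p k <= 2) -> (forall k, minimizer (Omega : set (lebesgueRn R n)) s (p k) (u k)) ->
  measurable_fun (Omega : set (lebesgueRn R n)) g ->
  (rint lebesgue (Omega : set (lebesgueRn R n)) g <= G%:E)%E ->
  (forall x, Omega x -> 0 <= g x) ->
  {ae lebesgue, forall x, (Omega : set (lebesgueRn R n)) x ->
    forall k, (gtail lebesgue (~` Omega) (fker s (p k)) (p k) (u k) x <= (g x)%:E)%E} ->
  exists2 k : nat -> nat, {homo k : i j / (i < j)%N} & forall i j, (i <= j)%N ->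
    (\int[lebesgue]_(x in (Omega : set (lebesgueRn R n))) `|u (k i) x - u (k j) x|%:E <=
     ((2^-1) ^+ i)%:E)%E.
Proof.
move=> n_gt0 s01 oO bO p12 um mg iG g0 tg.
have s0 : 0 < s by case/andP: s01.
have mO : measurable (Omega : set (lebesgueRn R n)) by exact: open_lebesgue.
have mu_ k : measurable_fun setT (u k) by have [[]] := um k.
have tgk k : {ae lebesgue, forall x, (Omega : set (lebesgueRn R n)) x ->
    (gtail lebesgue (~` Omega) (fker s (p k)) (p k) (u k) x <= (g x)%:E)%E}.
  by apply: (ae_mono tg) => x h Ox; exact: h.
have [c c0 ck] := kappa_ge n_gt0 s0 oO bO.
have [l l0 lE] := ge0_lty_real (measure_ge0 (@lebesgue R n) Omega) (lebesgue_bounded_lty oO bO).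
have G0 : 0 <= G.
  by rewrite -lee_fin; apply: (le_trans _ iG); apply: integral_ge0 => x Ox; rewrite lee_fin; exact: g0.
have b1 : 0 <= l + c^-1 * (4 * G).
  by apply: addr_ge0 => //; apply: mulr_ge0; [rewrite invr_ge0 ltW|exact: mulr_ge0].
have b2 : 0 <= 10 * G by exact: mulr_ge0.
pose v k := zero_extension Omega (u k).
have m0 : measurable_fun setT ((fun=> 0) : lebesgueRn R n -> R) by exact: measurable_cst.
have mv k : measurable_fun setT (v k) := measurable_glue oO (mu_ k) m0.
have v0 k x : ~ Omega x -> v k x = 0 by exact: (glue_out (u k) (fun=> 0)).
have vE k x : Omega x -> v k x = u k x by exact: (glue_in (u k) (fun=> 0)).
have vB k : (\int[lebesgue]_(x in (Omega : set (lebesgueRn R n))) `|v k x|%:E <=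
    (l + c^-1 * (4 * G) + 10 * G)%:E)%E.
  have -> : (\int[lebesgue]_(x in (Omega : set (lebesgueRn R n))) `|v k x|%:E =
      \int[lebesgue]_(x in (Omega : set (lebesgueRn R n))) `|u k x|%:E)%E.
    by apply: eq_integral => x /set_mem Ox; rewrite (vE k x Ox).
  apply: (le_trans (L1_bound oO (p12 k) (um k) mg iG g0 (tgk k) c0 (fun x Ox => ck (p k) x (p12 k) Ox) lE)).
  by rewrite lee_fin lerDl.
have NB k : (dint lebesgue setT setT (powdiff (p k) (fker s (p k)) (v k) (v k)) <=
    (l + c^-1 * (4 * G) + 10 * G)%:E)%E.
  apply: (le_trans (zero_extension_bound oO (p12 k) (um k) mg iG g0 (tgk k))).
  by rewrite lee_fin lerDr.
have [k kh kc] := seminorm_compactness n_gt0 s01 oO bO p12 mv v0 vB NB.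
exists k => // i j ij; apply: (le_trans _ (kc i j ij)).
rewrite le_eqVlt; apply/orP; left; apply/eqP.
by apply: eq_integral => x /set_mem Ox; rewrite (vE (k i) x Ox) (vE (k j) x Ox).
Qed.

Theorem theorem1p6 (R : realType) (n : nat) (n_gt0 : (0 < n)%N)
    (Omega : set (lebesgueRn R n)) (s : R) (p : nat -> R)
    (phi_ : nat -> lebesgueRn R n -> R) (phi : lebesgueRn R n -> R)
    (u : nat -> lebesgueRn R n -> R) :
  open (Omega : set 'rV[R]_n) ->
  bounded_set (Omega : set 'rV[R]_n) ->
  lipschitz_boundary Omega ->
  0 < s < 1 ->
  (forall k, 1 < p k) ->
  decreases_to p 1 ->
  lebesgue.-integrable Omega
    (fun x => ereal_sup (range (fun k => tail Omega s (p k) (phi_ k) x))) ->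
  {ae lebesgue, forall x, (~` Omega) x -> phi_ k x @[k --> \oo] --> phi x} ->
  (forall k, calW_ext Omega s (p k) (phi_ k) (u k)) ->
  (forall k, minimizer Omega s (p k) (u k)) ->
  exists (k : nat -> nat) (u1 : lebesgueRn R n -> R),
    [/\ {homo k : i j / (i < j)%N} /\ decreases_to (p \o k) 1,
        calW_ext Omega s 1 phi u1,
        (\int[lebesgue]_(x in Omega) `|u (k j) x - u1 x|%:E)%E @[j --> \oo]
          --> 0%E /\
        {ae lebesgue, forall x, u (k j) x @[j --> \oo] --> u1 x},
        lebesgue.-integrable Omega (tail Omega s 1 phi) &
        minimizer Omega s 1 u1].
Proof.
move=> oO bO lO s01 p_gt1 [p_dec p_cvg] iS phi_cvg u_ext um.
have mO : measurable Omega by exact: open_lebesgue.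
have mC : measurable (~` Omega) by exact: measurableC.
have mu_ k : measurable_fun setT (u k) by have [[]] := um k.
have tailE k x : tail Omega s (p k) (phi_ k) x = gtail lebesgue (~` Omega) (fker s (p k)) (p k) (u k) x.
  exact: (tail_ae s (p k) x mO (mu_ k) (u_ext k).2).
have tail0 k x : Omega x -> (0 <= tail Omega s (p k) (phi_ k) x)%E.
  by move=> _; rewrite tailE; apply: gtail_ge0 => a b; exact: frac_kernel_ge0.
have [g [G [mg g0 iG tg]]] := integrable_sup_majorant mO tail0 iS.
have [N pN] := eventually_le2 p_cvg.
have p12 k : 1 <= p (k + N)%N <= 2 by rewrite (ltW (p_gt1 _)) pN.
have tgN : {ae lebesgue, forall x, Omega x -> forall k,
    (gtail lebesgue (~` Omega) (fker s (p (k + N)%N)) (p (k + N)%N) (u (k + N)%N) x <= (g x)%:E)%E}.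
  by apply: (ae_mono tg) => x h Ox k; rewrite -tailE; exact: h.
have [k0 k0h k0c] := @minimizers_compactness R n s Omega (fun k => p (k + N)%N) (fun k => u (k + N)%N) g G
  n_gt0 s01 oO bO p12 (fun k => um (k + N)%N) mg iG g0 tgN.
pose k j := (k0 j + N)%N.
have kh : {homo k : i j / (i < j)%N} by move=> i j ij; rewrite /k ltn_add2r; exact: k0h.
have mukO j : measurable_fun Omega (u (k j)).
  exact: (measurable_funS measurableT (@subsetT _ Omega) (mu_ (k j))).
have cO : {ae lebesgue, forall x, Omega x -> cvgn (fun j => u (k j) x)}.
  exact: (@fast_cauchy_ae _ _ _ lebesgue Omega (fun j => u (k j)) mO mukO k0c).
have cC : {ae lebesgue, forall x, (~` Omega) x -> u (k j) x @[j --> \oo] --> phi x}.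
  have uphi : {ae lebesgue, forall x, forall j, (~` Omega) x -> u j x = phi_ j x}.
    exact: (ae_all (fun j => (u_ext j).2)).
  apply: (ae_mono (ae_and phi_cvg uphi)) => x [px ux] Cx.
  apply: (@cvg_subsequence R (fun j => u j x) k (phi x) kh).
  have -> : (fun j => u j x) = (fun j => phi_ j x) by apply/funext => j; exact: ux.
  exact: px.
pose u1 := pointwise_limit (fun j => u (k j)).
have mu1 : measurable_fun setT u1 by apply: measurable_pointwise_limit => j; exact: mu_.
have u1C : ae_eq lebesgue (~` Omega) u1 phi.
  by apply: (ae_mono cC) => x h Cx; exact: (pointwise_limitE (h Cx)).
have u_cvg : {ae lebesgue, forall x, u (k j) x @[j --> \oo] --> u1 x}.
  apply: (ae_mono (ae_and cO cC)) => x [hO hC].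
  have [Ox|Cx] := pselect (Omega x).
    have /cvg_ex[l hl] := hO Ox.
    by rewrite /u1 (pointwise_limitE hl).
  by rewrite /u1 (pointwise_limitE (hC Cx)); exact: hC.
have p12k j : 1 <= p (k j) <= 2 by exact: p12.
have pk_cvg : p (k j) @[j --> \oo] --> (1 : R) by exact: (cvg_subsequence kh p_cvg).
have umk j : minimizer Omega s (p (k j)) (u (k j)) by exact: um.
have tgk : {ae lebesgue, forall x, Omega x -> forall j,
    (gtail lebesgue (~` Omega) (fker s (p (k j))) (p (k j)) (u (k j)) x <= (g x)%:E)%E}.
  by apply: (ae_mono tgN) => x h Ox j; exact: h.
have u1m : minimizer Omega s 1 u1.
  exact: (@limit_minimizer R n s n_gt0 s01 Omega oO bO lO (fun j => p (k j)) (fun j => u (k j)) u1 g G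
    p12k pk_cvg umk mg iG g0 tgk mu1 u_cvg).
have tail_lty : (\int[lebesgue]_(x in Omega) gtail lebesgue (~` Omega) (fker s 1) 1 u1 x <= G%:E)%E.
  exact: (@limit_tail_bound R n s s01 Omega oO (fun j => p (k j)) (fun j => u (k j)) u1 g G
    p12k pk_cvg umk mg iG g0 tgk mu1 u_cvg).
have tail1E x : tail Omega s 1 phi x = gtail lebesgue (~` Omega) (fker s 1) 1 u1 x.
  exact: (tail_ae s 1 x mO mu1 u1C).
exists k, u1; split.
- split; first exact: kh.
  split; last exact: pk_cvg.
  by move=> i j ij; exact: (p_dec _ _ (ltnW_homo kh ij)).
- by split; [have [] := u1m|exact: u1C].
- split; last exact: u_cvg.
  have u_cvgO : {ae lebesgue, forall x, Omega x -> u (k j) x @[j --> \oo] --> u1 x}.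
    by apply: (ae_mono u_cvg) => x h _.
  exact: (@fast_cauchy_L1 _ _ _ lebesgue Omega (fun j => u (k j)) mO mukO k0c u1
    (measurable_funS measurableT (@subsetT _ Omega) mu1) u_cvgO).
- have -> : tail Omega s 1 phi = gtail lebesgue (~` Omega) (fker s 1) 1 u1 by apply/funext.
  have K0 (a b : lebesgueRn R n) : 0 <= fker s 1 a b by exact: frac_kernel_ge0.
  have t0 x : (0 <= gtail lebesgue (~` Omega) (fker s 1) 1 u1 x)%E by exact: gtail_ge0.
  apply/integrableP; split.
    apply: (measurable_funS measurableT (@subsetT _ Omega)).
    exact: (measurable_gtail lebesgue mC (@measurable_frac_kernel R n s 1) K0 1 mu1).
  have -> : (\int[lebesgue]_(x in Omega) `|gtail lebesgue (~` Omega) (fker s 1) 1 u1 x| =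
      \int[lebesgue]_(x in Omega) gtail lebesgue (~` Omega) (fker s 1) 1 u1 x)%E.
    by apply: eq_integral => x _; exact: (gee0_abs (t0 x)).
  exact: (le_lt_trans tail_lty (ltry G)).
- exact: u1m.
Qed.
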